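(* For $s,t\in\mathbb{R}$ let $v_s(t)=(1-ist-e^{-ist})/t^2$ for $t\neq 0$ and $v_s(0)=s^2/2$. For $f\in\mathcal{A}_c(\mathbb{R})$ with primitive $F$ define $\Omega_f(s)=\int_{-\infty}^{\infty} v_s f$. Then: (a) $|\Omega_f(s)|\le c\|f\|s^2$ for all $s\in\mathbb{R}$, where $c=\int_{-\infty}^\infty|v_1'(t)|\,dt=\mathrm{var}(v_1)$. Consequently $\Omega_f$ is differentiable at $0$ with $\Omega_f'(0)=0$. The constant $c$ is the best possible (i.e. no smaller constant makes the inequality hold for all $f\in\mathcal{A}_c(\mathbb{R})$ and $s$). (b) $\Omega_f(s)\sim F(\infty)s^2/2$ as $s\to 0$. Also $\Omega_f(s)=o(s^2)$ as $|s|\to\infty$, and this growth estimate is sharp: for every $\psi:[0,\infty)\to(0,\infty)$ with $\psi(s)=o(s^2)$ as $s\to\infty$ there exists $f\in\mathcal{A}_c(\mathbb{R})$ (which may even be chosen Henstock--Kurzweil integrable) such that $\Omega_f(s)/\psi(s)\not\to 0$ as $s\to\infty$. (c) There is a constant $k$ (independent of $f$, $s$, $h$) such that for each $s\in\mathbb{R}$ and $0<|h|<1/e$, $$|\Omega_f(s+h)-\Omega_f(s)|\le k\|f\|\big(|s|\,|h|\,|\log|h||+(s^2+1)|h|\big).$$ Consequently $\Omega_f$ is continuous on $\mathbb{R}$ and Hölder continuous on each compact interval of $\mathbb{R}$ with every exponent $0<\alpha<1$. (d) $\Omega_f$ need not be Lipschitz continuous: there exists $f\in\mathcal{A}_c(\mathbb{R})$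 for which $\Omega_f$ is not Lipschitz continuous. (e) Let $1<\rho<\infty$ and $1/\rho+1/\sigma=1$, and let $u_s(t)=(1-e^{-ist})/(it)$. Then for all $s,h\in\mathbb{R}$, $$|\Omega_f(s+h)-\Omega_f(s)|\le\|f\|\Big[\mathrm{var}(v_1)h^2+\|u_1'\|_\rho\|u_1\|_\sigma|h|^{2-1/\rho}|s|^{1/\rho}+\|u_1\|_\rho\|u_1'\|_\sigma|h|^{1-1/\rho}|s|^{1+1/\rho}\Big].$$
   Context: A function $F:[-\infty,\infty]\to\mathbb{C}$ is continuous on the extended real line if it is continuous on $\mathbb{R}$ and the limits $F(\pm\infty)=\lim_{x\to\pm\infty}F(x)$ exist. $\mathcal{B}_c(\mathbb{R})$ is the set of such $F$ with $F(-\infty)=0$. $\mathcal{A}_c(\mathbb{R})$ is the set of tempered distributions $f$ with $f=F'$ (distributional derivative) for some (unique) $F\in\mathcal{B}_c(\mathbb{R})$, called the primitive of $f$; the continuous primitive integral is $\int_a^b f=F(b)-F(a)$ and the Alexiewicz norm is $\|f\|=\sup_{x\in\mathbb{R}}|F(x)|$. For $g$ of bounded variation on $\mathbb{R}$, $\int_{-\infty}^\infty fg=F(\infty)g(\infty)-\int_{-\infty}^\infty F\,dg$ (Stieltjes integral). $\mathcal{A}_c(\mathbb{R})$ contains $L^1(\mathbb{R})$ and the Henstock--Kurzweil integrable functions. $\mathrm{var}$ denotes total variation on $\mathbb{R}$; $v_1'$, $u_1'$ denote derivatives in $t$; $\|\cdot\|_\rho$ is the $L^\rho(\mathbb{R})$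 norm. *)

(* Defs.v *)
From Stdlib Require Import Reals Lra ClassicalEpsilon.
From Coquelicot Require Export Coquelicot.
Open Scope R_scope.

Fixpoint csum (n : nat) (f : nat -> C) : C :=
  match n with O => RtoC 0 | S m => Cplus (csum m f) (f m) end.

(* real power x^y for x > 0, and 0 for x <= 0 (only used with y > 0) *)
Definition rpow (x y : R) : R :=
  if Rlt_dec 0 x then Rpower x y else 0.

Definition cexp (z : C) : C :=
  (exp (Re z) * cos (Im z), exp (Re z) * sin (Im z)).

Definition ci : C := (0, 1).

Definition lim_pinf (g : R -> C) : C :=
  epsilon (inhabits (RtoC 0))
    (fun l => filterlim g (Rbar_locally p_infty) (locally l)).

Definition cderiv (g : R -> C) (t : R) : C :=
  epsilon (inhabits (RtoC 0)) (fun l => is_derive g t l).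

Fixpoint rsum (n : nat) (f : nat -> R) : R :=
  match n with O => 0 | S m => rsum m f + f m end.

Definition tvar (g : R -> C) : Rbar :=
  Lub_Rbar (fun y => exists (n : nat) (x : nat -> R),
    (forall i, (i < n)%nat -> x i <= x (S i)) /\
    y = rsum n (fun i => Cmod (Cminus (g (x (S i))) (g (x i))))).

Definition ex_int_R (g : R -> R) : Prop :=
  ex_RInt_gen g (Rbar_locally m_infty) (Rbar_locally p_infty).
Definition int_R (g : R -> R) : R :=
  RInt_gen g (Rbar_locally m_infty) (Rbar_locally p_infty).

Definition Lp_integrable (p : R) (g : R -> C) : Prop :=
  ex_int_R (fun t => rpow (Cmod (g t)) p).
Definition Lnorm (p : R) (g : R -> C) : R :=
  rpow (int_R (fun t => rpow (Cmod (g t)) p)) (1 / p).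

Definition tagged_partition (a b : R) (n : nat) (x xi : nat -> R) : Prop :=
  x O = a /\ x n = b /\
  (forall i, (i < n)%nat -> x i <= xi i <= x (S i)).

Definition RS_sum (F g : R -> C) (n : nat) (x xi : nat -> R) : C :=
  csum n (fun i => Cmult (F (xi i)) (Cminus (g (x (S i))) (g (x i)))).

Definition is_RS_int (F g : R -> C) (a b : R) (l : C) : Prop :=
  forall eps : R, 0 < eps -> exists delta : R, 0 < delta /\
    forall n x xi, tagged_partition a b n x xi ->
      (forall i, (i < n)%nat -> x (S i) - x i < delta) ->
      Cmod (Cminus (RS_sum F g n x xi) l) < eps.

Definition is_RS_int_R (F g : R -> C) (l : C) : Prop :=
  forall eps : R, 0 < eps -> exists M : R, forall a b, a < - M -> M < b ->
    exists la, is_RS_int F g a b la /\ Cmod (Cminus la l) < eps.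

Definition RS_int_R (F g : R -> C) : C :=
  epsilon (inhabits (RtoC 0)) (is_RS_int_R F g).

(* An element f of A_c(R) is represented by its (unique) primitive F in B_c(R):
   F continuous on R, F(-oo) = 0, F(+oo) exists. *)
Definition in_Bc (F : R -> C) : Prop :=
  (forall x, continuous F x) /\
  filterlim F (Rbar_locally m_infty) (locally (RtoC 0)) /\
  (exists l : C, filterlim F (Rbar_locally p_infty) (locally l)).

Definition alex_norm (F : R -> C) : R :=
  real (Lub_Rbar (fun y => exists x, y = Cmod (F x))).

(* int_{-oo}^{oo} f g := F(oo) g(oo) - int F dg   (g of bounded variation) *)
Definition cp_int_mul (F g : R -> C) : C :=
  Cminus (Cmult (lim_pinf F) (lim_pinf g)) (RS_int_R F g).

Definition is_HK_int (g : R -> C) (a b : R) (l : C) : Prop :=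
  forall eps : R, 0 < eps -> exists delta : R -> R, (forall t, 0 < delta t) /\
    forall n x xi, tagged_partition a b n x xi ->
      (forall i, (i < n)%nat ->
          xi i - delta (xi i) < x i /\ x (S i) < xi i + delta (xi i)) ->
      Cmod (Cminus (csum n (fun i => Cmult (g (xi i)) (RtoC (x (S i) - x i)))) l)
        < eps.

(* the element of A_c with primitive F is the HK integrable function g:
   g is HK integrable on every compact interval with indefinite integral F
   (with F in B_c this means g is HK integrable on R and f = F' = g) *)
Definition HK_function_with_primitive (g F : R -> C) : Prop :=
  forall a b, a <= b -> is_HK_int g a b (Cminus (F b) (F a)).

Definition v (s t : R) : C :=
  if Req_EM_T t 0 then RtoC (s ^ 2 / 2)
  else Cdiv (Cminus (Cminus (RtoC 1) (Cmult ci (RtoC (s * t))))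
                    (cexp (Cmult ci (RtoC (- (s * t))))))
            (RtoC (t ^ 2)).

(* u_s(t) = (1 - e^{-i s t}) / (i t) for t <> 0, u_s(0) = s (continuous extension) *)
Definition u (s t : R) : C :=
  if Req_EM_T t 0 then RtoC s
  else Cdiv (Cminus (RtoC 1) (cexp (Cmult ci (RtoC (- (s * t))))))
            (Cmult ci (RtoC t)).

Definition Omega (F : R -> C) (s : R) : C := cp_int_mul F (v s).

(* Main.v *)
Require Import Defs.
From Stdlib Require Import Reals Lra Psatz ClassicalEpsilon FunctionalExtensionality.
From Coquelicot Require Import Coquelicot.
Open Scope R_scope.

(** Since v_s(t) = s^2 v_1(st) is C^1 and vanishes at infinity, Omega_F(s) = - int F v_s'
    and int |v_s'| = s^2 var(v_1), which gives (a); the constant is approached by continuous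
    dampings of -conj(v_1')/|v_1'|.  For (b), F is compared with F(oo) 1_{t>0} (as s -> 0) and
    with F(0) (as |s| -> oo) under the integral.  Sharpness: Re v_s >= 0 and Re v_s >= s^2/8 on
    |st| <= 1, so Re Omega_F(s) >= s^2 F(tau)/8 for monotone F >= 0 vanishing on t <= 0 and
    2 s tau <= 1, where F may grow from 0 as slowly as one likes.  For (c) and (e) one uses
    v_{s+h} = v_s + v_h + u_s u_h and bounds int |u_s' u_h| + |u_s u_h'|, pointwise for (c)
    and by Hoelder's inequality and scaling for (e). *)

(** * Complex-valued functions of a real variable *)

(** An element of A_c is seen only through its primitive, which is merely continuous, so no upper
    estimate may differentiate [F]: each one moves the derivative onto the kernel and becomes a
    bound on the integral of a nonnegative continuous majorant over all compact intervals. Since v_1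
    and u_1 have the form 0/0 at the origin, their decay is read off the denominator-free relations
    i t u_1 = 1 - e^{-it} and i t v_1 = 1 - u_1. In the identity for v_{s+h} the term v_h costs only
    O(h^2), while in the mixed products both factors decay like 1/|t| but at the different scales
    1/|s| and 1/|h|; the range between these scales produces the logarithm in (c). Claim (d) is a
    by-product of the sharpness in (b): Omega(0) = 0, so a Lipschitz Omega grows at most linearly,
    whereas (1+s)^{3/2} is still o(s^2). The primitive that witnesses sharpness is steep at the
    single point 0 and differentiable elsewhere, which is what makes its derivative
    Henstock-Kurzweil integrable. *)

Definition Cder (g : R -> C) (t : R) (l : C) : Prop :=
  is_derive (fun t => Re (g t)) t (Re l) /\ is_derive (fun t => Im (g t)) t (Im l).

Definition Ccont (f : R -> C) : Prop :=
  (forall x : R, continuous (fun t => Re (f t)) x) /\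
  (forall x : R, continuous (fun t => Im (f t)) x).

Lemma is_derive_Cder (g : R -> C) (t : R) (l : C) : is_derive g t l <-> Cder g t l.
Proof.
  split.
  - intros H. split.
    + apply (filterdiff_comp' g fst t (fun y => scal y l) fst H).
      apply filterdiff_linear. apply is_linear_fst.
    + apply (filterdiff_comp' g snd t (fun y => scal y l) snd H).
      apply filterdiff_linear. apply is_linear_snd.
  - intros [H1 H2].
    assert (H := filterdiff_comp'_2 (fun t => Re (g t)) (fun t => Im (g t))
       (fun x y => (x, y)) t (fun y => scal y (Re l)) (fun y => scal y (Im l))
       (fun x y => (x, y)) H1 H2).
    unfold is_derive.
    eapply filterdiff_ext_lin.
    + eapply filterdiff_ext.
      2: apply H.
      * intros y. unfold Re, Im. destruct (g y); reflexivity.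
      * eapply filterdiff_ext_lin. eapply filterdiff_ext.
        2: apply filterdiff_id. intros [y1 y2]; reflexivity.
        intros [y1 y2]; reflexivity.
    + intros y. destruct l; reflexivity.
Qed.

Lemma continuous_Ccont (f : R -> C) : (forall x : R, continuous f x) <-> Ccont f.
Proof.
  split.
  - intros H; split; intros x.
    + apply (continuous_comp f fst). apply H. destruct (f x). apply continuous_fst.
    + apply (continuous_comp f snd). apply H. destruct (f x). apply continuous_snd.
  - intros [H1 H2] x. unfold continuous.
    apply (filterlim_ext (fun t => (Re (f t), Im (f t)))).
    { intros y; destruct (f y); reflexivity. }
    replace (f x) with (Re (f x), Im (f x)) by (destruct (f x); reflexivity).
    intros P [eps HP].
    assert (A := H1 x _ (locally_ball (Re (f x)) eps)).
    assert (B := H2 x _ (locally_ball (Im (f x)) eps)).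
    unfold filtermap in *. generalize (filter_and _ _ A B).
    apply filter_imp. intros y [Ha Hb]. apply HP. split; assumption.
Qed.

Lemma continuous_Cmod (f : R -> C) : Ccont f -> forall x : R, continuous (fun t => Cmod (f t)) x.
Proof.
  intros H x. rewrite <- continuous_Ccont in H.
  apply (continuous_ext (fun t => @norm R_AbsRing C_R_NormedModule (f t))).
  { intros y. symmetry. apply Cmod_norm. }
  apply (continuous_comp f (@norm R_AbsRing C_R_NormedModule)); [apply H|].
  exact (@filterlim_norm R_AbsRing C_R_NormedModule (f x)).
Qed.

Lemma Cder_cont (g dg : R -> C) : (forall t, Cder g t (dg t)) -> Ccont g.
Proof.
  intros H; split; intros x; destruct (H x) as [A B];
  apply (ex_derive_continuous (V:=R_NormedModule)); eexists; eassumption.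
Qed.

Lemma Ccont_mult f g : Ccont f -> Ccont g -> Ccont (fun t => (f t * g t)%C).
Proof.
  intros [A B] [A' B']; split; intros x; simpl.
  - apply (continuous_minus (fun t => Re (f t) * Re (g t)) (fun t => Im (f t) * Im (g t)));
    apply (continuous_mult (K:=R_AbsRing)); auto.
  - apply (continuous_plus (fun t => Re (f t) * Im (g t)) (fun t => Im (f t) * Re (g t)));
    apply (continuous_mult (K:=R_AbsRing)); auto.
Qed.

Lemma Ccont_plus f g : Ccont f -> Ccont g -> Ccont (fun t => (f t + g t)%C).
Proof.
  intros [A B] [A' B']; split; intros x; simpl.
  - apply (continuous_plus (fun t => Re (f t)) (fun t => Re (g t))); auto.
  - apply (continuous_plus (fun t => Im (f t)) (fun t => Im (g t))); auto.
Qed.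

Lemma Ccont_opp f : Ccont f -> Ccont (fun t => (- f t)%C).
Proof.
  intros [A B]; split; intros x; simpl.
  - apply (continuous_opp (fun t => Re (f t))); auto.
  - apply (continuous_opp (fun t => Im (f t))); auto.
Qed.

Lemma Ccont_minus f g : Ccont f -> Ccont g -> Ccont (fun t => (f t - g t)%C).
Proof. intros; apply Ccont_plus; auto; apply Ccont_opp; auto. Qed.

Lemma Ccont_const c : Ccont (fun _ => c).
Proof. split; intros; apply continuous_const. Qed.

Lemma Ccont_RtoC (f : R -> R) : (forall x, continuous f x) -> Ccont (fun t => RtoC (f t)).
Proof. intros; split; intros; simpl; auto. apply continuous_const. Qed.

Lemma Ccont_comp (f : R -> C) (g : R -> R) :
  Ccont f -> (forall x, continuous g x) -> Ccont (fun t => f (g t)).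
Proof.
  intros [A B] H; split; intros x.
  - apply (continuous_comp g (fun t => Re (f t))); auto.
  - apply (continuous_comp g (fun t => Im (f t))); auto.
Qed.

(* Complex integrals are taken componentwise, so that only real Riemann
   integrals have to be manipulated. *)
Definition CI (f : R -> C) (a b : R) : C :=
  (RInt (fun t => Re (f t)) a b, RInt (fun t => Im (f t)) a b).

Lemma cont_ex_RInt (f : R -> R) a b : (forall x : R, continuous f x) -> ex_RInt f a b.
Proof. intros H; apply (ex_RInt_continuous (V:=R_CompleteNormedModule)); auto. Qed.

(** Bounding the two components separately would lose a constant factor, which the sharp constant in
    (a) does not allow; the pair is therefore read as one integral in the normed module C. *)
Lemma CI_Cmod_le (f : R -> C) (g : R -> R) (a b : R) :
  a <= b -> Ccont f -> (forall x : R, continuous g x) ->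
  (forall x, a <= x <= b -> Cmod (f x) <= g x) ->
  Cmod (CI f a b) <= RInt g a b.
Proof.
  intros Hab [A B] Hg H.
  rewrite Cmod_norm.
  apply (norm_RInt_le (V:=C_R_NormedModule) f g a b (CI f a b) (RInt g a b) Hab).
  - intros x Hx. rewrite <- Cmod_norm. auto.
  - apply (is_RInt_fct_extend_pair (U:=R_NormedModule) (V:=R_NormedModule)).
    + apply (RInt_correct (V:=R_CompleteNormedModule)). apply cont_ex_RInt, A.
    + apply (RInt_correct (V:=R_CompleteNormedModule)). apply cont_ex_RInt, B.
  - apply (RInt_correct (V:=R_CompleteNormedModule)). apply cont_ex_RInt, Hg.
Qed.

Lemma CI_plus f g a b : Ccont f -> Ccont g ->
  CI (fun t => (f t + g t)%C) a b = (CI f a b + CI g a b)%C.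
Proof.
  intros [A B] [A' B']. unfold CI. simpl.
  apply injective_projections; simpl.
  - apply (RInt_plus (V:=R_CompleteNormedModule)); apply cont_ex_RInt; auto.
  - apply (RInt_plus (V:=R_CompleteNormedModule)); apply cont_ex_RInt; auto.
Qed.

Lemma CI_ext f g a b : (forall t, f t = g t) -> CI f a b = CI g a b.
Proof.
  intros E. unfold CI. f_equal; apply RInt_ext; intros; rewrite E; auto.
Qed.

Lemma CI_scal c f a b : Ccont f -> CI (fun t => (c * f t)%C) a b = (c * CI f a b)%C.
Proof.
  intros [A B]. unfold CI.
  assert (HA : forall k, RInt (fun t => k * Re (f t)) a b = k * RInt (fun t => Re (f t)) a b).
  { intros k. apply (RInt_scal (V:=R_CompleteNormedModule)). apply cont_ex_RInt, A. }
  assert (HB : forall k, RInt (fun t => k * Im (f t)) a b = k * RInt (fun t => Im (f t)) a b).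
  { intros k. apply (RInt_scal (V:=R_CompleteNormedModule)). apply cont_ex_RInt, B. }
  assert (EA : forall k, ex_RInt (fun t => k * Re (f t)) a b).
  { intros k. apply (ex_RInt_scal (V:=R_CompleteNormedModule)). apply cont_ex_RInt, A. }
  assert (EB : forall k, ex_RInt (fun t => k * Im (f t)) a b).
  { intros k. apply (ex_RInt_scal (V:=R_CompleteNormedModule)). apply cont_ex_RInt, B. }
  apply injective_projections; simpl.
  - change (fst c) with (Re c); change (snd c) with (Im c).
    rewrite <- HA, <- HB. apply (RInt_minus (V:=R_CompleteNormedModule)); auto.
  - change (fst c) with (Re c); change (snd c) with (Im c).
    rewrite <- HA, <- HB. apply (RInt_plus (V:=R_CompleteNormedModule)); auto.
Qed.

Lemma CI_opp f a b : Ccont f -> CI (fun t => (- f t)%C) a b = (- CI f a b)%C.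
Proof.
  intros H. rewrite (CI_ext _ (fun t => (RtoC (-1) * f t)%C)).
  2: intros; apply injective_projections; simpl; ring.
  rewrite CI_scal; auto. apply injective_projections; simpl; ring.
Qed.

Lemma CI_minus f g a b : Ccont f -> Ccont g ->
  CI (fun t => (f t - g t)%C) a b = (CI f a b - CI g a b)%C.
Proof.
  intros Hf Hg. unfold Cminus. rewrite (CI_plus f (fun t => (- g t)%C)); auto.
  rewrite CI_opp; auto. apply Ccont_opp; auto.
Qed.

Lemma CI_Chasles f a b c : Ccont f -> (CI f a b + CI f b c)%C = CI f a c.
Proof.
  intros [A B]. unfold CI. apply injective_projections; simpl.
  - apply (RInt_Chasles (V:=R_CompleteNormedModule)); apply cont_ex_RInt; auto.
  - apply (RInt_Chasles (V:=R_CompleteNormedModule)); apply cont_ex_RInt; auto.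
Qed.

Lemma CI_const c a b : CI (fun _ => c) a b = (RtoC (b - a) * c)%C.
Proof.
  unfold CI. rewrite !RInt_const. apply injective_projections; simpl; unfold scal; simpl;
  unfold mult; simpl; change (fst c) with (Re c); change (snd c) with (Im c); ring.
Qed.

Lemma CI_derive (g dg : R -> C) a b :
  (forall t, Cder g t (dg t)) -> Ccont dg -> CI dg a b = (g b - g a)%C.
Proof.
  intros H [A B]. unfold CI. apply injective_projections; simpl.
  - apply is_RInt_unique.
    apply (is_RInt_derive (V:=R_CompleteNormedModule) (fun t => Re (g t))); intros; auto. apply H.
  - apply is_RInt_unique.
    apply (is_RInt_derive (V:=R_CompleteNormedModule) (fun t => Im (g t))); intros; auto. apply H.
Qed.

Lemma Cder_mult f g t df dg : Cder f t df -> Cder g t dg ->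
  Cder (fun t => (f t * g t)%C) t (df * g t + f t * dg)%C.
Proof.
  intros [A B] [A' B']; split; simpl;
  change (fst (f ?x)) with (Re (f x)) in *; auto.
  - eapply is_derive_ext. intros; reflexivity.
    evar_last.
    apply (is_derive_minus (fun t => Re (f t) * Re (g t)) (fun t => Im (f t) * Im (g t))).
    apply (is_derive_mult (fun t => Re (f t))); eauto. intros; apply Rmult_comm.
    apply (is_derive_mult (fun t => Im (f t))); eauto. intros; apply Rmult_comm.
    simpl. unfold minus, plus, opp, mult; simpl. unfold Re, Im. ring.
  - evar_last.
    apply (is_derive_plus (fun t => Re (f t) * Im (g t)) (fun t => Im (f t) * Re (g t))).
    apply (is_derive_mult (fun t => Re (f t))); eauto. intros; apply Rmult_comm.
    apply (is_derive_mult (fun t => Im (f t))); eauto. intros; apply Rmult_comm.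
    simpl. unfold minus, plus, opp, mult; simpl. unfold Re, Im. ring.
Qed.

Lemma Cder_plus f g t df dg : Cder f t df -> Cder g t dg ->
  Cder (fun t => (f t + g t)%C) t (df + dg)%C.
Proof.
  intros [A B] [A' B']; split; simpl.
  - apply (is_derive_plus (fun t => Re (f t)) (fun t => Re (g t))); auto.
  - apply (is_derive_plus (fun t => Im (f t)) (fun t => Im (g t))); auto.
Qed.

Lemma Cder_const c t : Cder (fun _ => c) t 0%C.
Proof. split; simpl; apply @is_derive_const. Qed.

Lemma Cder_scal c f t df : Cder f t df -> Cder (fun t => (c * f t)%C) t (c * df)%C.
Proof.
  intros H. replace (c * df)%C with (0 * f t + c * df)%C by ring.
  apply (Cder_mult (fun _ => c) f); auto. apply Cder_const.
Qed.

Lemma Cder_ext f g t d : (forall t, f t = g t) -> Cder f t d -> Cder g t d.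
Proof.
  intros E [A B]; split; eapply is_derive_ext. 2: apply A. 3: apply B.
  all: intros; simpl; rewrite E; auto.
Qed.

Lemma Cder_unique f t d d' : Cder f t d -> Cder f t d' -> d = d'.
Proof.
  intros [A B] [A' B']. apply injective_projections.
  - apply is_derive_unique in A. apply is_derive_unique in A'. unfold Re in *; congruence.
  - apply is_derive_unique in B. apply is_derive_unique in B'. unfold Im in *; congruence.
Qed.

Lemma Cder_comp_scal f s t d : Cder f (s * t) d ->
  Cder (fun t => f (s * t)) t (RtoC s * d)%C.
Proof.
  intros [A B]; split; simpl.
  - replace (s * fst d - 0 * snd d) with (s * fst d) by ring.
    apply (is_derive_comp (fun t => Re (f t)) (fun t => s * t)); auto.
    auto_derive; auto; ring.
  - replace (s * snd d + 0 * fst d) with (s * snd d) by ring.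
    apply (is_derive_comp (fun t => Im (f t)) (fun t => s * t)); auto.
    auto_derive; auto; ring.
Qed.

Lemma cderiv_unique g t l : Cder g t l -> cderiv g t = l.
Proof.
  intros H. unfold cderiv.
  assert (H' := proj2 (is_derive_Cder g t l) H).
  assert (E := epsilon_spec (inhabits (RtoC 0)) _ (ex_intro _ l H')).
  apply (Cder_unique g t); auto. apply is_derive_Cder. exact E.
Qed.

(** * Improper integrals and Riemann-Stieltjes integrals *)

Lemma RInt_le_cont (f g : R -> R) a b : a <= b -> (forall x : R, continuous f x) ->
  (forall x : R, continuous g x) -> (forall x, f x <= g x) -> RInt f a b <= RInt g a b.
Proof. intros. apply RInt_le; auto; apply cont_ex_RInt; auto. Qed.

Lemma RInt_nonneg (f : R -> R) a b : a <= b -> (forall x : R, continuous f x) ->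
  (forall x, 0 <= f x) -> 0 <= RInt f a b.
Proof. intros. apply RInt_ge_0; auto; apply cont_ex_RInt; auto. Qed.

Lemma RInt_Chasles_cont (f : R -> R) a b c : (forall x : R, continuous f x) ->
  RInt f a b + RInt f b c = RInt f a c.
Proof. intros. apply (RInt_Chasles (V:=R_CompleteNormedModule)); apply cont_ex_RInt; auto. Qed.

Lemma RInt_plus_cont (f g : R -> R) a b : (forall x : R, continuous f x) ->
  (forall x : R, continuous g x) -> RInt (fun x => f x + g x) a b = RInt f a b + RInt g a b.
Proof. intros. apply (RInt_plus (V:=R_CompleteNormedModule)); apply cont_ex_RInt; auto. Qed.

Lemma RInt_scal_cont (k : R) (f : R -> R) a b : (forall x : R, continuous f x) ->
  RInt (fun x => k * f x) a b = k * RInt f a b.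
Proof. intros. apply (RInt_scal (V:=R_CompleteNormedModule)); apply cont_ex_RInt; auto. Qed.

Lemma RInt_mono (f : R -> R) a b a' b' : a' <= a -> a <= b -> b <= b' ->
  (forall x : R, continuous f x) -> (forall x, 0 <= f x) -> RInt f a b <= RInt f a' b'.
Proof.
  intros H1 H2 H3 Hc Hp.
  rewrite <- (RInt_Chasles_cont f a' a b'), <- (RInt_Chasles_cont f a b b'); auto.
  assert (0 <= RInt f a' a) by (apply RInt_nonneg; auto).
  assert (0 <= RInt f b b') by (apply RInt_nonneg; auto). lra.
Qed.

(** Integrability over the line with integral at most [B], phrased through compact intervals so that
    majorants can be added, scaled and dilated without taking limits. *)
Definition bounded_integral (f : R -> R) (B : R) : Prop :=
  (forall x : R, continuous f x) /\ (forall x, 0 <= f x) /\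
  (forall a b, a <= b -> RInt f a b <= B).

Lemma bounded_integral_plus f g B D : bounded_integral f B -> bounded_integral g D -> bounded_integral (fun x => f x + g x) (B + D).
Proof.
  intros (A & P & H) (A' & P' & H'). split; [|split].
  - intros x. apply (continuous_plus f g); auto.
  - intros x. generalize (P x) (P' x); lra.
  - intros a b Hab. rewrite RInt_plus_cont; auto. generalize (H a b Hab) (H' a b Hab). lra.
Qed.

Lemma bounded_integral_scal k f B : 0 <= k -> bounded_integral f B -> bounded_integral (fun x => k * f x) (k * B).
Proof.
  intros Hk (A & P & H). split; [|split].
  - intros x. apply (continuous_scal_r k f); auto.
  - intros x. apply Rmult_le_pos; auto.
  - intros a b Hab. rewrite RInt_scal_cont; auto. apply Rmult_le_compat_l; auto.
Qed.

Lemma bounded_integral_le f g B : bounded_integral g B -> (forall x : R, continuous f x) ->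
  (forall x, 0 <= f x <= g x) -> bounded_integral f B.
Proof.
  intros (A & P & H) Hc Hl. split; [auto|split].
  - intros; apply Hl.
  - intros a b Hab. eapply Rle_trans; [|apply (H a b Hab)].
    apply RInt_le_cont; auto. apply Hl.
Qed.

Lemma bounded_integral_weaken f B B' : bounded_integral f B -> B <= B' -> bounded_integral f B'.
Proof. intros (A & P & H) HB. split; [auto|split]; auto. intros; eapply Rle_trans; eauto. Qed.

(** Each half-line contributes at most [B]. The antiderivative is required only for t >= 0, so the
    kink of |t| at 0 does not matter. *)
Lemma bounded_integral_even (f G : R -> R) (B : R) :
  (forall t, 0 <= t -> continuous f t) -> (forall t, 0 <= t -> 0 <= f t) ->
  (forall t, 0 <= t -> is_derive G t (f t)) -> (forall t, 0 <= t -> G t - G 0 <= B) ->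
  bounded_integral (fun t => f (Rabs t)) (2 * B).
Proof.
  intros Hc Hp Hd HB.
  assert (C : forall x : R, continuous (fun t => f (Rabs t)) x).
  { intros x. apply (continuous_comp Rabs f). apply continuous_Rabs. apply Hc, Rabs_pos. }
  split; [exact C|split].
  - intros; apply Hp, Rabs_pos.
  - intros a b Hab.
    set (M := Rmax (Rabs a) (Rabs b)).
    assert (HM : 0 <= M) by (eapply Rle_trans; [apply (Rabs_pos a)|apply Rmax_l]).
    assert (a1 : - M <= a).
    { generalize (Rmax_l (Rabs a) (Rabs b)). fold M. generalize (Rle_abs (-a)). rewrite Rabs_Ropp. lra. }
    assert (b1 : b <= M).
    { generalize (Rmax_r (Rabs a) (Rabs b)). fold M. generalize (Rle_abs b). lra. }
    eapply Rle_trans. apply (RInt_mono _ a b (-M) M); auto. intros; apply Hp, Rabs_pos.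
    rewrite <- (RInt_Chasles_cont _ (-M) 0 M); auto.
    assert (E1 : RInt (fun t => f (Rabs t)) 0 M = G M - G 0).
    { apply is_RInt_unique. apply (is_RInt_ext f).
      - intros x. rewrite Rmin_left, Rmax_right; auto. intros [H1 H2].
        rewrite Rabs_right; auto; lra.
      - apply (is_RInt_derive (V:=R_CompleteNormedModule)).
        all: intros x; rewrite Rmin_left, Rmax_right by auto; intros [H1 H2]; auto. }
    assert (E2 : RInt (fun t => f (Rabs t)) (-M) 0 = G M - G 0).
    { apply is_RInt_unique. apply (is_RInt_ext (fun t => f (- t))).
      - intros x. rewrite Rmin_left, Rmax_right by lra. intros [H1 H2].
        rewrite Rabs_left; auto; lra.
      - replace (G M - G 0) with (minus ((fun t => - G (- t)) 0) ((fun t => - G (- t)) (-M))).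
        2: { unfold minus, plus, opp; simpl. rewrite Ropp_0, !Ropp_involutive. ring. }
        apply (is_RInt_derive (V:=R_CompleteNormedModule) (fun t => - G (- t))).
        all: intros x; rewrite Rmin_left, Rmax_right by lra; intros [H1 H2]; auto.
        + evar_last. apply (is_derive_opp (fun t => G (- t))).
          apply (is_derive_comp G (fun t => - t) x (f (- x)) (-1)). apply Hd; lra.
          auto_derive; auto; ring.
          unfold opp, scal, one; simpl. unfold mult; simpl. ring.
        + apply (continuous_comp (fun t => - t) f). apply (continuous_opp (V:=R_NormedModule) (fun t => t)), continuous_id.
          apply Hc; lra. }
    rewrite E1, E2. generalize (HB M HM). lra.
Qed.

Definition Rlimint (f : R -> R) (l : R) : Prop :=
  forall eps, 0 < eps -> exists M, 0 < M /\
    forall a b, a < - M -> M < b -> Rabs (RInt f a b - l) < eps.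

Lemma Rlimint_gen f l : (forall x : R, continuous f x) -> Rlimint f l ->
  is_RInt_gen f (Rbar_locally m_infty) (Rbar_locally p_infty) l.
Proof.
  intros Hc H P [eps HP]. destruct (H eps (cond_pos eps)) as [M [HM HH]].
  exists (fun a => a < - M) (fun b => M < b).
  - exists (- M); auto.
  - exists M; auto.
  - intros a b Ha Hb. exists (RInt f a b). split.
    + apply (RInt_correct (V:=R_CompleteNormedModule)), cont_ex_RInt; auto.
    + apply HP. apply HH; auto.
Qed.

(** Integrals of a nonnegative function increase with the interval, so their supremum is their
    limit. *)
Lemma bounded_integral_lim f B : bounded_integral f B -> exists l, Rlimint f l /\
  (forall a b, a <= b -> RInt f a b <= l) /\ l <= B.
Proof.
  intros (A & P & H).
  destruct (completeness (fun y => exists a b, a <= b /\ y = RInt f a b)) as [l [Hu Hl]].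
  - exists B. intros y (a & b & Hab & ->). auto.
  - exists (RInt f 0 0). exists 0, 0. split; auto; lra.
  - exists l. split; [|split].
    + intros eps He.
      assert (exists a b, a <= b /\ l - eps < RInt f a b) as (a & b & Hab & Hlt).
      { apply NNPP. intros N. assert (l <= l - eps); [|lra].
        apply Hl. intros y (a & b & Hab & ->).
        apply Rnot_lt_le. intros Hlt. apply N. exists a, b; auto. }
      exists (Rabs a + Rabs b + 1). generalize (Rabs_pos a) (Rabs_pos b); intros.
      split; [lra|]. intros a' b' Ha Hb.
      assert (a' <= a) by (generalize (Rle_abs (-a)); rewrite Rabs_Ropp; lra).
      assert (b <= b') by (generalize (Rle_abs b); lra).
      assert (RInt f a b <= RInt f a' b') by (apply RInt_mono; auto).
      assert (RInt f a' b' <= l) by (apply Hu; exists a', b'; split; auto; lra).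
      apply Rabs_def1; lra.
    + intros a b Hab; apply Hu; exists a, b; auto.
    + apply Hl. intros y (a & b & Hab & ->). auto.
Qed.

(** Absolute convergence reduces to the nonnegative case by h = (h + f) - f with 0 <= h + f <= 2
    f. *)
Lemma Rlimint_abs (h f : R -> R) B : (forall x : R, continuous h x) -> bounded_integral f B ->
  (forall x, Rabs (h x) <= f x) -> exists l, Rlimint h l.
Proof.
  intros Hh Hb Hle.
  assert (Hb2 : bounded_integral (fun x => h x + f x) (2 * B)).
  { apply (bounded_integral_le _ (fun x => 2 * f x)).
    - apply bounded_integral_scal; auto; lra.
    - intros x. apply (continuous_plus h f); auto. apply Hb.
    - intros x. generalize (Rabs_le_between (h x) (f x)). intros [K _]. specialize (K (Hle x)). lra. }
  destruct (bounded_integral_lim _ _ Hb) as (l & Hl & _).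
  destruct (bounded_integral_lim _ _ Hb2) as (l' & Hl' & _).
  exists (l' - l). intros eps He.
  destruct (Hl (eps / 2)) as (M & HM & K); [lra|].
  destruct (Hl' (eps / 2)) as (M' & HM' & K'); [lra|].
  exists (M + M'). split; [lra|]. intros a b Ha Hb'.
  specialize (K a b ltac:(lra) ltac:(lra)). specialize (K' a b ltac:(lra) ltac:(lra)).
  rewrite RInt_plus_cont in K'; auto. 2: apply Hb.
  apply Rabs_def2 in K. apply Rabs_def2 in K'. apply Rabs_def1; lra.
Qed.

(** * Improper integrals of complex functions *)

Definition Clim (H : R -> C) (l : C) : Prop :=
  forall eps, 0 < eps -> exists M, 0 < M /\
    forall a b, a < - M -> M < b -> Cmod (CI H a b - l) < eps.

Lemma Cmod_le_sum (z : C) : Cmod z <= Rabs (Re z) + Rabs (Im z).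
Proof.
  replace z with (RtoC (Re z) + Ci * RtoC (Im z))%C at 1.
  2: { apply injective_projections; simpl; unfold Re, Im; ring. }
  eapply Rle_trans. apply Cmod_triangle. rewrite Cmod_mult, !Cmod_R, Cmod_Ci. lra.
Qed.

Lemma im_le_Cmod (z : C) : Rabs (Im z) <= Cmod z.
Proof.
  unfold Cmod. rewrite <- (sqrt_Rsqr_abs). apply sqrt_le_1_alt. unfold Rsqr, Im. nra.
Qed.

Lemma Clim_ex H f B : Ccont H -> bounded_integral f B -> (forall t, Cmod (H t) <= f t) ->
  exists l, Clim H l.
Proof.
  intros [A D] Hb Hle.
  destruct (Rlimint_abs (fun t => Re (H t)) f B A Hb) as [l1 H1].
  { intros; eapply Rle_trans; [apply re_le_Cmod|auto]. }
  destruct (Rlimint_abs (fun t => Im (H t)) f B D Hb) as [l2 H2].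
  { intros; eapply Rle_trans; [apply im_le_Cmod|auto]. }
  exists (l1, l2). intros eps He.
  destruct (H1 (eps / 2)) as (M & HM & K); [lra|].
  destruct (H2 (eps / 2)) as (M' & HM' & K'); [lra|].
  exists (M + M'). split; [lra|]. intros a b Ha Hb'.
  specialize (K a b ltac:(lra) ltac:(lra)). specialize (K' a b ltac:(lra) ltac:(lra)).
  eapply Rle_lt_trans. apply Cmod_le_sum. simpl. unfold Rminus in *. lra.
Qed.

Lemma Clim_unique H l l' : Clim H l -> Clim H l' -> l = l'.
Proof.
  intros A B. apply NNPP. intros N.
  assert (P : 0 < Cmod (l - l')).
  { apply Cmod_gt_0. intros E. apply N.
    replace l with (l - l' + l')%C by ring. rewrite E. ring. }
  destruct (A (Cmod (l - l') / 2)) as (M & HM & K); [lra|].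
  destruct (B (Cmod (l - l') / 2)) as (M' & HM' & K'); [lra|].
  specialize (K (- (M + M') - 1) (M + M' + 1) ltac:(lra) ltac:(lra)).
  specialize (K' (- (M + M') - 1) (M + M' + 1) ltac:(lra) ltac:(lra)).
  set (z := CI _ _ _) in *.
  assert (Cmod (l - l') <= Cmod (z - l) + Cmod (z - l')); [|lra].
  rewrite <- (Cmod_opp (z - l)). replace (l - l')%C with (- (z - l) + (z - l'))%C by ring.
  apply Cmod_triangle.
Qed.

Lemma Clim_plus f g l l' : Ccont f -> Ccont g -> Clim f l -> Clim g l' ->
  Clim (fun t => f t + g t)%C (l + l')%C.
Proof.
  intros Hf Hg A B eps He.
  destruct (A (eps / 2)) as (M & HM & K); [lra|].
  destruct (B (eps / 2)) as (M' & HM' & K'); [lra|].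
  exists (M + M'). split; [lra|]. intros a b Ha Hb.
  specialize (K a b ltac:(lra) ltac:(lra)). specialize (K' a b ltac:(lra) ltac:(lra)).
  rewrite CI_plus; auto.
  replace (CI f a b + CI g a b - (l + l'))%C with ((CI f a b - l) + (CI g a b - l'))%C by ring.
  eapply Rle_lt_trans. apply Cmod_triangle. lra.
Qed.

Lemma Clim_opp f l : Ccont f -> Clim f l -> Clim (fun t => - f t)%C (- l)%C.
Proof.
  intros Hf A eps He.
  destruct (A eps He) as (M & HM & K). exists M; split; auto. intros a b Ha Hb.
  rewrite CI_opp; auto. replace (- CI f a b - - l)%C with (- (CI f a b - l))%C by ring.
  rewrite Cmod_opp. auto.
Qed.

Lemma Clim_le f l B : Clim f l -> (forall a b, a < 0 -> 0 < b -> Cmod (CI f a b) <= B) -> Cmod l <= B.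
Proof.
  intros A H. apply Rnot_lt_le. intros N.
  destruct (A (Cmod l - B)) as (M & HM & K); [lra|].
  specialize (K (-M-1) (M+1) ltac:(lra) ltac:(lra)).
  specialize (H (-M-1) (M+1) ltac:(lra) ltac:(lra)).
  assert (Cmod l <= Cmod (CI f (-M-1) (M+1) - l) + Cmod (CI f (-M-1) (M+1))); [|lra].
  rewrite <- (Cmod_opp (_ - _)).
  set (z := CI _ _ _). replace l with (- (z - l) + z)%C at 1 by ring. apply Cmod_triangle.
Qed.

Lemma Clim_bounded_integral_le H l f B : Ccont H -> bounded_integral f B -> (forall t, Cmod (H t) <= f t) ->
  Clim H l -> Cmod l <= B.
Proof.
  intros Hc Hb Hle A. apply (Clim_le H); auto. intros a b Ha Hb'.
  eapply Rle_trans; [apply (CI_Cmod_le H f); auto; try lra; apply Hb|]. apply Hb; lra.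
Qed.

(** * Riemann-Stieltjes integrals against continuously differentiable integrators *)

Lemma Ccont_unif (F : R -> C) a b eps : Ccont F -> 0 < eps -> exists delta, 0 < delta /\
  forall x y, a <= x <= b -> a <= y <= b -> Rabs (y - x) < delta -> Cmod (F y - F x) < eps.
Proof.
  intros HF He. rewrite <- continuous_Ccont in HF.
  destruct (unifcont_normed_1d (V:=C_R_NormedModule) F a b (fun x _ => HF x) (mkposreal _ He)) as [d Hd].
  exists d. split; [apply cond_pos|]. intros x y Hx Hy Hxy.
  specialize (Hd x y Hx Hy Hxy). unfold ball_norm in Hd. rewrite <- Cmod_norm in Hd. exact Hd.
Qed.

Lemma partition_range a b n x xi : tagged_partition a b n x xi ->
  forall i, (i <= n)%nat -> a <= x i <= b.
Proof.
  intros (H0 & Hn & H).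
  assert (M : forall j i, (i + j <= n)%nat -> x i <= x (i + j)%nat).
  { induction j; intros i Hi. rewrite Nat.add_0_r; lra.
    rewrite Nat.add_succ_r. specialize (H (i + j)%nat ltac:(lia)).
    specialize (IHj i ltac:(lia)). lra. }
  intros i Hi. split.
  - rewrite <- H0. apply (M i 0%nat). lia.
  - rewrite <- Hn. replace n with (i + (n - i))%nat by lia. apply M. lia.
Qed.

(** Each increment of g is the integral of g' over its cell, so the error on a cell is the integral
    of (F(xi) - F(t)) g'(t), controlled by the modulus of continuity of F times the integral of
    |g'|. *)
Lemma RS_C1 F g dg a b : a <= b -> Ccont F -> (forall t, Cder g t (dg t)) -> Ccont dg ->
  is_RS_int F g a b (CI (fun t => F t * dg t)%C a b).
Proof.
  intros Hab HF Hg Hdg eps He.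
  set (V := RInt (fun t => Cmod (dg t)) a b).
  assert (HV : 0 <= V).
  { apply RInt_nonneg; auto. apply continuous_Cmod; auto. intros; apply Cmod_ge_0. }
  (* The total error is at most w V; the added 1 keeps the denominator positive and makes w V < eps
     strict. *)
  set (w := eps / (V + 1)).
  assert (Hw : 0 < w) by (apply Rdiv_lt_0_compat; lra).
  destruct (Ccont_unif F a b w HF Hw) as (d & Hd & HU).
  exists d. split; auto. intros n x xi Hp Hm.
  assert (Hr := partition_range _ _ _ _ _ Hp). destruct Hp as (H0 & Hn & Hxi).
  assert (Cm := continuous_Cmod dg Hdg).
  assert (CF := Ccont_mult F dg HF Hdg).
  assert (K : forall m, (m <= n)%nat ->
    Cmod (csum m (fun i => F (xi i) * (g (x (S i)) - g (x i)))%C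
      - CI (fun t => F t * dg t)%C (x O) (x m)) <= w * RInt (fun t => Cmod (dg t)) (x O) (x m)).
  { induction m; intros Hmn.
    - simpl. unfold CI. rewrite !RInt_point.
      match goal with |- Cmod ?z <= _ => replace z with (RtoC 0) end.
      2:{ apply injective_projections; simpl; unfold zero; simpl; ring. }
      rewrite Cmod_0. unfold zero; simpl. lra.
    - specialize (IHm ltac:(lia)). simpl.
      rewrite <- (CI_Chasles _ (x O) (x m) (x (S m))); auto.
      rewrite <- (RInt_Chasles_cont _ (x O) (x m) (x (S m))); auto.
      rewrite Rmult_plus_distr_l.
      set (A := csum m _) in *. set (I1 := CI _ (x O) (x m)) in *.
      rewrite <- (CI_derive g dg (x m) (x (S m))); auto.
      rewrite <- CI_scal; auto.
      set (I2 := CI _ (x m) (x (S m))). set (I3 := CI _ (x m) (x (S m))).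
      replace (A + I2 - (I1 + I3))%C with ((A - I1) + (I2 - I3))%C by ring.
      eapply Rle_trans. apply Cmod_triangle. apply Rplus_le_compat; auto.
      unfold I2, I3. rewrite <- CI_minus; auto.
      2: apply (Ccont_mult (fun _ => F (xi m)) dg); auto; apply Ccont_const.
      rewrite <- RInt_scal_cont; auto.
      specialize (Hxi m ltac:(lia)). specialize (Hm m ltac:(lia)).
      assert (R1 := Hr m ltac:(lia)). assert (R2 := Hr (S m) ltac:(lia)).
      apply CI_Cmod_le; [lra| | |].
      + apply Ccont_minus; auto. apply (Ccont_mult (fun _ => F (xi m)) dg); auto; apply Ccont_const.
      + intros t. apply (continuous_scal_r w (fun t => Cmod (dg t))); auto.
      + intros t Ht. replace (F (xi m) * dg t - F t * dg t)%C with ((F (xi m) - F t) * dg t)%C by ring.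
        rewrite Cmod_mult. apply Rmult_le_compat_r. apply Cmod_ge_0.
        left. apply HU; try lra. apply Rabs_def1; lra. }
  unfold RS_sum. specialize (K n (Nat.le_refl n)). rewrite H0, Hn in K. fold V in K.
  eapply Rle_lt_trans. apply K. unfold w.
  apply (Rmult_lt_reg_r (V + 1)); [lra|]. field_simplify; [|lra]. nra.
Qed.

(** One more cell than the integer part of (b - a)/d makes the mesh strictly smaller than d. The
    tags are the left endpoints. *)
Lemma uniform_partition a b d : a < b -> 0 < d -> exists n x, tagged_partition a b n x x /\
  (forall i, (i < n)%nat -> x (S i) - x i < d) /\
  (forall i, (i < n)%nat -> x i <= x (S i)).
Proof.
  intros Hab Hd.
  destruct (nfloor_ex ((b - a) / d)) as [n0 [_ Hn]].
  { apply Rlt_le, Rdiv_lt_0_compat; lra. }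
  set (n := S n0). exists n, (fun i => a + INR i * ((b - a) / INR n)).
  assert (Hp : 0 < INR n) by (apply lt_0_INR; unfold n; lia).
  assert (0 < (b - a) / INR n) by (apply Rdiv_lt_0_compat; lra).
  assert ((b - a) / INR n < d).
  { unfold n. rewrite S_INR. apply (Rmult_lt_reg_r (INR n0 + 1)).
    unfold n in Hp; rewrite S_INR in Hp; auto.
    apply (Rmult_lt_compat_r d) in Hn; auto.
    unfold n in Hp; rewrite S_INR in Hp. field_simplify; [|lra]. field_simplify in Hn; lra. }
  split; [split; [|split]|split].
  - simpl; ring.
  - field. lra.
  - intros i Hi. rewrite S_INR. lra.
  - intros i Hi. rewrite S_INR. lra.
  - intros i Hi. rewrite S_INR. lra.
Qed.

Lemma RS_unique F g a b l l' : a < b -> is_RS_int F g a b l -> is_RS_int F g a b l' -> l = l'.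
Proof.
  intros Hab A B. apply NNPP. intros N.
  assert (P : 0 < Cmod (l - l')).
  { apply Cmod_gt_0. intros E. apply N.
    replace l with (l - l' + l')%C by ring. rewrite E. ring. }
  destruct (A (Cmod (l - l') / 2)) as (d & Hd & K); [lra|].
  destruct (B (Cmod (l - l') / 2)) as (d' & Hd' & K'); [lra|].
  destruct (uniform_partition a b (Rmin d d') Hab) as (n & x & Hp & Hm & _).
  { apply Rmin_pos; auto. }
  specialize (K n x x Hp). specialize (K' n x x Hp).
  assert (K1 := K ltac:(intros; eapply Rlt_le_trans; [apply Hm; auto|apply Rmin_l])).
  assert (K2 := K' ltac:(intros; eapply Rlt_le_trans; [apply Hm; auto|apply Rmin_r])).
  set (z := RS_sum _ _ _ _ _) in *.
  assert (Cmod (l - l') <= Cmod (z - l) + Cmod (z - l')); [|lra].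
  rewrite <- (Cmod_opp (z - l)). replace (l - l')%C with (- (z - l) + (z - l'))%C by ring.
  apply Cmod_triangle.
Qed.

(** [RS_int_R] is a chosen value, so existence alone does not identify it: any admissible value is
    turned back into a limit of proper integrals, where uniqueness is available. *)
Lemma RS_int_R_C1 F g dg l : Ccont F -> (forall t, Cder g t (dg t)) -> Ccont dg ->
  Clim (fun t => F t * dg t)%C l -> RS_int_R F g = l.
Proof.
  intros HF Hg Hdg Hl.
  assert (E : is_RS_int_R F g l).
  { intros eps He. destruct (Hl eps He) as (M & HM & K). exists M. intros a b Ha Hb.
    exists (CI (fun t => F t * dg t)%C a b). split; auto.
    apply RS_C1; auto; lra. }
  unfold RS_int_R.
  assert (E' := epsilon_spec (inhabits (RtoC 0)) _ (ex_intro _ l E)).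
  set (l' := epsilon _ _) in *.
  apply (Clim_unique (fun t => F t * dg t)%C); auto.
  (* The threshold [M] of [is_RS_int_R] may be negative; the new one is positive and forces a <
     b. *)
  intros eps He. destruct (E' eps He) as (M & K). exists (Rabs M + 1).
  generalize (Rle_abs M) (Rabs_pos M); intros. split; [lra|].
  intros a b Ha Hb. destruct (K a b ltac:(lra) ltac:(lra)) as (la & H1 & H2).
  rewrite (RS_unique F g a b (CI (fun t => F t * dg t)%C a b) la); auto; try lra.
  apply RS_C1; auto; lra.
Qed.

(** * The kernels u and v *)

Section CosSinTransform.
Variable w : R -> R.
Hypothesis Hw : forall x : R, continuous w x.

(** Differentiation under the integral sign. The weight is kept arbitrary because differentiating
    only replaces [w] by x w(x), so one lemma serves both kernels. *)
Lemma is_derive_cos_transform (t : R) :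
  is_derive (fun t => RInt (fun x => w x * cos (x * t)) 0 1) t
    (- RInt (fun x => (x * w x) * sin (x * t)) 0 1).
Proof.
  assert (D : forall x t : R, is_derive (fun t => w x * cos (x * t)) t (- (x * w x * sin (x * t)))).
  { intros x s. auto_derive; auto. ring. }
  evar_last.
  apply (is_derive_RInt_param (fun t x => w x * cos (x * t)) 0 1 t).
  - apply filter_forall. intros s x _. eexists. apply D.
  - intros x _.
    apply (continuity_2d_pt_ext (fun u v => - (v * w v * sin (v * u)))).
    { intros a b. symmetry. apply is_derive_unique, D. }
    apply continuity_2d_pt_opp. apply continuity_2d_pt_mult. apply continuity_2d_pt_mult.
    apply continuity_2d_pt_id2.
    apply (continuity_1d_2d_pt_comp w (fun u v => v)).
    apply continuity_pt_filterlim, Hw. apply continuity_2d_pt_id2.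
    apply (continuity_1d_2d_pt_comp sin (fun u v => v * u)).
    apply continuity_sin.
    apply continuity_2d_pt_mult. apply continuity_2d_pt_id2. apply continuity_2d_pt_id1.
  - apply filter_forall. intros s. apply cont_ex_RInt. intros x.
    apply (continuous_mult (K:=R_AbsRing) w (fun x => _)); auto.
    apply continuous_comp. 2: apply continuous_cos.
    apply (continuous_mult (K:=R_AbsRing)). apply continuous_id. apply continuous_const.
  - simpl. transitivity (RInt (fun x => -1 * (x * w x * sin (x * t))) 0 1).
    + apply RInt_ext. intros x _. transitivity (- (x * w x * sin (x * t))). apply is_derive_unique, D.
      match goal with |- @eq _ ?a ?b => change (@eq R a b) end. ring.
    + rewrite RInt_scal_cont. simpl; ring.
      intros x. apply (continuous_mult (K:=R_AbsRing) (fun x => x * w x)).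
      apply (continuous_mult (K:=R_AbsRing) (fun x => x)); auto. apply continuous_id.
      apply continuous_comp. 2: apply continuous_sin.
      apply (continuous_mult (K:=R_AbsRing)). apply continuous_id. apply continuous_const.
Qed.

Lemma is_derive_sin_transform (t : R) :
  is_derive (fun t => RInt (fun x => w x * sin (x * t)) 0 1) t
    (RInt (fun x => (x * w x) * cos (x * t)) 0 1).
Proof.
  assert (D : forall x t : R, is_derive (fun t => w x * sin (x * t)) t (x * w x * cos (x * t))).
  { intros x s. auto_derive; auto. ring. }
  evar_last.
  apply (is_derive_RInt_param (fun t x => w x * sin (x * t)) 0 1 t).
  - apply filter_forall. intros s x _. eexists. apply D.
  - intros x _.
    apply (continuity_2d_pt_ext (fun u v => v * w v * cos (v * u))).
    { intros a b. symmetry. apply is_derive_unique, D. }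
    apply continuity_2d_pt_mult. apply continuity_2d_pt_mult.
    apply continuity_2d_pt_id2.
    apply (continuity_1d_2d_pt_comp w (fun u v => v)).
    apply continuity_pt_filterlim, Hw. apply continuity_2d_pt_id2.
    apply (continuity_1d_2d_pt_comp cos (fun u v => v * u)).
    apply continuity_cos.
    apply continuity_2d_pt_mult. apply continuity_2d_pt_id2. apply continuity_2d_pt_id1.
  - apply filter_forall. intros s. apply cont_ex_RInt. intros x.
    apply (continuous_mult (K:=R_AbsRing) w (fun x => _)); auto.
    apply continuous_comp. 2: apply continuous_sin.
    apply (continuous_mult (K:=R_AbsRing)). apply continuous_id. apply continuous_const.
  - simpl. apply RInt_ext. intros x _. apply is_derive_unique, D.
Qed.

End CosSinTransform.

(* Etr w t is the integral of w(x) e^{-ixt} over [0,1]; v_1 = Etr (1 - x) and u_1 = Etr 1,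
   which makes the smoothness of u_1 and v_1 at t = 0 evident. *)
Definition Etr (w : R -> R) (t : R) : C :=
  (RInt (fun x => w x * cos (x * t)) 0 1, - RInt (fun x => w x * sin (x * t)) 0 1).

Lemma Cder_Etr (w : R -> R) t : (forall x : R, continuous w x) ->
  Cder (Etr w) t (- ci * Etr (fun x => (x * w x)%R) t)%C.
Proof.
  intros Hw; split; unfold Etr; simpl.
  - evar_last. apply is_derive_cos_transform; auto. simpl; ring.
  - evar_last. apply (is_derive_opp (fun t => RInt (fun x => w x * sin (x * t)) 0 1)).
    apply is_derive_sin_transform; auto. unfold opp; simpl; ring.
Qed.

(** Each component is at most 1. The resulting 2 is not sharp, but it enters only auxiliary
    constants, never var(v_1). *)
Lemma Etr_bound (w : R -> R) t : (forall x : R, continuous w x) -> (forall x, 0 <= x <= 1 -> Rabs (w x) <= 1) ->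
  Cmod (Etr w t) <= 2.
Proof.
  intros Hw H1. eapply Rle_trans. apply Cmod_le_sum. simpl. rewrite Rabs_Ropp.
  assert (forall g : R -> R, (forall x : R, continuous g x) -> (forall x, Rabs (g x) <= 1) ->
    Rabs (RInt (fun x => w x * g (x * t)) 0 1) <= 1).
  { intros g Hg Hb. eapply Rle_trans. apply (abs_RInt_le_const _ 0 1 1); try lra.
    - apply cont_ex_RInt. intros x. apply (continuous_mult (K:=R_AbsRing) w (fun x => _)); auto.
      apply continuous_comp; auto.
      apply (continuous_mult (K:=R_AbsRing)). apply continuous_id. apply continuous_const.
    - intros x Hx. rewrite Rabs_mult. specialize (Hb (x * t)). specialize (H1 x Hx).
      generalize (Rabs_pos (w x)) (Rabs_pos (g (x * t))). nra.
    - lra. }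
  assert (A := H cos continuous_cos). assert (B := H sin continuous_sin).
  assert (Rabs (RInt (fun x => w x * cos (x * t)) 0 1) <= 1).
  { apply A. intros; apply Rabs_le, COS_bound. }
  assert (Rabs (RInt (fun x => w x * sin (x * t)) 0 1) <= 1).
  { apply B. intros; apply Rabs_le, SIN_bound. }
  lra.
Qed.

Lemma cexp_ci r : cexp (ci * RtoC r)%C = (cos r, sin r).
Proof.
  unfold cexp, ci. apply injective_projections; simpl.
  - replace (0 * r - 1 * 0) with 0 by ring. rewrite exp_0. replace (0 * 0 + 1 * r) with r by ring. ring.
  - replace (0 * r - 1 * 0) with 0 by ring. rewrite exp_0. replace (0 * 0 + 1 * r) with r by ring. ring.
Qed.

Lemma RInt_ext_all (f g : R -> R) a b : (forall x, f x = g x) -> RInt f a b = RInt g a b.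
Proof. intros H. apply RInt_ext. auto. Qed.

Lemma RInt_antiderivative (f G : R -> R) a b : (forall x : R, continuous f x) ->
  (forall x, is_derive G x (f x)) -> RInt f a b = G b - G a.
Proof.
  intros Hf HG. apply is_RInt_unique.
  apply (is_RInt_derive (V:=R_CompleteNormedModule) G f); auto.
Qed.

Ltac auto_cont := intros; apply (ex_derive_continuous (V:=R_NormedModule)); auto_derive; auto.

Lemma v_nonzero s t : t <> 0 ->
  v s t = ((1 - cos (s * t)) / t ^ 2, - ((s * t - sin (s * t)) / t ^ 2)).
Proof.
  intros Ht. unfold v. destruct (Req_EM_T t 0); [contradiction|].
  rewrite cexp_ci. rewrite cos_neg, sin_neg. unfold Cdiv.
  replace (/ RtoC (t ^ 2))%C with (RtoC (/ t ^ 2)).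
  2:{ rewrite RtoC_inv; auto. apply pow_nonzero; auto. }
  unfold ci. apply injective_projections; simpl; field; auto.
Qed.

Lemma u_nonzero s t : t <> 0 ->
  u s t = (sin (s * t) / t, - ((1 - cos (s * t)) / t)).
Proof.
  intros Ht. unfold u. destruct (Req_EM_T t 0); [contradiction|].
  rewrite cexp_ci. rewrite cos_neg, sin_neg. unfold Cdiv.
  replace (/ (ci * RtoC t))%C with (- ci * RtoC (/ t))%C.
  2:{ rewrite RtoC_inv by auto. field_simplify_eq.
      unfold ci. apply injective_projections; simpl; ring.
      split. intros E. apply n. apply RtoC_inj in E; auto.
      intros E. unfold ci in E. injection E. lra. }
  unfold ci. apply injective_projections; simpl; field; auto.
Qed.

(** This is Taylor's formula for e^{-it} at order two with integral remainder, divided by t^2. *)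
Lemma v1_Etr t : v 1 t = Etr (fun x => 1 - x) t.
Proof.
  destruct (Req_dec t 0) as [->|Ht].
  - unfold v. destruct (Req_EM_T 0 0); [|lra]. unfold Etr.
    rewrite (RInt_ext_all _ (fun x => 1 - x)).
    2:{ intros x. rewrite Rmult_0_r, cos_0. ring. }
    rewrite (RInt_ext_all (fun x => (1 - x) * sin (x * 0)) (fun x => 0)).
    2:{ intros x. rewrite Rmult_0_r, sin_0. ring. }
    rewrite (RInt_antiderivative (fun x => 1 - x) (fun x => x - x ^ 2 / 2)).
    + rewrite RInt_const. unfold scal; simpl. unfold mult; simpl.
      apply injective_projections; simpl; field.
    + auto_cont.
    + intros x; auto_derive; auto; field.
  - rewrite v_nonzero by auto. unfold Etr.
    rewrite (RInt_antiderivative (fun x => (1 - x) * cos (x * t))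
      (fun x => (1 - x) * sin (x * t) / t - cos (x * t) / t ^ 2)).
    rewrite (RInt_antiderivative (fun x => (1 - x) * sin (x * t))
      (fun x => - (1 - x) * cos (x * t) / t - sin (x * t) / t ^ 2)).
    + rewrite !Rmult_0_l, cos_0, sin_0, !Rmult_1_l.
      apply injective_projections; simpl; field; auto.
    + auto_cont.
    + intros x; auto_derive; auto; field; auto.
    + auto_cont.
    + intros x; auto_derive; auto; field; auto.
Qed.

Lemma u1_Etr t : u 1 t = Etr (fun x => 1) t.
Proof.
  destruct (Req_dec t 0) as [->|Ht].
  - unfold u. destruct (Req_EM_T 0 0); [|lra]. unfold Etr.
    rewrite (RInt_ext_all (fun x => 1 * cos (x * 0)) (fun x => 1)).
    2:{ intros x. rewrite Rmult_0_r, cos_0. ring. }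
    rewrite (RInt_ext_all (fun x => 1 * sin (x * 0)) (fun x => 0)).
    2:{ intros x. rewrite Rmult_0_r, sin_0. ring. }
    rewrite !RInt_const. unfold scal; simpl. unfold mult; simpl.
    apply injective_projections; simpl; field.
  - rewrite u_nonzero by auto. unfold Etr.
    rewrite (RInt_antiderivative (fun x => 1 * cos (x * t)) (fun x => sin (x * t) / t)).
    rewrite (RInt_antiderivative (fun x => 1 * sin (x * t)) (fun x => - cos (x * t) / t)).
    + rewrite !Rmult_0_l, cos_0, sin_0, !Rmult_1_l.
      apply injective_projections; simpl; field; auto.
    + auto_cont.
    + intros x; auto_derive; auto; field; auto.
    + auto_cont.
    + intros x; auto_derive; auto; field; auto.
Qed.

Lemma v_scal s t : v s t = (RtoC (s ^ 2) * v 1 (s * t))%C.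
Proof.
  destruct (Req_dec t 0) as [->|Ht].
  - rewrite Rmult_0_r. unfold v. destruct (Req_EM_T 0 0); [|lra].
    rewrite <- RtoC_mult. f_equal. field.
  - rewrite v_nonzero by auto. destruct (Req_dec s 0) as [->|Hs].
    + rewrite !Rmult_0_l, cos_0, sin_0. apply injective_projections; simpl; field; auto.
    + rewrite v_nonzero by (apply Rmult_integral_contrapositive; auto).
      rewrite !Rmult_1_l. apply injective_projections; simpl; field; auto.
Qed.

Lemma u_scal s t : u s t = (RtoC s * u 1 (s * t))%C.
Proof.
  destruct (Req_dec t 0) as [->|Ht].
  - rewrite Rmult_0_r. unfold u. destruct (Req_EM_T 0 0); [|lra].
    rewrite <- RtoC_mult. f_equal. field.
  - rewrite u_nonzero by auto. destruct (Req_dec s 0) as [->|Hs].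
    + rewrite !Rmult_0_l, cos_0, sin_0. apply injective_projections; simpl; field; auto.
    + rewrite u_nonzero by (apply Rmult_integral_contrapositive; auto).
      rewrite !Rmult_1_l. apply injective_projections; simpl; field; auto.
Qed.

(** Since 1/(it)^2 = -1/t^2, the product u_s u_h equals -(1 - e^{-ist})(1 - e^{-iht})/t^2; expanding
    it supplies exactly the failure of e^{-ist} to be additive in s. *)
Lemma v_add s h t : v (s + h) t = (v s t + v h t + u s t * u h t)%C.
Proof.
  destruct (Req_dec t 0) as [->|Ht].
  - unfold v, u. destruct (Req_EM_T 0 0); [|lra].
    rewrite <- RtoC_mult, <- !RtoC_plus. f_equal. field.
  - rewrite !v_nonzero, !u_nonzero by auto.
    replace ((s + h) * t) with (s * t + h * t) by ring. rewrite cos_plus, sin_plus.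
    apply injective_projections; simpl; field; auto.
Qed.

Definition dv1 (t : R) : C := (- ci * Etr (fun x => (x * (1 - x))%R) t)%C.
Definition du1 (t : R) : C := (- ci * Etr (fun x => (x * 1)%R) t)%C.
Definition dv (s t : R) : C := (RtoC (s ^ 3) * dv1 (s * t))%C.
Definition du (s t : R) : C := (RtoC (s ^ 2) * du1 (s * t))%C.

Lemma Cder_v1 t : Cder (v 1) t (dv1 t).
Proof.
  apply (Cder_ext (Etr (fun x => 1 - x))). intros; symmetry; apply v1_Etr.
  apply Cder_Etr. auto_cont.
Qed.

Lemma Cder_u1 t : Cder (u 1) t (du1 t).
Proof.
  apply (Cder_ext (Etr (fun x => 1))). intros; symmetry; apply u1_Etr.
  apply Cder_Etr. auto_cont.
Qed.

Lemma Cder_v s t : Cder (v s) t (dv s t).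
Proof.
  apply (Cder_ext (fun t => (RtoC (s ^ 2) * v 1 (s * t))%C)).
  { intros; symmetry; apply v_scal. }
  unfold dv. replace (RtoC (s ^ 3) * dv1 (s * t))%C with (RtoC (s ^ 2) * (RtoC s * dv1 (s * t)))%C.
  2:{ rewrite Cmult_assoc, <- RtoC_mult. do 2 f_equal. ring. }
  apply (Cder_scal _ (fun t => v 1 (s * t))). apply (Cder_comp_scal (v 1)). apply Cder_v1.
Qed.

Lemma Cder_u s t : Cder (u s) t (du s t).
Proof.
  apply (Cder_ext (fun t => (RtoC s * u 1 (s * t))%C)).
  { intros; symmetry; apply u_scal. }
  unfold du. replace (RtoC (s ^ 2) * du1 (s * t))%C with (RtoC s * (RtoC s * du1 (s * t)))%C.
  2:{ rewrite Cmult_assoc, <- RtoC_mult. do 2 f_equal. ring. }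
  apply (Cder_scal _ (fun t => u 1 (s * t))). apply (Cder_comp_scal (u 1)). apply Cder_u1.
Qed.

Lemma Ccont_Etr (w : R -> R) : (forall x : R, continuous w x) -> Ccont (Etr w).
Proof. intros H. eapply Cder_cont. intros t. apply Cder_Etr; auto. Qed.

Lemma Ccont_scal c f : Ccont f -> Ccont (fun t => (c * f t)%C).
Proof. intros. apply (Ccont_mult (fun _ => c)); auto. apply Ccont_const. Qed.

Lemma Ccont_dv1 : Ccont dv1.
Proof. apply Ccont_scal, Ccont_Etr. auto_cont. Qed.

Lemma Ccont_du1 : Ccont du1.
Proof. apply Ccont_scal, Ccont_Etr. auto_cont. Qed.

Lemma continuous_mult_const (s x : R) : continuous (fun t => s * t) x.
Proof. auto_cont. Qed.

Lemma Ccont_dv s : Ccont (dv s).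
Proof. apply Ccont_scal, (Ccont_comp dv1). apply Ccont_dv1. apply continuous_mult_const. Qed.

Lemma Ccont_du s : Ccont (du s).
Proof. apply Ccont_scal, (Ccont_comp du1). apply Ccont_du1. apply continuous_mult_const. Qed.

Lemma Ccont_u s : Ccont (u s).
Proof. eapply Cder_cont. intros; apply Cder_u. Qed.

Lemma dv_add s h t : dv (s + h) t = (dv s t + dv h t + (du s t * u h t + u s t * du h t))%C.
Proof.
  apply (Cder_unique (v (s + h)) t). apply Cder_v.
  apply (Cder_ext (fun t => v s t + v h t + u s t * u h t)%C).
  { intros; symmetry; apply v_add. }
  apply (Cder_plus (fun t => v s t + v h t)%C (fun t => u s t * u h t)%C).
  apply Cder_plus; apply Cder_v. apply Cder_mult; apply Cder_u.
Qed.

(** * Boundedness and decay of the kernels and of their derivatives *)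

Lemma Cmod_ci : Cmod ci = 1.
Proof. apply Cmod_Ci. Qed.

Lemma Cmod_u1 t : Cmod (u 1 t) <= 2.
Proof.
  rewrite u1_Etr. apply Etr_bound. auto_cont. intros; rewrite Rabs_R1; lra.
Qed.

Lemma Cmod_v1 t : Cmod (v 1 t) <= 2.
Proof.
  rewrite v1_Etr. apply Etr_bound. auto_cont. intros; apply Rabs_le; lra.
Qed.

Lemma Cmod_du1 t : Cmod (du1 t) <= 2.
Proof.
  unfold du1. rewrite Cmod_mult, Cmod_opp, Cmod_ci, Rmult_1_l. apply Etr_bound. auto_cont.
  intros; apply Rabs_le; lra.
Qed.

Lemma Cmod_dv1 t : Cmod (dv1 t) <= 2.
Proof.
  unfold dv1. rewrite Cmod_mult, Cmod_opp, Cmod_ci, Rmult_1_l. apply Etr_bound. auto_cont.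
  intros; apply Rabs_le; nra.
Qed.

(** The function e^{-it}, with the sign convention of the kernels. *)
Definition cis (t : R) : C := (cos t, - sin t).

Lemma Cmod_cis t : Cmod (cis t) = 1.
Proof.
  unfold Cmod, cis; simpl. replace (_ + _) with 1. apply sqrt_1.
  generalize (sin2_cos2 t); unfold Rsqr; lra.
Qed.

(** Clearing the denominator gives a form that also holds at t = 0 and can therefore be
    differentiated everywhere. *)
Lemma u1_eq t : (ci * RtoC t * u 1 t = 1 - cis t)%C.
Proof.
  destruct (Req_dec t 0) as [->|Ht].
  - unfold cis. rewrite cos_0, sin_0. apply injective_projections; simpl; ring.
  - rewrite u_nonzero by auto. rewrite Rmult_1_l. unfold cis, ci.
    apply injective_projections; simpl; field; auto.
Qed.

Lemma v1_eq t : (ci * RtoC t * v 1 t = 1 - u 1 t)%C.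
Proof.
  destruct (Req_dec t 0) as [->|Ht].
  - unfold u. destruct (Req_EM_T 0 0); [|lra]. ring.
  - rewrite u_nonzero, v_nonzero by auto. rewrite Rmult_1_l. unfold ci.
    apply injective_projections; simpl; field; auto.
Qed.

Lemma Cder_RtoC t : Cder (fun t => ci * RtoC t)%C t ci.
Proof.
  split; unfold ci; simpl; auto_derive; auto; ring.
Qed.

Lemma Cder_cis t : Cder cis t (- ci * cis t)%C.
Proof. split; unfold cis, ci; simpl; auto_derive; auto; ring. Qed.

Lemma Cder_opp f t df : Cder f t df -> Cder (fun t => (- f t)%C) t (- df)%C.
Proof.
  intros [A B]; split; simpl.
  - apply (is_derive_opp (fun t => Re (f t))); auto.
  - apply (is_derive_opp (fun t => Im (f t))); auto.
Qed.

(** Both sides are the derivative of i t u_1(t) = 1 - e^{-it}, once by the product rule and once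
    directly. No formula for u_1' with denominators is needed. *)
Lemma du1_eq t : (ci * u 1 t + ci * RtoC t * du1 t = ci * cis t)%C.
Proof.
  apply (Cder_unique (fun t => ci * RtoC t * u 1 t)%C t).
  - apply (Cder_mult (fun t => ci * RtoC t)%C (u 1)). apply Cder_RtoC. apply Cder_u1.
  - apply (Cder_ext (fun t => 1 + - cis t)%C). intros; rewrite u1_eq; auto.
    replace (ci * cis t)%C with (0 + - (- ci * cis t))%C by ring.
    apply (Cder_plus (fun _ => RtoC 1) (fun t => - cis t)%C). apply Cder_const.
    apply Cder_opp, Cder_cis.
Qed.

Lemma dv1_eq t : (ci * v 1 t + ci * RtoC t * dv1 t = - du1 t)%C.
Proof.
  apply (Cder_unique (fun t => ci * RtoC t * v 1 t)%C t).
  - apply (Cder_mult (fun t => ci * RtoC t)%C (v 1)). apply Cder_RtoC. apply Cder_v1.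
  - apply (Cder_ext (fun t => 1 + - u 1 t)%C). intros; rewrite v1_eq; auto.
    replace (- du1 t)%C with (0 + - du1 t)%C by ring.
    apply (Cder_plus (fun _ => RtoC 1) (fun t => - u 1 t)%C). apply Cder_const.
    apply Cder_opp, Cder_u1.
Qed.

Lemma Cmod_minus_le z w : Cmod (z - w) <= Cmod z + Cmod w.
Proof. unfold Cminus. eapply Rle_trans. apply Cmod_triangle. rewrite Cmod_opp. lra. Qed.

Lemma Cmod_ci_t (t : R) z : Cmod (ci * RtoC t * z) = Rabs t * Cmod z.
Proof. rewrite !Cmod_mult, Cmod_ci, Cmod_R. ring. Qed.

Lemma t_u1 t : Rabs t * Cmod (u 1 t) <= 2.
Proof.
  rewrite <- Cmod_ci_t, u1_eq. eapply Rle_trans. apply Cmod_minus_le.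
  rewrite Cmod_1, Cmod_cis. lra.
Qed.

Lemma t_v1 t : Rabs t * Cmod (v 1 t) <= 3.
Proof.
  rewrite <- Cmod_ci_t, v1_eq. eapply Rle_trans. apply Cmod_minus_le.
  rewrite Cmod_1. generalize (Cmod_u1 t). lra.
Qed.

Lemma t_du1 t : Rabs t * Cmod (du1 t) <= 3.
Proof.
  rewrite <- Cmod_ci_t. replace (ci * RtoC t * du1 t)%C with (ci * cis t - ci * u 1 t)%C.
  2:{ rewrite <- du1_eq. ring. }
  eapply Rle_trans. apply Cmod_minus_le.
  rewrite !Cmod_mult, Cmod_cis, Cmod_ci. generalize (Cmod_u1 t). lra.
Qed.

(** Both terms on the right are O(1/|t|), so v_1' gains a second power of 1/|t| and becomes
    integrable, unlike what the same bounds give for u_1'. *)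
Lemma t_dv1_le t : Rabs t * Cmod (dv1 t) <= Cmod (du1 t) + Cmod (v 1 t).
Proof.
  rewrite <- Cmod_ci_t. replace (ci * RtoC t * dv1 t)%C with (- du1 t - ci * v 1 t)%C.
  2:{ rewrite <- dv1_eq. ring. }
  eapply Rle_trans. apply Cmod_minus_le.
  rewrite Cmod_opp, Cmod_mult, Cmod_ci. lra.
Qed.

(** The bound on the function and the bound on |t| times the function are added. The constant 5 = 2
    + 3 is common to u_1, v_1 and u_1' so that they can be treated uniformly. *)
Lemma u1_decay t : Cmod (u 1 t) <= 5 / (1 + Rabs t).
Proof.
  generalize (t_u1 t) (Cmod_u1 t) (Rabs_pos t); intros.
  apply Rle_div_r; nra.
Qed.

Lemma v1_decay t : Cmod (v 1 t) <= 5 / (1 + Rabs t).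
Proof.
  generalize (t_v1 t) (Cmod_v1 t) (Rabs_pos t); intros.
  apply Rle_div_r; nra.
Qed.

Lemma du1_decay t : Cmod (du1 t) <= 5 / (1 + Rabs t).
Proof.
  generalize (t_du1 t) (Cmod_du1 t) (Rabs_pos t); intros.
  apply Rle_div_r; nra.
Qed.

(** Expanding (1 + |t|)^2 gives the three contributions 2, 2 (2 + 2) and 3 + 3, whose sum is 16. *)
Lemma dv1_decay t : Cmod (dv1 t) <= 16 / (1 + Rabs t) ^ 2.
Proof.
  generalize (t_dv1_le t) (Cmod_dv1 t) (Rabs_pos t) (Cmod_du1 t) (Cmod_v1 t)
   (t_du1 t) (t_v1 t) (Cmod_ge_0 (dv1 t)); intros.
  apply Rle_div_r. apply pow_lt; lra.
  assert (Rabs t * (Rabs t * Cmod (dv1 t)) <= Rabs t * (Cmod (du1 t) + Cmod (v 1 t))).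
  { apply Rmult_le_compat_l; auto. }
  nra.
Qed.

(** * Total variation and the integral representation of Omega *)

(** The scale [m] is free because these functions later serve as continuous substitutes for a cutoff
    at |t| = m. *)
Lemma bounded_integral_inv_square m : 0 < m -> bounded_integral (fun t => / (m + Rabs t) ^ 2) (2 * / m).
Proof.
  intros Hm. apply (bounded_integral_even (fun t => / (m + t) ^ 2) (fun t => - / (m + t))).
  - intros t Ht. apply (ex_derive_continuous (V:=R_NormedModule)). auto_derive. nra.
  - intros t Ht. apply Rlt_le, Rinv_0_lt_compat, pow_lt. lra.
  - intros t Ht. auto_derive. lra. field. lra.
  - intros t Ht. rewrite Rplus_0_r. assert (0 < / (m + t)) by (apply Rinv_0_lt_compat; lra). lra.
Qed.

Lemma bounded_integral_dilate f B s : s <> 0 -> bounded_integral f B -> bounded_integral (fun t => Rabs s * f (s * t)) B.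
Proof.
  intros Hs (A & P & H). split; [|split].
  - intros x. apply (continuous_scal_r (Rabs s) (fun t => f (s * t))).
    apply (continuous_comp (fun t => s * t) f); auto. apply continuous_mult_const.
  - intros x. apply Rmult_le_pos; auto. apply Rabs_pos.
  - intros a b Hab.
    assert (E : RInt (fun t => s * f (s * t)) a b = RInt f (s * a) (s * b)).
    { rewrite <- (Rplus_0_r (s * a)), <- (Rplus_0_r (s * b)).
      rewrite <- (RInt_comp_lin (V:=R_CompleteNormedModule)).
      apply RInt_ext_all. intros x. rewrite Rplus_0_r. reflexivity.
      apply cont_ex_RInt; auto. }
    destruct (Rle_or_lt 0 s).
    + rewrite Rabs_pos_eq by auto. rewrite E. apply H. nra.
    + rewrite Rabs_left by auto.
      rewrite (RInt_ext_all _ (fun t => (-1) * (s * f (s * t)))). 2: intros; ring.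
      rewrite RInt_scal_cont, E.
      2:{ intros x. apply (continuous_scal_r s (fun t => f (s * t))).
        apply (continuous_comp (fun t => s * t) f); auto. apply continuous_mult_const. }
      rewrite <- opp_RInt_swap. 2: apply cont_ex_RInt; auto.
      assert (K := H (s * b) (s * a) ltac:(nra)). unfold opp; simpl. lra.
Qed.

Lemma increment_le (g dg : R -> C) x y : (forall t, Cder g t (dg t)) -> Ccont dg -> x <= y ->
  Cmod (g y - g x) <= RInt (fun t => Cmod (dg t)) x y.
Proof.
  intros Hg Hc Hxy. rewrite <- (CI_derive g dg); auto.
  apply CI_Cmod_le; auto. apply continuous_Cmod; auto. intros; lra.
Qed.

Lemma RInt_const_mult (k a b : R) : RInt (fun _ => k) a b = (b - a) * k.
Proof. rewrite RInt_const. reflexivity. Qed.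

(** Both the integral of |g'| and the length of the chord are compared with |g'(x)| (y - x), each at
    a cost of w (y - x); hence the factor 2. *)
Lemma increment_ge (g dg : R -> C) x y w : (forall t, Cder g t (dg t)) -> Ccont dg -> x <= y ->
  (forall t, x <= t <= y -> Cmod (dg t - dg x) <= w) ->
  RInt (fun t => Cmod (dg t)) x y - 2 * w * (y - x) <= Cmod (g y - g x).
Proof.
  intros Hg Hc Hxy Hw. rewrite <- (CI_derive g dg); auto.
  assert (Cc := continuous_Cmod dg Hc).
  assert (A : RInt (fun t => Cmod (dg t)) x y <= (y - x) * (Cmod (dg x) + w)).
  { rewrite <- RInt_const_mult. apply RInt_le; auto. apply cont_ex_RInt; auto.
    apply ex_RInt_const. intros t Ht.
    replace (dg t) with (dg x + (dg t - dg x))%C by ring.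
    eapply Rle_trans. apply Cmod_triangle. apply Rplus_le_compat_l. apply Hw; lra. }
  assert (B : Cmod (CI (fun t => dg t - dg x)%C x y) <= (y - x) * w).
  { rewrite <- RInt_const_mult.
    apply CI_Cmod_le; auto. apply (Ccont_minus dg); auto. apply Ccont_const.
    intros; apply continuous_const. }
  rewrite (CI_minus dg (fun _ => dg x)) in B; auto. 2: apply Ccont_const.
  rewrite CI_const in B.
  assert (D : (y - x) * Cmod (dg x) <= Cmod (CI dg x y) + (y - x) * w).
  { replace ((y - x) * Cmod (dg x)) with (Cmod (RtoC (y - x) * dg x)).
    2:{ rewrite Cmod_mult, Cmod_R, Rabs_pos_eq; auto; lra. }
    set (z := (RtoC (y - x) * dg x)%C) in *.
    replace z with (CI dg x y - (CI dg x y - z))%C at 1 by ring.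
    eapply Rle_trans. apply Cmod_minus_le. lra. }
  lra.
Qed.

Lemma variation_le (g dg : R -> C) (x : nat -> R) n : (forall t, Cder g t (dg t)) -> Ccont dg ->
  (forall i, (i < n)%nat -> x i <= x (S i)) ->
  x O <= x n /\ rsum n (fun i => Cmod (g (x (S i)) - g (x i))) <= RInt (fun t => Cmod (dg t)) (x O) (x n).
Proof.
  intros Hg Hc. assert (Cc := continuous_Cmod dg Hc). induction n; intros Hx; simpl.
  - rewrite RInt_point. unfold zero; simpl. lra.
  - destruct IHn as [H1 H2]; auto. assert (H3 := Hx n ltac:(lia)). split; [lra|].
    rewrite <- (RInt_Chasles_cont _ (x O) (x n)); auto.
    generalize (increment_le g dg _ _ Hg Hc H3). lra.
Qed.

Lemma variation_ge (g dg : R -> C) a b eps : (forall t, Cder g t (dg t)) -> Ccont dg -> a < b ->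
  0 < eps -> exists n x, (forall i, (i < n)%nat -> x i <= x (S i)) /\
    RInt (fun t => Cmod (dg t)) a b - eps <= rsum n (fun i => Cmod (g (x (S i)) - g (x i))).
Proof.
  intros Hg Hc Hab He. assert (Cc := continuous_Cmod dg Hc).
  set (w := eps / (2 * (b - a))).
  assert (Hw : 0 < w) by (apply Rdiv_lt_0_compat; lra).
  destruct (Ccont_unif dg a b w Hc Hw) as (d & Hd & HU).
  destruct (uniform_partition a b d Hab Hd) as (n & x & Hp & Hm & Hx).
  exists n, x. split; auto.
  assert (Hr := partition_range _ _ _ _ _ Hp). destruct Hp as (H0 & Hn & _).
  assert (K : forall m, (m <= n)%nat -> RInt (fun t => Cmod (dg t)) (x O) (x m) - 2 * w * (x m - x O)
    <= rsum m (fun i => Cmod (g (x (S i)) - g (x i)))).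
  { induction m; intros Hmn; simpl.
    - rewrite RInt_point. unfold zero; simpl. lra.
    - specialize (IHm ltac:(lia)).
      rewrite <- (RInt_Chasles_cont _ (x O) (x m)); auto.
      assert (Q := increment_ge g dg (x m) (x (S m)) w Hg Hc (Hx m ltac:(lia))).
      assert (R1 := Hr m ltac:(lia)). assert (R2 := Hr (S m) ltac:(lia)).
      assert (R3 := Hm m ltac:(lia)).
      enough (RInt (fun t => Cmod (dg t)) (x m) (x (S m)) - 2 * w * (x (S m) - x m) <=
        Cmod (g (x (S m)) - g (x m))) by lra.
      apply Q. intros t Ht. left. apply HU; try lra. apply Rabs_def1; lra. }
  specialize (K n (Nat.le_refl n)). rewrite H0, Hn in K.
  replace (2 * w * (b - a)) with eps in K. auto. unfold w. field. lra.
Qed.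

(** Every variation sum lies below the integral of |g'|, and fine partitions of long intervals come
    arbitrarily close to it. *)
Lemma tvar_C1 (g dg : R -> C) B : (forall t, Cder g t (dg t)) -> Ccont dg ->
  bounded_integral (fun t => Cmod (dg t)) B ->
  exists l, tvar g = Finite l /\ Rlimint (fun t => Cmod (dg t)) l /\
    bounded_integral (fun t => Cmod (dg t)) l.
Proof.
  intros Hg Hc Hb. destruct (bounded_integral_lim _ _ Hb) as (l & Hl & Hle & _).
  exists l. split; [|split; [auto|]].
  - apply is_lub_Rbar_unique. split.
    + intros y (n & x & Hx & ->). destruct (variation_le g dg x n Hg Hc Hx). simpl.
      eapply Rle_trans; eauto.
    + intros b Hub.
      assert (K : forall eps, 0 < eps -> Rbar_le (l - eps) b).
      { intros eps He. destruct (Hl (eps / 2)) as (M & HM & H); [lra|].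
        specialize (H (-M-1) (M+1) ltac:(lra) ltac:(lra)). apply Rabs_def2 in H.
        destruct (variation_ge g dg (-M-1) (M+1) (eps/2) Hg Hc) as (n & x & Hx & Hv); try lra.
        eapply Rbar_le_trans. 2: apply Hub; exists n, x; split; [apply Hx|reflexivity].
        simpl. lra. }
      destruct b as [b| |]; simpl in *; auto.
      * apply le_epsilon. intros eps He. specialize (K eps He). lra.
      * apply (K 1). lra.
  - destruct Hb as (A & P & H). split; auto.
Qed.

Lemma bounded_integral_dv1 : bounded_integral (fun t => Cmod (dv1 t)) (16 * (2 * / 1)).
Proof.
  apply (bounded_integral_le _ (fun t => 16 * / (1 + Rabs t) ^ 2)).
  - apply bounded_integral_scal; [lra|]. apply bounded_integral_inv_square; lra.
  - apply continuous_Cmod, Ccont_dv1.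
  - intros; split. apply Cmod_ge_0. apply dv1_decay.
Qed.

Lemma tvar_v1 : exists l, tvar (v 1) = Finite l /\ Rlimint (fun t => Cmod (dv1 t)) l /\
    bounded_integral (fun t => Cmod (dv1 t)) l.
Proof. eapply tvar_C1. apply Cder_v1. apply Ccont_dv1. apply bounded_integral_dv1. Qed.

(** * Limits at infinity and the Alexiewicz norm *)

Lemma filterlim_C {T} (Fl : (T -> Prop) -> Prop) {FF : Filter Fl} (f : T -> C) (l : C) :
  filterlim f Fl (locally l) <-> forall eps, 0 < eps -> Fl (fun x => Cmod (f x - l) < eps).
Proof.
  split.
  - intros H eps He. specialize (H (fun z => Cmod (z - l) < eps)). apply H.
    apply (@locally_le_locally_norm R_AbsRing C_R_NormedModule).
    exists (mkposreal _ He). intros y Hy. unfold ball_norm in Hy. rewrite <- Cmod_norm in Hy. exact Hy.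
  - intros H P HP.
    apply (@locally_norm_le_locally R_AbsRing C_R_NormedModule) in HP.
    destruct HP as [eps HP]. unfold filtermap. generalize (H eps (cond_pos eps)). apply filter_imp.
    intros x Hx. apply HP. unfold ball_norm. rewrite <- Cmod_norm. exact Hx.
Qed.

Lemma lim_pinf_unique (g : R -> C) (l : C) : filterlim g (Rbar_locally p_infty) (locally l) -> lim_pinf g = l.
Proof.
  intros H. unfold lim_pinf.
  assert (E := epsilon_spec (inhabits (RtoC 0))
    (fun l : C => filterlim g (Rbar_locally p_infty) (locally l)) (ex_intro _ l H)).
  set (l' := epsilon _ _) in *.
  apply (@filterlim_locally_unique _ R_AbsRing C_R_NormedModule (Rbar_locally p_infty) _ g l' l E H).
Qed.

(** [alex_norm] reads an extended supremum as a real number, which would send infinity to 0;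
    boundedness rules this out. *)
Lemma is_lub_alex F M : (forall x, Cmod (F x) <= M) ->
  is_lub_Rbar (fun y => exists x, y = Cmod (F x)) (alex_norm F).
Proof.
  intros HM. unfold alex_norm. assert (H := Lub_Rbar_correct (fun y => exists x, y = Cmod (F x))).
  destruct (Lub_Rbar _) as [r| |] eqn:E; auto.
  - exfalso. destruct H as [_ H]. apply (H (Finite M)). intros y [x ->]. apply HM.
  - exfalso. destruct H as [H _]. apply (H (Cmod (F 0))). eauto.
Qed.

Lemma in_Bc_bounded F : in_Bc F -> exists M, forall x, Cmod (F x) <= M.
Proof.
  intros (Hc & Hm & l & Hp).
  assert (Hm' := proj1 (filterlim_C (Rbar_locally m_infty) F (RtoC 0)) Hm).
  assert (Hp' := proj1 (filterlim_C (Rbar_locally p_infty) F l) Hp).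
  clear Hm Hp; rename Hm' into Hm; rename Hp' into Hp.
  destruct (Hm 1 Rlt_0_1) as [a Ha]. destruct (Hp 1 Rlt_0_1) as [b Hb].
  apply continuous_Ccont in Hc. assert (Cc := continuous_Cmod F Hc).
  (* The thresholds [a] and [b] come in no particular order; this interval contains everything
     between them in either case. *)
  destruct (continuity_ab_maj (fun t => Cmod (F t)) (Rmin (a - 1) (b - 1)) (Rmax (a + 1) (b + 1))) as [m [H1 _]].
  - generalize (Rmin_l (a - 1) (b - 1)) (Rmax_l (a + 1) (b + 1)). lra.
  - intros x _. apply continuity_pt_filterlim. apply Cc.
  - exists (1 + Cmod l + Cmod (F m)). intros x.
    generalize (Cmod_ge_0 l) (Cmod_ge_0 (F m)). intros.
    destruct (Rlt_dec x a) as [L|L].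
    { specialize (Ha x L). unfold Cminus in Ha. replace (F x + - 0)%C with (F x) in Ha by ring. lra. }
    destruct (Rlt_dec b x) as [L'|L'].
    { specialize (Hb x L'). replace (F x) with (F x - l + l)%C by ring.
      eapply Rle_trans. apply Cmod_triangle. lra. }
    specialize (H1 x). generalize (Rmin_l (a - 1) (b - 1)) (Rmax_r (a + 1) (b + 1)); intros.
    specialize (H1 ltac:(lra)). lra.
Qed.

Lemma alex_norm_ge F x : in_Bc F -> Cmod (F x) <= alex_norm F.
Proof.
  intros H. destruct (in_Bc_bounded F H) as [M HM]. destruct (is_lub_alex F M HM) as [A _].
  apply (A (Cmod (F x))). eauto.
Qed.

Lemma alex_norm_le F M : (forall x, Cmod (F x) <= M) -> alex_norm F <= M.
Proof.
  intros H. destruct (is_lub_alex F M H) as [_ A]. apply (A (Finite M)).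
  intros y [x ->]. apply H.
Qed.

Lemma alex_norm_nonneg F : in_Bc F -> 0 <= alex_norm F.
Proof. intros H. eapply Rle_trans. apply (Cmod_ge_0 (F 0)). apply alex_norm_ge; auto. Qed.

Lemma in_Bc_Ccont F : in_Bc F -> Ccont F.
Proof. intros [H _]. apply continuous_Ccont, H. Qed.

Definition varv1 : R := real (tvar (v 1)).

Lemma varv1_spec : tvar (v 1) = Finite varv1 /\ Rlimint (fun t => Cmod (dv1 t)) varv1 /\
    bounded_integral (fun t => Cmod (dv1 t)) varv1.
Proof.
  destruct tvar_v1 as (l & E & H). unfold varv1. rewrite E. simpl. auto.
Qed.

Lemma Cmod_RtoC_pow s n : Cmod (RtoC (s ^ n)) = Rabs s ^ n.
Proof. rewrite Cmod_R. symmetry. apply RPow_abs. Qed.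

Lemma Cmod_dv s t : Cmod (dv s t) = Rabs s ^ 3 * Cmod (dv1 (s * t)).
Proof. unfold dv. rewrite Cmod_mult, Cmod_RtoC_pow. auto. Qed.

Lemma Cmod_du s t : Cmod (du s t) = Rabs s ^ 2 * Cmod (du1 (s * t)).
Proof. unfold du. rewrite Cmod_mult, Cmod_RtoC_pow. auto. Qed.

Lemma Cmod_u s t : Cmod (u s t) = Rabs s * Cmod (u 1 (s * t)).
Proof. rewrite u_scal, Cmod_mult, Cmod_R. auto. Qed.

Lemma bounded_integral_ext f g B : (forall x, f x = g x) -> bounded_integral f B -> bounded_integral g B.
Proof.
  intros E H. apply (bounded_integral_le _ f); auto.
  - intros x. apply (continuous_ext f); auto. apply H.
  - intros x. rewrite <- E. split; [apply H|lra].
Qed.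

Lemma bounded_integral_0 : bounded_integral (fun _ => 0) 0.
Proof.
  split; [|split]. intros; apply continuous_const. intros; lra.
  intros. rewrite RInt_const. unfold scal; simpl; unfold mult; simpl. lra.
Qed.

Lemma bounded_integral_dv s : bounded_integral (fun t => Cmod (dv s t)) (varv1 * s ^ 2).
Proof.
  destruct (Req_dec s 0) as [->|Hs].
  - apply (bounded_integral_ext (fun _ => 0)). { intros; rewrite Cmod_dv, Rabs_R0; ring. }
    replace (varv1 * 0 ^ 2) with 0 by ring. apply bounded_integral_0.
  - apply (bounded_integral_ext (fun t => s ^ 2 * (Rabs s * Cmod (dv1 (s * t))))).
    { intros t. rewrite Cmod_dv. rewrite <- (pow2_abs s). ring. }
    rewrite Rmult_comm. apply bounded_integral_scal. apply pow2_ge_0.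
    apply (bounded_integral_dilate (fun t => Cmod (dv1 t))); auto. apply varv1_spec.
Qed.

(** By scaling |v_s(t)| <= 5 s^2/(1 + |st|), which is at most 5|s|/|t|. *)
Lemma v_small s eps : 0 < eps -> exists M, 0 < M /\ forall t, M < Rabs t -> Cmod (v s t) < eps.
Proof.
  intros He. exists (5 * Rabs s / eps + 1).
  assert (P := Rabs_pos s).
  assert (0 <= 5 * Rabs s / eps) by (apply Rdiv_le_0_compat; lra).
  split; [lra|]. intros t Ht. rewrite v_scal, Cmod_mult, Cmod_RtoC_pow.
  assert (D := v1_decay (s * t)).
  assert (Q := Rabs_pos (s * t)).
  eapply Rle_lt_trans. apply Rmult_le_compat_l. apply pow2_ge_0. apply D.
  rewrite Rabs_mult in *.
  apply (Rmult_lt_reg_r (1 + Rabs s * Rabs t)); [lra|].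
  replace (Rabs s ^ 2 * (5 / (1 + Rabs s * Rabs t)) * (1 + Rabs s * Rabs t)) with (5 * Rabs s ^ 2) by (field; lra).
  assert (5 * Rabs s < eps * Rabs t).
  { apply (Rmult_lt_reg_r (/ eps)). apply Rinv_0_lt_compat; auto.
    replace (eps * Rabs t * / eps) with (Rabs t) by (field; lra).
    unfold Rdiv in Ht. lra. }
  nra.
Qed.

Lemma lim_pinf_v s : lim_pinf (v s) = 0%C.
Proof.
  apply lim_pinf_unique. apply (proj2 (filterlim_C (Rbar_locally p_infty) (v s) (RtoC 0))).
  intros eps He. destruct (v_small s eps He) as (M & HM & H). exists M. intros x Hx.
  replace (v s x - 0)%C with (v s x) by ring. apply H. rewrite Rabs_pos_eq; lra.
Qed.

(** The majorant ||f|| |v_s'| makes the improper integral converge, so the chosen Stieltjes value is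
    this limit; the boundary term drops out because v_s vanishes at infinity. *)
Lemma Omega_Clim F s : in_Bc F -> Clim (fun t => F t * dv s t)%C (- Omega F s)%C.
Proof.
  intros HF. assert (Hc := in_Bc_Ccont F HF).
  destruct (Clim_ex (fun t => F t * dv s t)%C (fun t => alex_norm F * Cmod (dv s t))
    (alex_norm F * (varv1 * s ^ 2))) as [l Hl].
  - apply Ccont_mult; auto. apply Ccont_dv.
  - apply bounded_integral_scal. apply alex_norm_nonneg; auto. apply bounded_integral_dv.
  - intros t. rewrite Cmod_mult. apply Rmult_le_compat_r. apply Cmod_ge_0. apply alex_norm_ge; auto.
  - unfold Omega, cp_int_mul. rewrite lim_pinf_v.
    rewrite (RS_int_R_C1 F (v s) (dv s) l); auto. 2: apply Cder_v. 2: apply Ccont_dv.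
    replace (- (lim_pinf F * 0 - l))%C with l by ring. auto.
Qed.

Lemma Omega_bound F s : in_Bc F -> Cmod (Omega F s) <= varv1 * alex_norm F * s ^ 2.
Proof.
  intros HF. rewrite <- Cmod_opp.
  replace (varv1 * alex_norm F * s ^ 2) with (alex_norm F * (varv1 * s ^ 2)) by ring.
  apply (Clim_bounded_integral_le (fun t => F t * dv s t)%C _ (fun t => alex_norm F * Cmod (dv s t))).
  - apply Ccont_mult. apply in_Bc_Ccont; auto. apply Ccont_dv.
  - apply bounded_integral_scal. apply alex_norm_nonneg; auto. apply bounded_integral_dv.
  - intros t. rewrite Cmod_mult. apply Rmult_le_compat_r. apply Cmod_ge_0. apply alex_norm_ge; auto.
  - apply Omega_Clim; auto.
Qed.

(** Common entry point for (c) and (e): after cancelling v_s' only v_h' and (u_s u_h)' remain, so it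
    suffices to bound the integral of their moduli. *)
Lemma Omega_increment F s h B : in_Bc F ->
  bounded_integral (fun t => Cmod (dv h t) + (Cmod (du s t) * Cmod (u h t) + Cmod (u s t) * Cmod (du h t))) B ->
  Cmod (Omega F (s + h) - Omega F s) <= alex_norm F * B.
Proof.
  intros HF Hb. assert (Hc := in_Bc_Ccont F HF).
  assert (C1 := Ccont_mult F (dv s) Hc (Ccont_dv s)).
  assert (C2 := Ccont_mult F (dv (s + h)) Hc (Ccont_dv (s + h))).
  assert (L := Clim_plus _ _ _ _ C2 (Ccont_opp _ C1) (Omega_Clim F (s + h) HF)
     (Clim_opp _ _ C1 (Omega_Clim F s HF))).
  rewrite <- Cmod_opp. replace (- (Omega F (s + h) - Omega F s))%C with
    (- Omega F (s + h) + - - Omega F s)%C by ring.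
  refine (Clim_bounded_integral_le _ _ _ _ _ (bounded_integral_scal (alex_norm F) _ _ _ Hb) _ L).
  - apply Ccont_plus; auto. apply Ccont_opp; auto.
  - apply alex_norm_nonneg; auto.
  - intros t. cbv beta. rewrite dv_add.
    replace (F t * (dv s t + dv h t + (du s t * u h t + u s t * du h t)) + - (F t * dv s t))%C
     with (F t * (dv h t + (du s t * u h t + u s t * du h t)))%C by ring.
    rewrite Cmod_mult. apply Rmult_le_compat; try apply Cmod_ge_0. apply alex_norm_ge; auto.
    eapply Rle_trans. apply Cmod_triangle. apply Rplus_le_compat_l.
    eapply Rle_trans. apply Cmod_triangle. rewrite !Cmod_mult. lra.
Qed.

(** * Best constant, asymptotics and the logarithmic modulus of continuity *)

(** |v_1| equals 1/2 at 0 and is below 1/4 far out, so the variation exceeds 1/4. *)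
Lemma varv1_pos : 0 < varv1.
Proof.
  destruct (v_small 1 (1/4)) as (M & HM & H); [lra|].
  destruct varv1_spec as (_ & _ & _ & _ & K).
  assert (A := increment_le (v 1) dv1 0 (M + 1) Cder_v1 Ccont_dv1 ltac:(lra)).
  specialize (K 0 (M + 1) ltac:(lra)). specialize (H (M + 1)).
  rewrite Rabs_pos_eq in H by lra. specialize (H ltac:(lra)).
  assert (E : v 1 0 = RtoC (1 / 2)).
  { unfold v. destruct (Req_EM_T 0 0); [|lra]. f_equal. field. }
  assert (Cmod (v 1 0) <= Cmod (v 1 (M + 1)) + Cmod (v 1 (M + 1) - v 1 0)).
  { replace (v 1 0) with (v 1 (M + 1) - (v 1 (M + 1) - v 1 0))%C at 1 by ring. apply Cmod_minus_le. }
  rewrite E, Cmod_R, Rabs_pos_eq in H0 by lra. rewrite E in A. lra.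
Qed.

Lemma dv_1 t : dv 1 t = dv1 t.
Proof. unfold dv. rewrite pow1, Rmult_1_l. ring. Qed.

Lemma continuous_inv_pos (f : R -> R) (x : R) : continuous f x -> f x <> 0 ->
  continuous (fun t => / f t) x.
Proof.
  intros H H0. apply (continuous_comp f Rinv); auto.
  apply (ex_derive_continuous (V:=R_NormedModule)). auto_derive. auto.
Qed.

(* Almost extremal primitive: a continuous damping of the unimodular function -conj(v_1')/|v_1'|. *)
Definition extremal (e : R) (t : R) : C := (RtoC (- / (Cmod (dv1 t) + e)) * Cconj (dv1 t))%C.

Lemma Cmod_extremal e t : 0 < e -> Cmod (extremal e t) = Cmod (dv1 t) / (Cmod (dv1 t) + e).
Proof.
  intros He. unfold extremal. rewrite Cmod_mult, Cmod_conj, Cmod_R, Rabs_Ropp.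
  assert (P := Cmod_ge_0 (dv1 t)).
  rewrite Rabs_pos_eq. field. lra. left. apply Rinv_0_lt_compat. lra.
Qed.

Lemma dv1_small eps t : 0 < eps -> 16 / eps < Rabs t -> Cmod (dv1 t) < eps.
Proof.
  intros He Ht. assert (0 < 16 / eps) by (apply Rdiv_lt_0_compat; lra).
  eapply Rle_lt_trans. apply dv1_decay.
  apply (Rmult_lt_reg_r ((1 + Rabs t) ^ 2)). apply pow_lt; lra.
  assert (16 < eps * Rabs t).
  { apply (Rmult_lt_reg_r (/ eps)). apply Rinv_0_lt_compat; auto.
    replace (eps * Rabs t * / eps) with (Rabs t) by (field; lra). exact Ht. }
  replace (16 / (1 + Rabs t) ^ 2 * (1 + Rabs t) ^ 2) with 16 by (field; lra).
  nra.
Qed.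

Lemma extremal_in_Bc e : 0 < e -> in_Bc (extremal e).
Proof.
  intros He.
  (* The modulus is at most |v_1'|/e, so the damping also provides the limits at both ends, which a
     function of modulus 1 could not have. *)
  assert (K : forall eps, 0 < eps -> forall t, 16 / (eps * e) < Rabs t -> Cmod (extremal e t - 0) < eps).
  { intros eps Heps t Ht. replace (extremal e t - 0)%C with (extremal e t) by ring.
    rewrite Cmod_extremal by auto. assert (P := Cmod_ge_0 (dv1 t)).
    assert (D := dv1_small (eps * e) t ltac:(nra) Ht).
    apply Rlt_div_l; nra. }
  split; [|split].
  - apply continuous_Ccont. apply (Ccont_mult (fun t => RtoC (- / (Cmod (dv1 t) + e))) (fun t => Cconj (dv1 t))).
    + apply Ccont_RtoC. intros x. apply (continuous_opp (fun t => / (Cmod (dv1 t) + e))).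
      apply (continuous_inv_pos (fun t => Cmod (dv1 t) + e)).
      apply (continuous_plus (fun t => Cmod (dv1 t)) (fun _ => e)).
      apply continuous_Cmod, Ccont_dv1. apply continuous_const.
      generalize (Cmod_ge_0 (dv1 x)); lra.
    + destruct Ccont_dv1 as [A B]. split; intros x; simpl. apply A.
      apply (continuous_opp (fun t => Im (dv1 t))), B.
  - apply (proj2 (filterlim_C (Rbar_locally m_infty) (extremal e) (RtoC 0))).
    intros eps Heps. exists (- (16 / (eps * e))). intros x Hx. apply K; auto.
    assert (0 < 16 / (eps * e)) by (apply Rdiv_lt_0_compat; nra).
    rewrite Rabs_left; lra.
  - exists (RtoC 0). apply (proj2 (filterlim_C (Rbar_locally p_infty) (extremal e) (RtoC 0))).
    intros eps Heps. exists ((16 / (eps * e))). intros x Hx. apply K; auto.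
    eapply Rlt_le_trans. apply Hx. apply Rle_abs.
Qed.

Lemma Cconj_mult_self z : (Cconj z * z)%C = RtoC (Cmod z ^ 2).
Proof.
  unfold Cmod. rewrite pow2_sqrt. 2: nra.
  apply injective_projections; simpl; ring.
Qed.

Lemma best_constant c' : c' < varv1 ->
  (* With c >= 0 the bound [alex_norm] <= 1 on the extremal primitive suffices, even when c' is
     negative. *)
  exists F s, in_Bc F /\ c' * alex_norm F * s ^ 2 < Cmod (Omega F s).
Proof.
  intros Hc'. set (c := Rmax c' 0).
  assert (Hc : c < varv1). { apply Rmax_lub_lt; auto. apply varv1_pos. }
  assert (Hc0 : 0 <= c) by apply Rmax_r. assert (Hcc : c' <= c) by apply Rmax_l.
  (* Three losses of eta occur: truncating the integral, damping, and approximating Omega by a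
     proper integral. The fourth quarter leaves strictness. *)
  set (eta := (varv1 - c) / 4). assert (Heta : 0 < eta) by (unfold eta; lra).
  destruct varv1_spec as (_ & HL & _).
  destruct (HL eta Heta) as (M & HM & H).
  specialize (H (- (M + 1)) (M + 1) ltac:(lra) ltac:(lra)). apply Rabs_def2 in H.
  (* Damping costs at most e pointwise, hence e times the window length 2 (M + 1), that is eta. *)
  set (e := eta / (2 * (M + 1))).
  assert (He : 0 < e) by (apply Rdiv_lt_0_compat; lra).
  assert (HB := extremal_in_Bc e He).
  exists (extremal e), 1. split; auto.
  set (r := fun t => Cmod (dv1 t) ^ 2 * / (Cmod (dv1 t) + e)).
  assert (Cm := continuous_Cmod dv1 Ccont_dv1).
  assert (Cr : forall x : R, continuous r x).
  { intros x. apply (continuous_mult (K:=R_AbsRing) (fun t => Cmod (dv1 t) ^ 2)).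
    - apply (continuous_mult (K:=R_AbsRing) (fun t => Cmod (dv1 t))); auto.
      apply (continuous_mult (K:=R_AbsRing) (fun t => Cmod (dv1 t))); auto. apply continuous_const.
    - apply (continuous_inv_pos (fun t => Cmod (dv1 t) + e)).
      apply (continuous_plus (fun t => Cmod (dv1 t)) (fun _ => e)); auto.
      apply continuous_const. generalize (Cmod_ge_0 (dv1 x)); lra. }
  assert (Pr : forall t, 0 <= r t).
  { intros t. generalize (Cmod_ge_0 (dv1 t)); intros. apply Rmult_le_pos. apply pow2_ge_0.
    left. apply Rinv_0_lt_compat; lra. }
  assert (Lr : forall t, Cmod (dv1 t) + - e <= r t).
  { intros t. unfold r. generalize (Cmod_ge_0 (dv1 t)); intros.
    apply (Rmult_le_reg_r (Cmod (dv1 t) + e)); [lra|]. rewrite Rmult_assoc, Rinv_l by lra. nra. }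
  assert (I1 : varv1 - 2 * eta <= RInt r (- (M + 1)) (M + 1)).
  { eapply Rle_trans. 2: apply (RInt_le_cont (fun t => Cmod (dv1 t) + - e)); auto; try lra.
    - rewrite RInt_plus_cont; auto. 2: intros; apply continuous_const.
      rewrite RInt_const_mult. replace ((M + 1 - - (M + 1)) * - e) with (- eta).
      lra. unfold e. field. lra.
    - intros x. apply (continuous_plus (fun t => Cmod (dv1 t)) (fun _ => - e)); auto.
      apply continuous_const. }
  destruct (Omega_Clim _ 1 HB eta Heta) as (M' & HM' & K).
  (* Since r >= 0, enlarging the window to one where the proper integral approximates Omega can only
     increase the integral of r. *)
  set (A := M + M' + 1). specialize (K (- A) A ltac:(unfold A; lra) ltac:(unfold A; lra)).
  rewrite (CI_ext _ (fun t => RtoC (-1 * r t))) in K.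
  2:{ intros t. rewrite dv_1. unfold extremal. rewrite <- Cmult_assoc, Cconj_mult_self, <- RtoC_mult.
      f_equal. unfold r. ring. }
  assert (E : CI (fun t => RtoC (-1 * r t)) (- A) A = RtoC (- RInt r (- A) A)).
  { unfold CI. apply injective_projections; simpl.
    - rewrite RInt_scal_cont; auto. ring.
    - rewrite RInt_const_mult. ring. }
  rewrite E in K.
  assert (I2 : RInt r (- (M + 1)) (M + 1) <= RInt r (- A) A).
  { apply RInt_mono; auto; unfold A; lra. }
  assert (Q : RInt r (- A) A <= Cmod (RtoC (- RInt r (- A) A) - - Omega (extremal e) 1) + Cmod (Omega (extremal e) 1)).
  { rewrite <- (Cmod_opp (Omega _ _)).
    replace (RInt r (-A) A) with (Cmod (RtoC (- RInt r (- A) A))) at 1.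
    2:{ rewrite Cmod_R, Rabs_Ropp, Rabs_pos_eq; auto. apply RInt_nonneg; auto. unfold A; lra. }
    set (z := RtoC (- RInt r (- A) A)). set (o := (- Omega _ _)%C).
    replace z with (z - o + o)%C at 1 by ring. apply Cmod_triangle. }
  assert (N1 : alex_norm (extremal e) <= 1).
  { apply alex_norm_le. intros t. rewrite Cmod_extremal by auto. generalize (Cmod_ge_0 (dv1 t)); intros.
    apply Rle_div_l; lra. }
  assert (N0 := alex_norm_nonneg _ HB).
  assert (c' * alex_norm (extremal e) <= c). { eapply Rle_trans. apply Rmult_le_compat_r; eauto. nra. }
  unfold eta in *. nra.
Qed.

(** * Behaviour of Omega for small and for large s *)

Lemma is_derive_0_of_square (f : R -> R) K : (forall s, Rabs (f s) <= K * s ^ 2) -> is_derive f 0 0.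
Proof.
  intros H. apply is_derive_Reals. intros eps He.
  assert (HK : 0 <= K). { generalize (H 1) (Rabs_pos (f 1)). lra. }
  assert (f 0 = 0). { generalize (H 0). intros Q. apply Rabs_eq_0. generalize (Rabs_pos (f 0)). lra. }
  assert (Hd : 0 < eps / (K + 1)) by (apply Rdiv_lt_0_compat; lra).
  exists (mkposreal _ Hd). simpl. intros h Hh Hlt.
  rewrite Rplus_0_l, H0, !Rminus_0_r. unfold Rdiv. rewrite Rabs_mult, Rabs_inv.
  assert (P : 0 < Rabs h) by (apply Rabs_pos_lt; auto).
  apply (Rmult_lt_reg_r (Rabs h)); auto. rewrite Rmult_assoc, Rinv_l by lra.
  specialize (H h). rewrite <- (pow2_abs h) in H.
  assert ((K + 1) * Rabs h < eps).
  { apply (Rmult_lt_compat_l (K + 1)) in Hlt; [|lra].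
    replace ((K + 1) * (eps / (K + 1))) with eps in Hlt by (field; lra). exact Hlt. }
  nra.
Qed.

Lemma Omega_derive_0 F : in_Bc F -> is_derive (Omega F) 0 (RtoC 0).
Proof.
  intros HF. apply is_derive_Cder. split.
  - apply (is_derive_0_of_square (fun s => Re (Omega F s)) (varv1 * alex_norm F)).
    intros s. eapply Rle_trans; [apply re_le_Cmod|apply Omega_bound; auto].
  - apply (is_derive_0_of_square (fun s => Im (Omega F s)) (varv1 * alex_norm F)).
    intros s. eapply Rle_trans; [apply im_le_Cmod|apply Omega_bound; auto].
Qed.

(** Here w is minus the integral of a comparison function against v_s', hence the plus sign next to
    the integral of F v_s'. Integrating the comparison function leaves boundary values of v_s, which
    vanish as the interval grows. *)
Lemma Omega_approx F s w B K : in_Bc F -> 0 <= K ->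
  (forall a b, a < 0 -> 0 < b ->
    Cmod (CI (fun t => F t * dv s t)%C a b + w) <= B + K * (Cmod (v s a) + Cmod (v s b))) ->
  Cmod (Omega F s - w) <= B.
Proof.
  intros HF HK H. apply le_epsilon. intros eps He.
  destruct (Omega_Clim F s HF (eps / 2)) as (M & HM & A); [lra|].
  destruct (v_small s (eps / (4 * (K + 1)))) as (M' & HM' & A').
  { apply Rdiv_lt_0_compat; lra. }
  set (b := M + M' + 1).
  specialize (A (- b) b ltac:(unfold b; lra) ltac:(unfold b; lra)).
  specialize (H (- b) b ltac:(unfold b; lra) ltac:(unfold b; lra)).
  assert (A1 := A' b). assert (A2 := A' (- b)). rewrite Rabs_Ropp in A2.
  rewrite Rabs_pos_eq in A1, A2 by (unfold b; lra).
  specialize (A1 ltac:(unfold b; lra)). specialize (A2 ltac:(unfold b; lra)).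
  set (z := CI _ _ _) in *.
  assert (Cmod (Omega F s - w) <= Cmod (z - - Omega F s) + Cmod (z + w)).
  { replace (Omega F s - w)%C with ((z - - Omega F s) - (z + w))%C by ring. apply Cmod_minus_le. }
  assert (K * (Cmod (v s (- b)) + Cmod (v s b)) <= (K + 1) * (2 * (eps / (4 * (K + 1))))).
  { apply Rmult_le_compat; try lra. generalize (Cmod_ge_0 (v s (-b))) (Cmod_ge_0 (v s b)); lra. }
  replace ((K + 1) * (2 * (eps / (4 * (K + 1))))) with (eps / 2) in H1 by (field; lra).
  lra.
Qed.

Lemma Cmod_dv_le s t : Cmod (dv s t) <= 2 * Rabs s ^ 3.
Proof.
  rewrite Cmod_dv. rewrite Rmult_comm. apply Rmult_le_compat_r. apply pow_le, Rabs_pos. apply Cmod_dv1.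
Qed.

(** Away from 0 the derivative is only linear in |s|, while its total mass is of order s^2: for
    large |s| the mass concentrates at t = 0. *)
Lemma t2_dv s t : t ^ 2 * Cmod (dv s t) <= 16 * Rabs s.
Proof.
  rewrite Cmod_dv. assert (D := dv1_decay (s * t)). rewrite Rabs_mult in D.
  generalize (Rabs_pos s) (Rabs_pos t). intros P Q. rewrite <- (pow2_abs t).
  assert (0 <= Rabs s * Rabs t) by nra.
  apply Rle_div_r in D. 2: apply pow_lt; lra.
  generalize (Cmod_ge_0 (dv1 (s * t))). intros.
  replace (Rabs t ^ 2 * (Rabs s ^ 3 * Cmod (dv1 (s * t)))) with
   (Rabs s * (Cmod (dv1 (s * t)) * (Rabs s * Rabs t) ^ 2)) by ring.
  rewrite (Rmult_comm 16). apply Rmult_le_compat_l; auto.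
  eapply Rle_trans; [|apply D]. apply Rmult_le_compat_l; auto. apply pow_incr. lra.
Qed.

Lemma v_0 s : v s 0 = RtoC (s ^ 2 / 2).
Proof. unfold v. destruct (Req_EM_T 0 0); [auto|lra]. Qed.

Lemma lim_pinf_spec F : in_Bc F -> filterlim F (Rbar_locally p_infty) (locally (lim_pinf F)).
Proof. intros (_ & _ & l & H). rewrite (lim_pinf_unique F l); auto. Qed.

(** For the comparison function the integral is -F(oo) v_s(0) = -F(oo) s^2/2. Outside [-M, M] the
    difference is at most eps/var(v_1), and inside |v_s'| = O(|s|^3), so the bounded part is of
    higher order. *)
Lemma Omega_near_0 F eps : in_Bc F -> 0 < eps -> exists K, 0 <= K /\ forall s,
  Cmod (Omega F s - lim_pinf F * RtoC (s ^ 2 / 2)) <= eps * s ^ 2 + K * Rabs s ^ 3.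
Proof.
  intros HF He. assert (HL := lim_pinf_spec F HF). set (L := lim_pinf F) in *.
  assert (Hc := in_Bc_Ccont F HF). assert (HN := alex_norm_nonneg F HF).
  set (N := alex_norm F) in *. assert (PV := varv1_pos).
  set (e := eps / varv1). assert (Pe : 0 < e) by (apply Rdiv_lt_0_compat; lra).
  assert (H1 := proj1 (filterlim_C (Rbar_locally m_infty) F (RtoC 0)) (proj1 (proj2 HF)) e Pe).
  assert (H2 := proj1 (filterlim_C (Rbar_locally p_infty) F L) HL e Pe).
  destruct H1 as [a1 H1]. destruct H2 as [b1 H2].
  set (M := Rabs a1 + Rabs b1 + 1).
  assert (HM : 0 < M) by (unfold M; generalize (Rabs_pos a1) (Rabs_pos b1); lra).
  set (P := N + Cmod L). assert (HP : 0 <= P) by (unfold P; generalize (Cmod_ge_0 L); lra).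
  exists (P * 8 * M ^ 2 * (2 * / M)). split.
  { apply Rmult_le_pos. apply Rmult_le_pos; nra. generalize (Rinv_0_lt_compat M HM); lra. }
  intros s.
  (* The function 4 M^2/(M + |t|)^2 is at least 1 on [-M, M] and replaces its indicator
     continuously; the 8 is this 4 times the 2 in |v_s'| <= 2|s|^3. *)
  set (m := fun t => e * Cmod (dv s t) + P * 8 * M ^ 2 * Rabs s ^ 3 * / (M + Rabs t) ^ 2).
  assert (Bm : bounded_integral m (eps * s ^ 2 + P * 8 * M ^ 2 * (2 * / M) * Rabs s ^ 3)).
  { eapply bounded_integral_weaken. apply (bounded_integral_plus (fun t => e * Cmod (dv s t))).
    apply bounded_integral_scal. lra. apply bounded_integral_dv.
    apply (bounded_integral_scal _ (fun t => / (M + Rabs t) ^ 2)).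
    2: apply bounded_integral_inv_square; auto.
    - apply Rmult_le_pos. apply Rmult_le_pos; nra. apply pow_le, Rabs_pos.
    - right. unfold e. field. lra. }
  assert (Pm : forall (G : R -> C) t, (Rabs t > M -> Cmod (G t) <= e) -> Cmod (G t) <= P ->
    Cmod (G t * dv s t) <= m t).
  { intros G t G1 G2. rewrite Cmod_mult. unfold m.
    assert (Q := Rabs_pos t). assert (D := Cmod_ge_0 (dv s t)).
    assert (D' := Cmod_dv_le s t). assert (S3 := pow_le (Rabs s) 3 (Rabs_pos s)).
    assert (I0 : 0 < / (M + Rabs t) ^ 2) by (apply Rinv_0_lt_compat, pow_lt; lra).
    assert (0 <= P * 8 * M ^ 2 * Rabs s ^ 3) by (apply Rmult_le_pos; auto; nra).
    destruct (Rlt_dec M (Rabs t)) as [L1|L1].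
    - apply G1 in L1. assert (Cmod (G t) * Cmod (dv s t) <= e * Cmod (dv s t)) by nra. nra.
    - assert (1 <= 4 * M ^ 2 * / (M + Rabs t) ^ 2).
      { apply (Rmult_le_reg_r ((M + Rabs t) ^ 2)). apply pow_lt; lra.
        rewrite Rmult_assoc, Rinv_l by (apply pow_nonzero; lra). nra. }
      assert (Cmod (G t) * Cmod (dv s t) <= P * (2 * Rabs s ^ 3)).
      { apply Rmult_le_compat; auto. apply Cmod_ge_0. }
      assert (0 <= P * (2 * Rabs s ^ 3)) by (apply Rmult_le_pos; lra).
      replace (P * 8 * M ^ 2 * Rabs s ^ 3 * / (M + Rabs t) ^ 2) with
        (P * (2 * Rabs s ^ 3) * (4 * M ^ 2 * / (M + Rabs t) ^ 2)) by ring.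
      nra. }
  apply (Omega_approx F s _ _ (Cmod L)); auto. apply Cmod_ge_0.
  intros a b Ha Hb.
  assert (CF := Ccont_mult F (dv s) Hc (Ccont_dv s)).
  assert (CL := Ccont_mult (fun _ => L) (dv s) (Ccont_const L) (Ccont_dv s)).
  assert (CFL : Ccont (fun t => (F t - L) * dv s t)%C).
  { apply (Ccont_mult (fun t => F t - L)%C). apply (Ccont_minus F); auto. apply Ccont_const. apply Ccont_dv. }
  assert (Cm := proj1 Bm).
  assert (E : (CI (fun t => F t * dv s t) a b + L * RtoC (s ^ 2 / 2) =
    CI (fun t => F t * dv s t) a 0 + CI (fun t => (F t - L) * dv s t) 0 b + L * v s b)%C).
  { rewrite <- (CI_Chasles _ a 0 b) by auto.
    rewrite (CI_ext (fun t => (F t - L) * dv s t)%C (fun t => F t * dv s t - L * dv s t)%C) by (intros; ring).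
    rewrite (CI_minus (fun t => F t * dv s t)%C) by auto.
    rewrite CI_scal by apply Ccont_dv.
    rewrite (CI_derive (v s) (dv s)); [|apply Cder_v|apply Ccont_dv]. rewrite v_0. ring. }
  rewrite E.
  assert (T1 : Cmod (CI (fun t => F t * dv s t)%C a 0) <= RInt m a 0).
  { apply CI_Cmod_le; auto. lra. intros t Ht. apply Pm.
    - intros K. left. replace (F t) with (F t - 0)%C by ring. apply H1.
      rewrite Rabs_left1 in K by lra. unfold M in K.
      generalize (Rabs_pos b1) (Rle_abs (-a1)). rewrite Rabs_Ropp. lra.
    - unfold P. generalize (alex_norm_ge F t HF) (Cmod_ge_0 L). fold N. lra. }
  assert (T2 : Cmod (CI (fun t => (F t - L) * dv s t)%C 0 b) <= RInt m 0 b).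
  { apply CI_Cmod_le; auto. lra. intros t Ht. apply (Pm (fun t => F t - L)%C).
    - intros K. left. apply H2. rewrite Rabs_pos_eq in K by lra. unfold M in K.
      generalize (Rabs_pos a1) (Rle_abs b1). lra.
    - eapply Rle_trans. apply Cmod_minus_le.
      unfold P. generalize (alex_norm_ge F t HF). fold N. lra. }
  assert (T3 : RInt m a 0 + RInt m 0 b <= eps * s ^ 2 + P * 8 * M ^ 2 * (2 * / M) * Rabs s ^ 3).
  { rewrite RInt_Chasles_cont by auto. apply Bm. lra. }
  eapply Rle_trans. apply Cmod_triangle. rewrite Cmod_mult.
  assert (T4 := Cmod_triangle (CI (fun t => F t * dv s t)%C a 0) (CI (fun t => (F t - L) * dv s t)%C 0 b)).
  generalize (Cmod_ge_0 L) (Cmod_ge_0 (v s a)). nra.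
Qed.

(** A constant integrates against v_s' to boundary values only, so F(0) may be subtracted. The
    difference is small near 0, where the mass of v_s' sits, and elsewhere v_s' is O(|s|/t^2). *)
Lemma Omega_at_infinity F eps : in_Bc F -> 0 < eps -> exists K, 0 <= K /\ forall s,
  Cmod (Omega F s) <= eps * s ^ 2 + K * Rabs s.
Proof.
  intros HF He.
  assert (Hc := in_Bc_Ccont F HF). assert (HN := alex_norm_nonneg F HF).
  set (N := alex_norm F) in *. assert (PV := varv1_pos).
  set (e := eps / varv1). assert (Pe : 0 < e) by (apply Rdiv_lt_0_compat; lra).
  destruct (Ccont_unif F (-1) 1 e Hc Pe) as (d0 & Hd0 & HU).
  (* Halving keeps d strictly below d0, and the cap keeps |t| <= d inside [-1, 1], where d0 is
     valid. *)
  set (d := Rmin d0 1 / 2).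
  assert (Hd : 0 < d < d0 /\ d < 1).
  { unfold d. generalize (Rmin_l d0 1) (Rmin_r d0 1) (Rmin_pos d0 1 Hd0 Rlt_0_1). lra. }
  exists (N * 128 * (2 * / d)). split.
  { generalize (Rinv_0_lt_compat d ltac:(lra)); nra. }
  intros s.
  (* For |t| > d, 128 = 2 * 16 * 4 collects |F - F(0)| <= 2N, t^2 |v_s'| <= 16|s| and 1 <= 4 t^2/(d
     + |t|)^2. *)
  set (m := fun t => e * Cmod (dv s t) + N * 128 * Rabs s * / (d + Rabs t) ^ 2).
  assert (Ps := Rabs_pos s).
  assert (Bm : bounded_integral m (eps * s ^ 2 + N * 128 * (2 * / d) * Rabs s)).
  { eapply bounded_integral_weaken. apply (bounded_integral_plus (fun t => e * Cmod (dv s t))).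
    apply bounded_integral_scal. lra. apply bounded_integral_dv.
    apply (bounded_integral_scal _ (fun t => / (d + Rabs t) ^ 2)).
    2: apply bounded_integral_inv_square; lra.
    - nra.
    - right. unfold e. field. lra. }
  assert (Pm : forall t, Cmod ((F t - F 0%R) * dv s t) <= m t).
  { intros t. rewrite Cmod_mult. unfold m.
    assert (Q := Rabs_pos t). assert (D := Cmod_ge_0 (dv s t)).
    assert (I0 : 0 < / (d + Rabs t) ^ 2) by (apply Rinv_0_lt_compat, pow_lt; lra).
    destruct (Rle_dec (Rabs t) d) as [L1|L1].
    - assert (Cmod (F t - F 0) < e).
      { apply Rabs_le_between in L1. apply HU; try lra. rewrite Rminus_0_r. apply Rabs_def1; lra. }
      assert (Cmod (F t - F 0) * Cmod (dv s t) <= e * Cmod (dv s t)) by nra.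
      assert (0 <= N * 128 * Rabs s) by nra. nra.
    - assert (G2 : Cmod (F t - F 0) <= 2 * N).
      { eapply Rle_trans. apply Cmod_minus_le.
        generalize (alex_norm_ge F t HF) (alex_norm_ge F 0 HF). fold N. lra. }
      assert (1 <= 4 * Rabs t ^ 2 * / (d + Rabs t) ^ 2).
      { apply (Rmult_le_reg_r ((d + Rabs t) ^ 2)). apply pow_lt; lra.
        rewrite Rmult_assoc, Rinv_l by (apply pow_nonzero; lra). nra. }
      assert (T2 := t2_dv s t). rewrite <- pow2_abs in T2.
      assert (Cmod (F t - F 0) * Cmod (dv s t) <= 2 * N * Cmod (dv s t)) by nra.
      assert (2 * N * Cmod (dv s t) <= 2 * N * Cmod (dv s t) * (4 * Rabs t ^ 2 * / (d + Rabs t) ^ 2)).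
      { assert (0 <= 2 * N * Cmod (dv s t)) by nra. nra. }
      assert (2 * N * Cmod (dv s t) * (4 * Rabs t ^ 2 * / (d + Rabs t) ^ 2) <=
         N * 128 * Rabs s * / (d + Rabs t) ^ 2).
      { replace (2 * N * Cmod (dv s t) * (4 * Rabs t ^ 2 * / (d + Rabs t) ^ 2)) with
         (8 * N * (Rabs t ^ 2 * Cmod (dv s t)) * / (d + Rabs t) ^ 2) by ring.
        apply Rmult_le_compat_r. lra. nra. }
      nra. }
  replace (Omega F s) with (Omega F s - 0)%C by ring.
  apply (Omega_approx F s _ _ (Cmod (F 0))); auto. apply Cmod_ge_0.
  intros a b Ha Hb.
  assert (CF := Ccont_mult F (dv s) Hc (Ccont_dv s)).
  assert (CFL : Ccont (fun t => (F t - F 0%R) * dv s t)%C).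
  { apply (Ccont_mult (fun t => F t - F 0%R)%C). apply (Ccont_minus F); auto. apply Ccont_const. apply Ccont_dv. }
  assert (E : (CI (fun t => F t * dv s t) a b + 0 =
    CI (fun t => (F t - F 0%R) * dv s t) a b + F 0%R * (v s b - v s a))%C).
  { rewrite (CI_ext (fun t => (F t - F 0%R) * dv s t)%C (fun t => F t * dv s t - F 0%R * dv s t)%C) by (intros; ring).
    rewrite (CI_minus (fun t => F t * dv s t)%C (fun t => F 0%R * dv s t)%C) by (auto; apply Ccont_scal, Ccont_dv).
    rewrite CI_scal by apply Ccont_dv.
    rewrite (CI_derive (v s) (dv s)); [|apply Cder_v|apply Ccont_dv]. ring. }
  rewrite E.
  eapply Rle_trans. apply Cmod_triangle. apply Rplus_le_compat.
  - eapply Rle_trans. apply (CI_Cmod_le _ m); auto. lra. apply Bm. apply Bm; lra.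
  - rewrite Cmod_mult. apply Rmult_le_compat_l. apply Cmod_ge_0.
    eapply Rle_trans. apply Cmod_minus_le. lra.
Qed.

Lemma Omega_lim_0 F : in_Bc F ->
  is_lim (fun s => Cmod (Omega F s - lim_pinf F * RtoC (s ^ 2 / 2)) / s ^ 2) 0 0.
Proof.
  intros HF. apply is_lim_spec. intros eps.
  destruct (Omega_near_0 F (eps / 2) HF) as (K & HK & H). { generalize (cond_pos eps); lra. }
  assert (Pe := cond_pos eps).
  assert (Hd : 0 < eps / (2 * (K + 1))) by (apply Rdiv_lt_0_compat; lra).
  exists (mkposreal _ Hd). intros s Hs Hs0.
  change (Rabs (s - 0) < eps / (2 * (K + 1))) in Hs. rewrite Rminus_0_r in Hs.
  assert (P : 0 < Rabs s) by (apply Rabs_pos_lt; auto).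
  assert (P2 : 0 < s ^ 2) by (rewrite <- pow2_abs; apply pow_lt; auto).
  rewrite Rminus_0_r, Rabs_pos_eq.
  2:{ apply Rdiv_le_0_compat; auto. apply Cmod_ge_0. }
  apply Rlt_div_l; auto. eapply Rle_lt_trans. apply H.
  assert (K * Rabs s < eps / 2).
  { apply (Rmult_lt_compat_l (K + 1)) in Hs; [|lra].
    replace ((K + 1) * (eps / (2 * (K + 1)))) with (eps / 2) in Hs by (field; lra). nra. }
  replace (K * Rabs s ^ 3) with (K * Rabs s * Rabs s ^ 2) by ring. rewrite pow2_abs. nra.
Qed.

Lemma Omega_little_o F eps : in_Bc F -> 0 < eps -> exists M, 0 < M /\ forall s, M < Rabs s ->
  Rabs (Cmod (Omega F s) / s ^ 2 - 0) < eps.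
Proof.
  intros HF He. destruct (Omega_at_infinity F (eps / 2) HF) as (K & HK & H); [lra|].
  exists (2 * (K + 1) / eps). split. { apply Rdiv_lt_0_compat; lra. }
  intros s Hs.
  assert (PM : 0 < 2 * (K + 1) / eps). { apply Rdiv_lt_0_compat; lra. }
  assert (P2 : 0 < s ^ 2) by (rewrite <- pow2_abs; apply pow_lt; lra).
  rewrite Rminus_0_r, Rabs_pos_eq.
  2:{ apply Rdiv_le_0_compat; auto. apply Cmod_ge_0. }
  apply Rlt_div_l; auto. eapply Rle_lt_trans. apply H.
  assert (2 * (K + 1) < eps * Rabs s).
  { apply (Rmult_lt_compat_l eps) in Hs; auto.
    replace (eps * (2 * (K + 1) / eps)) with (2 * (K + 1)) in Hs by (field; lra). auto. }
  rewrite <- pow2_abs in *. nra.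
Qed.

(** Partial fractions give ln((1 + t)/(1 + eta t))/(1 - eta) on a half-line, and the ratio stays
    below 1/eta. Since eta < 1/2, the factor 1/(1 - eta) is at most 2. *)
Lemma bounded_integral_log eta : 0 < eta < / exp 1 ->
  bounded_integral (fun t => / ((1 + Rabs t) * (1 + eta * Rabs t))) (4 * Rabs (ln eta)).
Proof.
  intros [H0 H1].
  assert (He : / exp 1 < / 2).
  { apply Rinv_lt_contravar. generalize (exp_pos 1); lra.
    generalize (exp_ineq1 1 ltac:(lra)); lra. }
  assert (Hl : ln eta < 0). { rewrite <- ln_1. apply ln_increasing; lra. }
  apply (bounded_integral_weaken _ (2 * (- ln eta / (1 - eta)))).
  - apply (bounded_integral_even (fun t => / ((1 + t) * (1 + eta * t)))
      (fun t => (ln (1 + t) - ln (1 + eta * t)) / (1 - eta))).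
    + intros t Ht. apply (ex_derive_continuous (V:=R_NormedModule)). auto_derive. nra.
    + intros t Ht. left. apply Rinv_0_lt_compat. nra.
    + intros t Ht. auto_derive. split; [lra|split]; nra. field. nra.
    + intros t Ht. rewrite Rmult_0_r, Rplus_0_r, ln_1.
      replace ((0 - 0) / (1 - eta)) with 0 by (field; lra). rewrite Rminus_0_r.
      apply Rmult_le_compat_r. left; apply Rinv_0_lt_compat; lra.
      assert (ln (eta * (1 + t)) <= ln (1 + eta * t)).
      { apply ln_le. nra. nra. }
      rewrite ln_mult in H by lra. lra.
  - rewrite Rabs_left by auto.
    assert (- ln eta / (1 - eta) <= 2 * - ln eta).
    { apply Rle_div_l. lra. nra. }
    lra.
Qed.

(** The left side is at most s for T <= 1 and at most 1/T beyond. The splitting puts the factor s on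
    an integrable term, so that the slowly decaying term, which causes the logarithm, does not
    depend on s. *)
Lemma dilated_decay s T : 0 <= s -> 0 <= T -> s / (1 + s * T) <= 4 * s * / (1 + T) ^ 2 + 2 * / (1 + T).
Proof.
  intros Hs HT. assert (0 <= s * T) by nra.
  assert (I : 0 < / (1 + T)) by (apply Rinv_0_lt_compat; lra).
  assert (I2 : 0 < / (1 + T) ^ 2) by (apply Rinv_0_lt_compat, pow_lt; lra).
  destruct (Rle_dec T 1).
  - assert (s / (1 + s * T) <= s) by (apply Rle_div_l; nra).
    assert (1 <= 4 * / (1 + T) ^ 2).
    { apply (Rmult_le_reg_r ((1 + T) ^ 2)). apply pow_lt; lra.
      rewrite Rmult_assoc, Rinv_l by (apply pow_nonzero; lra). nra. }
    nra.
  - assert (s / (1 + s * T) <= 2 * / (1 + T)).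
    { apply Rle_div_l. lra. apply (Rmult_le_reg_r (1 + T)). lra.
      replace (2 * / (1 + T) * (1 + s * T) * (1 + T)) with (2 * (1 + s * T)) by (field; lra). nra. }
    assert (0 <= 4 * s * / (1 + T) ^ 2) by nra. lra.
Qed.

Lemma Omega_log_modulus : exists k, forall F, in_Bc F -> forall s h, 0 < Rabs h < / exp 1 ->
  Cmod (Omega F (s + h) - Omega F s)
   <= k * alex_norm F * (Rabs s * Rabs h * Rabs (ln (Rabs h)) + (s ^ 2 + 1) * Rabs h).
Proof.
  (* The mixed terms carry 25 * 8 = 200, from two decay constants 5 and the integral of [w];
     absorbing the lower-order products into (s^2 + 1)|h| stays well within 600. *)
  exists (varv1 + 600). intros F HF s h Hh.
  assert (He : / exp 1 < / 2).
  { apply Rinv_lt_contravar. generalize (exp_pos 1); lra.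
    generalize (exp_ineq1 1 ltac:(lra)); lra. }
  set (eta := Rabs h) in *. set (sg := Rabs s).
  assert (Psg : 0 <= sg) by apply Rabs_pos.
  assert (L0 := Rabs_pos (ln eta)).
  assert (D1 := bounded_integral_log eta Hh). assert (D2 := bounded_integral_inv_square 1 Rlt_0_1).
  (* This is [dilated_decay] multiplied by 1/(1 + |ht|), with that factor dropped where the decay is
     already integrable. *)
  set (w := fun t => 4 * sg * / (1 + Rabs t) ^ 2 + 2 * / ((1 + Rabs t) * (1 + eta * Rabs t))).
  assert (Dw : bounded_integral w (8 * sg + 8 * Rabs (ln eta))).
  { eapply bounded_integral_weaken.
    apply (bounded_integral_plus (fun t => 4 * sg * / (1 + Rabs t) ^ 2) (fun t => 2 * / ((1 + Rabs t) * (1 + eta * Rabs t)))).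
    apply bounded_integral_scal; [|apply D2]. lra. apply bounded_integral_scal; [|apply D1]. lra. right; field. }
  (* Needed for the term h^2 |log|h||, which has no factor |s| and must be absorbed into |h|. *)
  assert (Hle : eta * Rabs (ln eta) <= 1).
  { rewrite Rabs_left. 2:{ rewrite <- ln_1. apply ln_increasing; lra. }
    rewrite <- ln_Rinv by lra. assert (P := Rinv_0_lt_compat eta ltac:(lra)).
    assert (ln (/ eta) <= / eta).
    { generalize (exp_ineq1_le (ln (/ eta))). rewrite exp_ln by auto. lra. }
    apply (Rmult_le_compat_l eta) in H; [|lra]. rewrite Rinv_r in H by lra. auto. }
  assert (Pw : forall t, (Cmod (du s t) * Cmod (u h t) <= 25 * sg * eta * w t) /\
    Cmod (u s t) * Cmod (du h t) <= 25 * eta ^ 2 * w t).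
  { intros t. assert (Q := Rabs_pos t).
    rewrite !Cmod_du, (Cmod_u s t), (Cmod_u h t). fold sg. fold eta.
    assert (A1 := du1_decay (s * t)). assert (A2 := u1_decay (s * t)).
    assert (A3 := du1_decay (h * t)). assert (A4 := u1_decay (h * t)).
    rewrite Rabs_mult in A1, A2, A3, A4. fold sg in A1, A2. fold eta in A3, A4.
    assert (B := dilated_decay sg (Rabs t) Psg Q).
    assert (Pa : 0 < / (1 + eta * Rabs t)) by (apply Rinv_0_lt_compat; nra).
    assert (Pb : 0 < / (1 + sg * Rabs t)) by (apply Rinv_0_lt_compat; nra).
    assert (W : sg / (1 + sg * Rabs t) * / (1 + eta * Rabs t) <= w t).
    { unfold w. rewrite Rinv_mult.
      assert (0 < / (1 + Rabs t) ^ 2) by (apply Rinv_0_lt_compat, pow_lt; lra).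
      assert (/ (1 + eta * Rabs t) <= 1).
      { rewrite <- Rinv_1. apply Rinv_le_contravar; nra. }
      apply (Rmult_le_compat_r (/ (1 + eta * Rabs t))) in B; [|lra].
      assert (4 * sg * / (1 + Rabs t) ^ 2 * / (1 + eta * Rabs t) <= 4 * sg * / (1 + Rabs t) ^ 2 * 1).
      { apply Rmult_le_compat_l; auto. nra. }
      lra. }
    split.
    - apply Rle_trans with (25 * sg * eta * (sg / (1 + sg * Rabs t) * / (1 + eta * Rabs t))).
      + replace (25 * sg * eta * (sg / (1 + sg * Rabs t) * / (1 + eta * Rabs t))) with
         ((sg ^ 2 * (5 / (1 + sg * Rabs t))) * (eta * (5 / (1 + eta * Rabs t)))) by (unfold Rdiv; ring).
        apply Rmult_le_compat.
        apply Rmult_le_pos. nra. apply Cmod_ge_0. apply Rmult_le_pos. lra. apply Cmod_ge_0.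
        apply Rmult_le_compat_l; auto. nra. apply Rmult_le_compat_l; auto. lra.
      + apply Rmult_le_compat_l; auto. nra.
    - apply Rle_trans with (25 * eta ^ 2 * (sg / (1 + sg * Rabs t) * / (1 + eta * Rabs t))).
      + replace (25 * eta ^ 2 * (sg / (1 + sg * Rabs t) * / (1 + eta * Rabs t))) with
         ((sg * (5 / (1 + sg * Rabs t))) * (eta ^ 2 * (5 / (1 + eta * Rabs t)))) by (unfold Rdiv; ring).
        apply Rmult_le_compat.
        apply Rmult_le_pos. nra. apply Cmod_ge_0. apply Rmult_le_pos. nra. apply Cmod_ge_0.
        apply Rmult_le_compat_l; auto. apply Rmult_le_compat_l; auto. nra.
      + apply Rmult_le_compat_l; auto. nra. }
  assert (B : bounded_integral (fun t => Cmod (dv h t) + (Cmod (du s t) * Cmod (u h t) + Cmod (u s t) * Cmod (du h t)))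
    (varv1 * h ^ 2 + (25 * sg * eta + 25 * eta ^ 2) * (8 * sg + 8 * Rabs (ln eta)))).
  { apply (bounded_integral_plus (fun t => Cmod (dv h t))). apply bounded_integral_dv.
    apply (bounded_integral_le _ (fun t => (25 * sg * eta + 25 * eta ^ 2) * w t)).
    - apply bounded_integral_scal; auto. nra.
    - intros x. apply (continuous_plus (fun t => Cmod (du s t) * Cmod (u h t)) (fun t => Cmod (u s t) * Cmod (du h t))).
      apply (continuous_mult (K:=R_AbsRing)); apply continuous_Cmod. apply Ccont_du. apply Ccont_u.
      apply (continuous_mult (K:=R_AbsRing)); apply continuous_Cmod. apply Ccont_u. apply Ccont_du.
    - intros x. destruct (Pw x). split. 2: lra.
      generalize (Cmod_ge_0 (du s x)) (Cmod_ge_0 (u h x)) (Cmod_ge_0 (u s x)) (Cmod_ge_0 (du h x)). nra. }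
  eapply Rle_trans. apply (Omega_increment F s h _ HF B).
  assert (HN := alex_norm_nonneg F HF). assert (PV := varv1_pos).
  rewrite (Rmult_comm (varv1 + 600)), (Rmult_assoc (alex_norm F)). apply Rmult_le_compat_l; auto.
  replace (s ^ 2) with (sg ^ 2) by apply pow2_abs. replace (h ^ 2) with (eta ^ 2) by apply pow2_abs.
  assert (Hh1 := proj1 Hh). assert (Hh2 : eta < 1) by lra. clear Hh B Dw Pw D1 D2 w He.
  set (l := Rabs (ln eta)) in *. clearbody l sg eta.
  assert (0 <= sg * eta * l) by (apply Rmult_le_pos; [nra|exact L0]).
  assert (E2 : eta ^ 2 <= eta) by nra.
  assert (varv1 * eta ^ 2 <= varv1 * eta) by (apply Rmult_le_compat_l; lra).
  assert (eta ^ 2 * sg <= eta * sg) by (apply Rmult_le_compat_r; lra).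
  assert (eta * sg <= eta * ((sg ^ 2 + 1) / 2)).
  { apply Rmult_le_compat_l. lra. generalize (pow2_ge_0 (sg - 1)); lra. }
  assert (eta ^ 2 * l <= eta).
  { replace (eta ^ 2 * l) with (eta * (eta * l)) by ring.
    apply (Rmult_le_compat_l eta) in Hle; lra. }
  assert (0 <= varv1 * (sg * eta * l)) by (apply Rmult_le_pos; lra).
  assert (0 <= varv1 * (sg ^ 2 * eta)) by (apply Rmult_le_pos; [lra|apply Rmult_le_pos; [apply pow2_ge_0|lra]]).
  assert (0 <= sg ^ 2 * eta) by (apply Rmult_le_pos; [apply pow2_ge_0|lra]).
  lra.
Qed.

(** * Hoelder estimates *)

Lemma rpow_pos x y : 0 < x -> rpow x y = Rpower x y.
Proof. intros H. unfold rpow. destruct (Rlt_dec 0 x); [auto|lra]. Qed.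

Lemma rpow_0 y : rpow 0 y = 0.
Proof. unfold rpow. destruct (Rlt_dec 0 0); [lra|auto]. Qed.

Lemma rpow_nonneg x y : 0 <= rpow x y.
Proof. unfold rpow. destruct (Rlt_dec 0 x). left; apply exp_pos. lra. Qed.

Lemma rpow_gt0 x y : 0 < x -> 0 < rpow x y.
Proof. intros; rewrite rpow_pos; auto. apply exp_pos. Qed.

Lemma rpow_le x x' y : 0 < y -> x <= x' -> rpow x y <= rpow x' y.
Proof.
  intros Hy H. unfold rpow at 1. destruct (Rlt_dec 0 x); [|apply rpow_nonneg].
  rewrite rpow_pos by lra. apply Rle_Rpower_l; lra.
Qed.

Lemma rpow_mult x y p : 0 <= x -> 0 <= y -> rpow (x * y) p = rpow x p * rpow y p.
Proof.
  intros [Hx| <-] [Hy| <-]; rewrite ?Rmult_0_l, ?Rmult_0_r, ?rpow_0; try ring.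
  assert (0 < x * y) by nra.
  rewrite !rpow_pos by auto. rewrite Rpower_mult_distr by auto. auto.
Qed.

Lemma rpow_plus x p q : rpow x (p + q) = rpow x p * rpow x q.
Proof. unfold rpow. destruct (Rlt_dec 0 x); [|ring]. apply Rpower_plus. Qed.

Lemma rpow_1 x : 0 <= x -> rpow x 1 = x.
Proof. intros [H| <-]. rewrite rpow_pos; auto. apply Rpower_1; auto. apply rpow_0. Qed.

Lemma rpow_2 x : 0 <= x -> rpow x 2 = x ^ 2.
Proof. intros H. replace 2 with (1 + 1) by ring. rewrite rpow_plus, rpow_1 by auto. ring. Qed.

Lemma continuous_rpow p (x : R) : 0 < p -> continuous (fun x => rpow x p) x.
Proof.
  intros Hp. destruct (Rtotal_order x 0) as [H|[->|H]].
  - apply (continuous_ext_loc _ (fun _ => 0)). 2: apply continuous_const.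
    assert (H' : 0 < - x) by lra. exists (mkposreal _ H'). intros y Hy.
    change (Rabs (y - x) < - x) in Hy. apply Rabs_def2 in Hy.
    unfold rpow. destruct (Rlt_dec 0 y); auto. lra.
  - apply continuity_pt_filterlim. intros eps He. exists (Rpower eps (/ p)). split. apply exp_pos.
    intros y [_ Hy]. unfold dist in *; simpl in *. unfold Rdist in *.
    rewrite rpow_0, Rminus_0_r in *. rewrite Rabs_pos_eq by apply rpow_nonneg.
    unfold rpow. destruct (Rlt_dec 0 y); [|lra]. rewrite Rabs_pos_eq in Hy by lra.
    apply Rlt_le_trans with (Rpower (Rpower eps (/ p)) p). apply Rlt_Rpower_l; auto.
    rewrite Rpower_mult, Rinv_l, Rpower_1; lra.
  - apply (continuous_ext_loc _ (fun x => Rpower x p)).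
    + exists (mkposreal _ H). intros y Hy.
      change (Rabs (y - x) < x) in Hy. apply Rabs_def2 in Hy. rewrite rpow_pos; auto. lra.
    + apply (ex_derive_continuous (V:=R_NormedModule)). unfold Rpower. auto_derive. auto.
Qed.

(** Convexity of exp: both p ln x and q ln y are compared with the tangent at m = ln x + ln y, and
    averaging the tangent values with weights 1/p and 1/q gives exactly exp m = x y. *)
Lemma young x y p q : 0 <= x -> 0 <= y -> 1 < p -> 1 / p + 1 / q = 1 ->
  x * y <= / p * rpow x p + / q * rpow y q.
Proof.
  intros Hx Hy Hp Hpq.
  assert (Ip : 0 < / p < 1).
  { split. apply Rinv_0_lt_compat; lra. rewrite <- Rinv_1. apply Rinv_lt_contravar; lra. }
  assert (Iq : 0 < / q) by lra.
  assert (Hq : q <> 0). { intros ->. rewrite Rinv_0 in Iq. lra. }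
  destruct Hx as [Hx| <-].
  2:{ rewrite rpow_0. generalize (rpow_nonneg y q). nra. }
  destruct Hy as [Hy| <-].
  2:{ rewrite rpow_0. generalize (rpow_nonneg x p). nra. }
  rewrite !rpow_pos by auto. unfold Rpower.
  rewrite <- (exp_ln x) at 1 by auto. rewrite <- (exp_ln y) at 1 by auto. rewrite <- exp_plus.
  set (m := ln x + ln y).
  assert (T : forall z, exp m * (1 + (z - m)) <= exp z).
  { intros z. replace (exp z) with (exp m * exp (z - m)) by (rewrite <- exp_plus; f_equal; ring).
    apply Rmult_le_compat_l. left; apply exp_pos. apply exp_ineq1_le. }
  assert (A := T (p * ln x)). assert (B := T (q * ln y)).
  apply (Rmult_le_compat_l (/ p)) in A; [|lra]. apply (Rmult_le_compat_l (/ q)) in B; [|lra].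
  eapply Rle_trans; [|apply Rplus_le_compat; [apply A|apply B]].
  right.
  replace (/ p * (exp m * (1 + (p * ln x - m))) + / q * (exp m * (1 + (q * ln y - m)))) with
   (exp m * ((/ p + / q) * (1 - m) + (/ p * p) * ln x + (/ q * q) * ln y)) by ring.
  rewrite !Rinv_l by lra. replace (/ p + / q) with 1 by lra. unfold m. ring.
Qed.

Lemma conj_exponent p q : 1 < p -> 1 / p + 1 / q = 1 -> 1 < q /\ 1 / q + 1 / p = 1.
Proof.
  intros Hp Hpq. split; [|lra].
  assert (Ip : 0 < / p < 1).
  { split. apply Rinv_0_lt_compat; lra. rewrite <- Rinv_1. apply Rinv_lt_contravar; lra. }
  assert (Iq : 0 < / q < 1) by lra.
  assert (Hq : q <> 0). { intros ->. rewrite Rinv_0 in Iq. lra. }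
  rewrite <- (Rinv_inv q). rewrite <- Rinv_1. apply Rinv_lt_contravar; lra.
Qed.

Lemma rpow_root X p : 0 < X -> 0 < p -> rpow (/ rpow X (1 / p)) p = / X.
Proof.
  intros HX Hp. rewrite (rpow_pos X) by auto. rewrite rpow_pos by (apply Rinv_0_lt_compat, exp_pos).
  rewrite <- Rpower_Ropp, Rpower_mult. replace (- (1 / p) * p) with (- (1)) by (field; lra).
  rewrite Rpower_Ropp, Rpower_1; auto.
Qed.

(** f and g are divided by X^{1/p} and Y^{1/q}, after which Young's inequality integrates to 1/p +
    1/q = 1. This normalization is why X and Y must be positive. *)
Lemma bounded_integral_holder (f g : R -> R) p q X Y : 1 < p -> 1 / p + 1 / q = 1 ->
  (forall x : R, continuous f x) -> (forall x : R, continuous g x) ->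
  (forall x, 0 <= f x) -> (forall x, 0 <= g x) -> 0 < X -> 0 < Y ->
  bounded_integral (fun t => rpow (f t) p) X -> bounded_integral (fun t => rpow (g t) q) Y ->
  bounded_integral (fun t => f t * g t) (rpow X (1 / p) * rpow Y (1 / q)).
Proof.
  intros Hp Hpq Cf Cg Pf Pg HX HY BX BY.
  destruct (conj_exponent p q Hp Hpq) as [Hq _].
  set (al := rpow X (1 / p)). set (be := rpow Y (1 / q)).
  assert (Pa : 0 < al) by (apply rpow_gt0; auto).
  assert (Pb : 0 < be) by (apply rpow_gt0; auto).
  assert (Ip : 0 < / p) by (apply Rinv_0_lt_compat; lra).
  assert (Iq : 0 < / q) by (apply Rinv_0_lt_compat; lra).
  assert (IX : 0 < / X) by (apply Rinv_0_lt_compat; lra).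
  assert (IY : 0 < / Y) by (apply Rinv_0_lt_compat; lra).
  apply (bounded_integral_le _ (fun t => al * be * ((/ p * / X) * rpow (f t) p + (/ q * / Y) * rpow (g t) q))).
  - eapply bounded_integral_weaken. apply bounded_integral_scal. 2: apply bounded_integral_plus; apply bounded_integral_scal.
    3: apply BX. 4: apply BY. all: try nra.
    right. replace (/ p * / X * X + / q * / Y * Y) with (/ p * (/ X * X) + / q * (/ Y * Y)) by ring.
    rewrite !Rinv_l by lra. rewrite !Rmult_1_r. replace (/ p + / q) with 1 by lra. ring.
  - intros x. apply (continuous_mult (K:=R_AbsRing)); auto.
  - intros x. split. apply Rmult_le_pos; auto.
    assert (Ia := Rinv_0_lt_compat al Pa). assert (Ib := Rinv_0_lt_compat be Pb).
    assert (Y0 := young (f x * / al) (g x * / be) p q ltac:(generalize (Pf x); nra) ltac:(generalize (Pg x); nra) Hp Hpq).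
    rewrite !rpow_mult in Y0; auto; try lra.
    unfold al at 2, be at 2 in Y0. rewrite !rpow_root in Y0; auto; try lra.
    apply (Rmult_le_compat_l (al * be)) in Y0; [|nra].
    replace (al * be * (f x * / al * (g x * / be))) with (f x * g x) in Y0 by (field; lra).
    eapply Rle_trans. apply Y0. right. ring.
Qed.

Lemma bounded_integral_power_decay p : 1 < p -> bounded_integral (fun t => Rpower (1 + Rabs t) (- p)) (2 * / (p - 1)).
Proof.
  intros Hp. apply (bounded_integral_even (fun t => Rpower (1 + t) (- p)) (fun t => exp ((1 - p) * ln (1 + t)) / (1 - p))).
  - intros t Ht. apply (ex_derive_continuous (V:=R_NormedModule)). unfold Rpower. auto_derive. lra.
  - intros t Ht. left. apply exp_pos.
  - intros t Ht. auto_derive. lra. unfold Rpower.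
    replace (- p * ln (1 + t)) with ((1 - p) * ln (1 + t) + - ln (1 + t)) by ring.
    rewrite exp_plus, exp_Ropp, exp_ln by lra. field. lra.
  - intros t Ht. rewrite Rplus_0_r, ln_1, Rmult_0_r, exp_0.
    assert (0 < exp ((1 - p) * ln (1 + t))) by apply exp_pos.
    replace (exp ((1 - p) * ln (1 + t)) / (1 - p) - 1 / (1 - p)) with ((1 - exp ((1 - p) * ln (1 + t))) * / (p - 1)) by (field; lra).
    assert (0 < / (p - 1)) by (apply Rinv_0_lt_compat; lra). nra.
Qed.

(** Decay of order 1/|t| is p-integrable for every p > 1. The point [t0] makes the integral strictly
    positive, as the normalization in Hoelder's inequality demands. *)
Lemma Lp_facts (g : R -> C) p t0 : 1 < p -> Ccont g -> (forall t, Cmod (g t) <= 5 / (1 + Rabs t)) ->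
  0 < Cmod (g t0) ->
  Lp_integrable p g /\ 0 < int_R (fun t => rpow (Cmod (g t)) p) /\
  bounded_integral (fun t => rpow (Cmod (g t)) p) (int_R (fun t => rpow (Cmod (g t)) p)).
Proof.
  intros Hp Hc Hd H0.
  assert (Cc : forall x : R, continuous (fun t => rpow (Cmod (g t)) p) x).
  { intros x. apply (continuous_comp (fun t => Cmod (g t)) (fun y => rpow y p)).
    apply continuous_Cmod; auto. apply continuous_rpow; lra. }
  assert (B : bounded_integral (fun t => rpow (Cmod (g t)) p) (Rpower 5 p * (2 * / (p - 1)))).
  { apply (bounded_integral_le _ (fun t => Rpower 5 p * Rpower (1 + Rabs t) (- p))); auto.
    - apply bounded_integral_scal. left; apply exp_pos. apply bounded_integral_power_decay; auto.
    - intros t. split. apply rpow_nonneg.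
      assert (P := Rabs_pos t).
      eapply Rle_trans. apply rpow_le. lra. apply Hd.
      unfold Rdiv. assert (Q : 0 < / (1 + Rabs t)) by (apply Rinv_0_lt_compat; lra).
      rewrite rpow_mult by lra. rewrite !rpow_pos by lra. right. f_equal.
      unfold Rpower. f_equal. rewrite ln_Rinv by lra. ring. }
  destruct (bounded_integral_lim _ _ B) as (l & Hl & Hle & _).
  assert (G := Rlimint_gen _ _ Cc Hl).
  assert (E : int_R (fun t => rpow (Cmod (g t)) p) = l).
  { unfold int_R. apply is_RInt_gen_unique; auto; apply Proper_StrongProper; apply Rbar_locally_filter. }
  rewrite E. split; [|split].
  - exists l. exact G.
  - assert (Cm := continuous_Cmod g Hc t0).
    assert (L := Cm _ (locally_ball (Cmod (g t0)) (mkposreal _ H0))).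
    destruct L as [d Hd'].
    apply Rlt_le_trans with (RInt (fun t => rpow (Cmod (g t)) p) t0 (t0 + d / 2)).
    + assert (Pd := cond_pos d). apply RInt_gt_0; auto. lra. intros x Hx. apply rpow_gt0.
      assert (Hb : ball t0 d x). { change (Rabs (x - t0) < d). apply Rabs_def1; lra. }
      specialize (Hd' x Hb). change (Rabs (Cmod (g x) - Cmod (g t0)) < Cmod (g t0)) in Hd'.
      apply Rabs_def2 in Hd'. lra.
    + apply Hle. generalize (cond_pos d); lra.
  - destruct B as (A & P & _). split; auto.
Qed.

Lemma cderiv_u1 : cderiv (u 1) = du1.
Proof. apply functional_extensionality. intros t. apply cderiv_unique, Cder_u1. Qed.

Lemma u1_0 : u 1 0 = RtoC 1.
Proof. unfold u. destruct (Req_EM_T 0 0); [auto|lra]. Qed.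

Lemma du1_0 : Cmod (du1 0) = / 2.
Proof.
  unfold du1. rewrite Cmod_mult, Cmod_opp, Cmod_ci, Rmult_1_l. unfold Etr.
  rewrite (RInt_ext_all _ (fun x => x)).
  2:{ intros x. rewrite Rmult_0_r, cos_0. ring. }
  rewrite (RInt_ext_all (fun x => x * 1 * sin (x * 0)) (fun x => 0)).
  2:{ intros x. rewrite Rmult_0_r, sin_0. ring. }
  rewrite (RInt_antiderivative (fun x => x) (fun x => x ^ 2 / 2)).
  2: auto_cont. 2: intros; auto_derive; auto; field.
  rewrite RInt_const_mult.
  replace (_, _) with (RtoC (/ 2)). rewrite Cmod_R. apply Rabs_pos_eq; lra.
  apply injective_projections; simpl; field.
Qed.

Lemma Lp_u1 p : 1 < p -> Lp_integrable p (u 1) /\ 0 < int_R (fun t => rpow (Cmod (u 1 t)) p) /\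
  bounded_integral (fun t => rpow (Cmod (u 1 t)) p) (int_R (fun t => rpow (Cmod (u 1 t)) p)).
Proof.
  intros. apply (Lp_facts (u 1) p 0); auto. apply Ccont_u. apply u1_decay.
  rewrite u1_0, Cmod_1. lra.
Qed.

Lemma Lp_du1 p : 1 < p -> Lp_integrable p du1 /\ 0 < int_R (fun t => rpow (Cmod (du1 t)) p) /\
  bounded_integral (fun t => rpow (Cmod (du1 t)) p) (int_R (fun t => rpow (Cmod (du1 t)) p)).
Proof.
  intros. apply (Lp_facts du1 p 0); auto. apply Ccont_du1. apply du1_decay.
  rewrite du1_0. lra.
Qed.

Lemma bounded_integral_dilate_inv (f : R -> R) B s : s <> 0 -> bounded_integral f B -> bounded_integral (fun t => f (s * t)) (/ Rabs s * B).
Proof.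
  intros Hs H. assert (P : 0 < Rabs s) by (apply Rabs_pos_lt; auto).
  apply (bounded_integral_ext (fun t => / Rabs s * (Rabs s * f (s * t)))).
  { intros x. rewrite <- Rmult_assoc, Rinv_l by lra. ring. }
  apply bounded_integral_scal. left; apply Rinv_0_lt_compat; auto. apply bounded_integral_dilate; auto.
Qed.

Lemma bounded_integral_holder_dilated (f g : R -> C) p q X Y s h : 1 < p -> 1 / p + 1 / q = 1 ->
  Ccont f -> Ccont g -> 0 < X -> 0 < Y ->
  bounded_integral (fun t => rpow (Cmod (f t)) p) X -> bounded_integral (fun t => rpow (Cmod (g t)) q) Y ->
  bounded_integral (fun t => (Rabs s ^ 2 * Cmod (f (s * t))) * (Rabs h * Cmod (g (h * t))))
    (rpow X (1 / p) * rpow Y (1 / q) * rpow (Rabs s) (2 - 1 / p) * rpow (Rabs h) (1 - 1 / q)).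
Proof.
  intros Hp Hpq Cf Cg HX HY BX BY.
  (* Dilation requires s and h to be nonzero; in the excluded cases the product and the bound both
     vanish. *)
  destruct (Req_dec s 0) as [->|Hs].
  { rewrite Rabs_R0, rpow_0. apply (bounded_integral_ext (fun _ => 0)). intros; ring.
    replace (_ * _) with 0 by ring. apply bounded_integral_0. }
  destruct (Req_dec h 0) as [->|Hh].
  { rewrite Rabs_R0, rpow_0. apply (bounded_integral_ext (fun _ => 0)). intros; ring.
    rewrite Rmult_0_r. apply bounded_integral_0. }
  assert (Ps : 0 < Rabs s) by (apply Rabs_pos_lt; auto).
  assert (Ph : 0 < Rabs h) by (apply Rabs_pos_lt; auto).
  assert (Is := Rinv_0_lt_compat _ Ps). assert (Ih := Rinv_0_lt_compat _ Ph).
  assert (H := bounded_integral_holder (fun t => Cmod (f (s * t))) (fun t => Cmod (g (h * t))) p q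
    (/ Rabs s * X) (/ Rabs h * Y) Hp Hpq
    (continuous_Cmod _ (Ccont_comp f (fun t => s * t) Cf (continuous_mult_const s)))
    (continuous_Cmod _ (Ccont_comp g (fun t => h * t) Cg (continuous_mult_const h)))
    (fun t => Cmod_ge_0 _) (fun t => Cmod_ge_0 _) ltac:(nra) ltac:(nra)
    (bounded_integral_dilate_inv (fun t => rpow (Cmod (f t)) p) X s Hs BX)
    (bounded_integral_dilate_inv (fun t => rpow (Cmod (g t)) q) Y h Hh BY)).
  apply (bounded_integral_scal (Rabs s ^ 2 * Rabs h)) in H. 2: nra.
  eapply bounded_integral_weaken. eapply bounded_integral_ext. 2: apply H. intros x; simpl; ring.
  right. rewrite !rpow_mult by lra.
  replace (2 - 1 / p) with (2 + - (1 / p)) by ring. replace (1 - 1 / q) with (1 + - (1 / q)) by ring.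
  rewrite !rpow_plus, rpow_2, rpow_1 by lra.
  assert (E : forall z r, 0 < z -> rpow (/ z) r = rpow z (- r)).
  { intros z r Hz. assert (Iz := Rinv_0_lt_compat _ Hz). rewrite !rpow_pos by auto. unfold Rpower.
    rewrite ln_Rinv by auto. f_equal. ring. }
  rewrite !E by auto. ring.
Qed.

(** The two mixed products use Hoelder with (rho, sigma) and with (sigma, rho), the derivative
    always carrying the first exponent; 1 - 1/sigma = 1/rho then matches the powers of |s| and
    |h|. *)
Lemma Omega_holder_bound F rho sigma s h : in_Bc F -> 1 < rho -> 1 / rho + 1 / sigma = 1 ->
  Cmod (Omega F (s + h) - Omega F s) <= alex_norm F *
    (varv1 * h ^ 2
     + Lnorm rho du1 * Lnorm sigma (u 1) * rpow (Rabs h) (2 - 1 / rho) * rpow (Rabs s) (1 / rho)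
     + Lnorm rho (u 1) * Lnorm sigma du1 * rpow (Rabs h) (1 - 1 / rho) * rpow (Rabs s) (1 + 1 / rho)).
Proof.
  intros HF Hr Hrs. destruct (conj_exponent _ _ Hr Hrs) as [Hs Hsr].
  apply Omega_increment; auto.
  destruct (Lp_u1 rho Hr) as (_ & U1 & U2). destruct (Lp_u1 sigma Hs) as (_ & U3 & U4).
  destruct (Lp_du1 rho Hr) as (_ & U5 & U6). destruct (Lp_du1 sigma Hs) as (_ & U7 & U8).
  assert (A := bounded_integral_holder_dilated du1 (u 1) rho sigma _ _ h s Hr Hrs Ccont_du1 (Ccont_u 1) U5 U3 U6 U4).
  assert (B := bounded_integral_holder_dilated du1 (u 1) sigma rho _ _ s h Hs Hsr Ccont_du1 (Ccont_u 1) U7 U1 U8 U2).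
  fold (Lnorm rho du1) in A. fold (Lnorm sigma (u 1)) in A.
  fold (Lnorm sigma du1) in B. fold (Lnorm rho (u 1)) in B.
  eapply bounded_integral_weaken. eapply bounded_integral_ext.
  2: apply (bounded_integral_plus _ _ _ _ (bounded_integral_dv h) (bounded_integral_plus _ _ _ _ B A)).
  - intros t. simpl. rewrite !Cmod_du, (Cmod_u s t), (Cmod_u h t). ring.
  - right. replace (1 - 1 / sigma) with (1 / rho) by lra.
    replace (2 - 1 / sigma) with (1 + 1 / rho) by lra. ring.
Qed.

(** Derived from (e), which has no logarithm and no restriction on |h|: with 1 - 1/rho = alpha the
    lowest power of |h| is exactly alpha, and the surplus powers are bounded on the compact
    interval. *)
Lemma Omega_holder F : in_Bc F -> forall a b alpha, 0 < alpha < 1 -> exists K, 0 <= K /\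
  forall x y, a <= x <= b -> a <= y <= b ->
    Cmod (Omega F x - Omega F y) <= K * rpow (Rabs (x - y)) alpha.
Proof.
  intros HF a b al [H0 H1].
  set (rho := 1 / (1 - al)). set (sigma := 1 / al).
  assert (Er : 1 / rho = 1 - al) by (unfold rho; field; lra).
  assert (Es : 1 / sigma = al) by (unfold sigma; field; lra).
  assert (Hr : 1 < rho). { unfold rho. apply Rlt_div_r; lra. }
  set (D := Rabs (b - a)). set (S := Rabs a + Rabs b).
  set (L1 := Lnorm rho du1 * Lnorm sigma (u 1)). set (L2 := Lnorm rho (u 1) * Lnorm sigma du1).
  assert (PL1 : 0 <= L1) by (apply Rmult_le_pos; apply rpow_nonneg).
  assert (PL2 : 0 <= L2) by (apply Rmult_le_pos; apply rpow_nonneg).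
  assert (PV := varv1_pos). assert (HN := alex_norm_nonneg F HF).
  exists (alex_norm F * (varv1 * rpow D (2 - al) + L1 * D * rpow S (1 - al) + L2 * rpow S (2 - al))).
  assert (PD : 0 <= D) by apply Rabs_pos.
  split.
  { apply Rmult_le_pos; auto.
    generalize (rpow_nonneg D (2 - al)) (rpow_nonneg S (1 - al)) (rpow_nonneg S (2 - al)). intros.
    assert (0 <= L1 * D) by (apply Rmult_le_pos; auto).
    assert (0 <= L1 * D * rpow S (1 - al)) by (apply Rmult_le_pos; auto).
    assert (0 <= L2 * rpow S (2 - al)) by (apply Rmult_le_pos; auto).
    assert (0 <= varv1 * rpow D (2 - al)) by (apply Rmult_le_pos; auto; lra). lra. }
  intros x y Hx Hy.
  assert (K := Omega_holder_bound F rho sigma y (x - y) HF Hr ltac:(lra)).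
  replace (y + (x - y)) with x in K by ring.
  eapply Rle_trans. apply K. rewrite (Rmult_assoc (alex_norm F)). apply Rmult_le_compat_l; auto.
  fold L1 L2. rewrite Er. set (h := Rabs (x - y)).
  assert (Ph : 0 <= h) by apply Rabs_pos.
  assert (hD : h <= D). { unfold h, D. apply Rabs_le_between'. rewrite (Rabs_pos_eq (b - a)) by lra. lra. }
  assert (yS : Rabs y <= S).
  { unfold S. apply Rabs_le. generalize (Rle_abs b) (Rle_abs (- a)) (Rabs_pos a) (Rabs_pos b). rewrite Rabs_Ropp. lra. }
  replace (2 - (1 - al)) with (al + 1) by ring. replace (1 - (1 - al)) with al by ring.
  replace (1 + (1 - al)) with (2 - al) by ring.
  replace ((x - y) ^ 2) with (rpow h (al + (2 - al))).
  2:{ replace (al + (2 - al)) with 2 by ring. rewrite rpow_2 by auto. unfold h. apply pow2_abs. }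
  rewrite !rpow_plus, (rpow_1 h) by auto.
  assert (A1 := rpow_le h D (2 - al) ltac:(lra) hD).
  assert (A2 := rpow_le _ _ (1 - al) ltac:(lra) yS). assert (A3 := rpow_le _ _ (2 - al) ltac:(lra) yS).
  assert (Pa := rpow_nonneg h al).
  assert (Q1 := rpow_nonneg (Rabs y) (1 - al)). assert (Q2 := rpow_nonneg (Rabs y) (2 - al)).
  set (r := rpow h al) in *.
  assert (T1 : varv1 * (r * rpow h (2 - al)) <= varv1 * (r * rpow D (2 - al))).
  { apply Rmult_le_compat_l. lra. apply Rmult_le_compat_l; auto. }
  assert (T2 : L1 * (r * h) * rpow (Rabs y) (1 - al) <= L1 * (r * D) * rpow S (1 - al)).
  { apply Rmult_le_compat; auto. apply Rmult_le_pos; auto. apply Rmult_le_pos; auto.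
    apply Rmult_le_compat_l; auto. apply Rmult_le_compat_l; auto. }
  assert (T3 : L2 * r * rpow (Rabs y) (2 - al) <= L2 * r * rpow S (2 - al)).
  { apply Rmult_le_compat_l; auto. apply Rmult_le_pos; auto. }
  lra.
Qed.

Lemma Omega_continuous F s : in_Bc F -> continuous (Omega F) s.
Proof.
  intros HF. apply (proj2 (filterlim_C (locally s) (Omega F) (Omega F s))).
  intros eps He. destruct (Omega_holder F HF (s - 1) (s + 1) (1 / 2)) as (K & HK & H); [lra|].
  set (d := Rmin 1 ((eps / (K + 1)) ^ 2)).
  assert (Pe : 0 < eps / (K + 1)) by (apply Rdiv_lt_0_compat; lra).
  assert (Hd : 0 < d). { apply Rmin_pos. lra. apply pow_lt; auto. }
  exists (mkposreal _ Hd). intros y Hy. change (Rabs (y - s) < d) in Hy.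
  assert (D1 : Rabs (y - s) < 1) by (eapply Rlt_le_trans; [apply Hy|apply Rmin_l]).
  assert (D2 : Rabs (y - s) < (eps / (K + 1)) ^ 2) by (eapply Rlt_le_trans; [apply Hy|apply Rmin_r]).
  apply Rabs_def2 in D1.
  eapply Rle_lt_trans. apply H; lra.
  assert (rpow (Rabs (y - s)) (1 / 2) <= eps / (K + 1)).
  { apply Rle_trans with (rpow ((eps / (K + 1)) ^ 2) (1 / 2)).
    apply rpow_le; lra. rewrite <- rpow_2 by lra. rewrite !rpow_pos by (auto; rewrite rpow_pos; auto; apply exp_pos).
    rewrite Rpower_mult. replace (2 * (1 / 2)) with 1 by field. rewrite Rpower_1 by auto. lra. }
  apply (Rmult_le_compat_l K) in H0; auto.
  assert (K * (eps / (K + 1)) < eps).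
  { apply (Rmult_lt_reg_r (K + 1)). lra.
    replace (K * (eps / (K + 1)) * (K + 1)) with (K * eps) by (field; lra). nra. }
  lra.
Qed.

(** * Sharpness of the growth estimate *)

Ltac ringR := match goal with |- @eq _ ?a ?b => change (@eq R a b) end; ring.

Definition sqplus (x : R) : R := Rmax 0 x ^ 2.

Lemma is_derive_sqplus x : is_derive sqplus x (2 * Rmax 0 x).
Proof.
  unfold sqplus. destruct (Rtotal_order x 0) as [H|[->|H]].
  - rewrite Rmax_left by lra. rewrite Rmult_0_r.
    apply (is_derive_ext_loc (fun _ => 0)).
    + assert (H' : 0 < - x) by lra. exists (mkposreal _ H'). intros y Hy.
      change (Rabs (y - x) < - x) in Hy. apply Rabs_def2 in Hy. rewrite Rmax_left by lra. ringR.
    + apply @is_derive_const.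
  - rewrite Rmax_left, Rmult_0_r by lra. apply (is_derive_0_of_square _ 1).
    intros s. rewrite Rmult_1_l, Rabs_pos_eq by apply pow2_ge_0.
    unfold Rmax. destruct (Rle_dec 0 s). lra. generalize (pow2_ge_0 s). lra.
  - rewrite Rmax_right by lra. apply (is_derive_ext_loc (fun x => x ^ 2)).
    + exists (mkposreal _ H). intros y Hy.
      change (Rabs (y - x) < x) in Hy. apply Rabs_def2 in Hy. rewrite Rmax_right by lra. ringR.
    + auto_derive; auto. ring.
Qed.

(* A C^1 step from 0 (on x <= 0) to 1 (on x >= 1). *)
Definition step (x : R) : R := 2 * sqplus x - 4 * sqplus (x - 1 / 2) + 2 * sqplus (x - 1).

(** The hat function on [0, 1] with peak 2 at 1/2: nonnegative and of integral 1. *)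
Definition dstep (x : R) : R := 4 * Rmax 0 x - 8 * Rmax 0 (x - 1 / 2) + 4 * Rmax 0 (x - 1).

Lemma is_derive_step x : is_derive step x (dstep x).
Proof.
  unfold step, dstep.
  assert (A : forall c, is_derive (fun x => sqplus (x - c)) x (2 * Rmax 0 (x - c))).
  { intros c. replace (2 * Rmax 0 (x - c)) with (1 * (2 * Rmax 0 (x - c))) by ring.
    apply (is_derive_comp sqplus (fun x => x - c)). apply is_derive_sqplus. auto_derive; auto; ring. }
  evar_last. apply (is_derive_plus (fun x => 2 * sqplus x - 4 * sqplus (x - 1 / 2)) (fun x => 2 * sqplus (x - 1))).
  apply (is_derive_minus (fun x => 2 * sqplus x) (fun x => 4 * sqplus (x - 1 / 2))).
  apply is_derive_scal, is_derive_sqplus. apply is_derive_scal, A. apply is_derive_scal, A.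
  unfold plus, minus, plus, opp; simpl. ring.
Qed.

Lemma step_mono x y : x <= y -> step x <= step y.
Proof.
  intros [H| <-]; [|lra].
  destruct (MVT_gen step x y dstep) as (c & _ & E).
  - intros; apply is_derive_step.
  - intros z _. apply continuity_pt_filterlim. apply (ex_derive_continuous (V:=R_NormedModule)).
    eexists; apply is_derive_step.
  - assert (0 <= dstep c). { unfold dstep, Rmax. repeat destruct (Rle_dec _ _); lra. }
    nra.
Qed.

Lemma step_0 x : x <= 0 -> step x = 0.
Proof. intros H. unfold step, sqplus. rewrite !Rmax_left by lra. ring. Qed.

Lemma step_1 x : 1 <= x -> step x = 1.
Proof. intros H. unfold step, sqplus. rewrite !Rmax_right by lra. field. Qed.

Lemma step_range x : 0 <= step x <= 1.
Proof.
  split.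
  - destruct (Rle_dec x 0). rewrite step_0 by auto; lra. rewrite <- (step_0 0) by lra. apply step_mono; lra.
  - destruct (Rle_dec 1 x). rewrite step_1 by auto; lra. rewrite <- (step_1 1) by lra. apply step_mono; lra.
Qed.

(** What sharpness needs: however fast tau_n tends to 0, F(tau_n) is still at least 2^{-n}.
    Monotonicity feeds the lower bound for Omega, and differentiability off 0 feeds
    Henstock-Kurzweil integrability. *)
Record slow_primitive (tau : nat -> R) (F : R -> R) : Prop := {
  slow_zero : forall t, t <= 0 -> F t = 0;
  slow_mono : forall x y, x <= y -> F x <= F y;
  slow_const : forall t, 1 <= t -> F t = F 1;
  slow_large : forall n, (1 / 2) ^ n <= F (tau n);
  slow_derive : forall t, t <> 0 -> ex_derive F t;
  slow_continuous : forall t : R, continuous F t }.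

Section SlowPrimitive.
Variable tau : nat -> R.
Hypothesis Htau : forall n, 0 < tau n <= / INR (S n).

(** The n-th step is complete at tau_n and then contributes 2^{-n}. Because tau_n <= 1/(n + 1), only
    finitely many steps vary near a point t > 0. *)
Let a (t : R) (n : nat) : R := (1 / 2) ^ n * step (t / tau n).
Let F (t : R) : R := Series (a t).

Let pow_half_pos n : 0 < (1 / 2) ^ n.
Proof. apply pow_lt; lra. Qed.

Let ex_geom : ex_series (fun n => (1 / 2) ^ n).
Proof. apply ex_series_geom. rewrite Rabs_pos_eq; lra. Qed.

Let a_range t n : 0 <= a t n <= (1 / 2) ^ n.
Proof.
  unfold a. generalize (pow_half_pos n) (step_range (t / tau n)). nra.
Qed.

Let ex_a t : ex_series (a t).
Proof.
  apply (ex_series_le (V:=R_CompleteNormedModule) (a t) (fun n => (1 / 2) ^ n)); auto.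
  intros n. change (Rabs (a t n) <= (1 / 2) ^ n). rewrite Rabs_pos_eq; apply a_range.
Qed.

Let a_mono x y n : x <= y -> a x n <= a y n.
Proof.
  intros H. unfold a. apply Rmult_le_compat_l. left; apply pow_half_pos. apply step_mono.
  apply Rmult_le_compat_r; auto. left; apply Rinv_0_lt_compat, Htau.
Qed.

Let F_split t n : F t = sum_f_R0 (a t) n + Series (fun k => a t (S n + k)).
Proof. unfold F. rewrite (Series_incr_n (a t) (S n)); auto. lia. Qed.

Let ex_tail t n : ex_series (fun k => a t (S n + k)).
Proof. apply (ex_series_incr_n (V:=R_NormedModule) (a t) (S n)). auto. Qed.

Let tail_range t n : 0 <= Series (fun k => a t (S n + k)) <= (1 / 2) ^ n.
Proof.
  split.
  - replace 0 with (Series (fun _ : nat => 0)).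
    + apply Series_le; auto. intros k; split; [lra|apply a_range].
    + rewrite (Series_ext _ (fun _ => 0 * 0)) by (intros; ring). rewrite Series_scal_l. ring.
  - replace ((1 / 2) ^ n) with (Series (fun k => (1 / 2) ^ S n * (1 / 2) ^ k)).
    + apply Series_le.
      * intros k. rewrite <- pow_add. apply a_range.
      * apply (ex_series_scal (V:=R_NormedModule) ((1/2) ^ S n) (fun k => (1 / 2) ^ k)); auto.
    + rewrite Series_scal_l, Series_geom by (rewrite Rabs_pos_eq; lra). simpl. field.
Qed.

Let sum_nonneg t n : 0 <= sum_f_R0 (a t) n.
Proof. induction n; simpl. apply a_range. generalize (a_range t (S n)). lra. Qed.

Let F_zero t : t <= 0 -> F t = 0.
Proof.
  intros Ht. unfold F. rewrite (Series_ext _ (fun _ => 0 * 0)).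
  - rewrite Series_scal_l. ring.
  - intros n. unfold a. rewrite step_0. ring.
    assert (I := Rinv_0_lt_compat _ (proj1 (Htau n))). unfold Rdiv. nra.
Qed.

Let F_mono x y : x <= y -> F x <= F y.
Proof.
  intros H. apply Series_le; auto. intros n. split. apply a_range. apply a_mono; auto.
Qed.

Let tau_small n : tau n <= 1.
Proof.
  eapply Rle_trans. apply Htau. rewrite <- Rinv_1. apply Rinv_le_contravar. lra.
  rewrite S_INR. generalize (pos_INR n). lra.
Qed.

Let a_saturated t n : tau n <= t -> a t n = (1 / 2) ^ n.
Proof.
  intros H. unfold a. rewrite step_1. ring. apply Rle_div_r. apply Htau. lra.
Qed.

Let F_const t : 1 <= t -> F t = F 1.
Proof.
  intros Ht. apply Series_ext. intros n.
  rewrite !a_saturated; auto. generalize (tau_small n). lra.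
Qed.

Let F_large n : (1 / 2) ^ n <= F (tau n).
Proof.
  rewrite (F_split _ n). generalize (tail_range (tau n) n). intros [H _].
  assert ((1 / 2) ^ n <= sum_f_R0 (a (tau n)) n); [|lra].
  rewrite <- (a_saturated (tau n) n) at 1 by lra.
  destruct n; simpl; [lra|]. generalize (sum_nonneg (tau (S n)) n). lra.
Qed.

Let sum_derive t n : ex_derive (fun t => sum_f_R0 (a t) n) t.
Proof.
  assert (A : forall k, ex_derive (fun t => a t k) t).
  { intros k. apply (ex_derive_scal (fun t => step (t / tau k)) ((1 / 2) ^ k)).
    apply (ex_derive_comp step (fun t => t / tau k)). eexists; apply is_derive_step.
    auto_derive. auto. }
  induction n; simpl. apply A.
  apply (ex_derive_plus (fun t => sum_f_R0 (a t) n) (fun t => a t (S n))); auto.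
Qed.

Let F_derive t : t <> 0 -> ex_derive F t.
Proof.
  intros Ht. destruct (Rlt_dec t 0) as [L|L].
  - apply (ex_derive_ext_loc (fun _ => 0)). 2: apply ex_derive_const.
    assert (H' : 0 < - t) by lra. exists (mkposreal _ H'). intros y Hy.
    change (Rabs (y - t) < - t) in Hy. apply Rabs_def2 in Hy. rewrite F_zero; auto. lra.
  - assert (P : 0 < t / 2) by lra.
    (* All steps of index above N are complete before t/2, so on a neighbourhood of t the tail of
       the series is constant. *)
    destruct (archimed_cor1 (t / 2) P) as (N & HN & HN0).
    apply (ex_derive_ext_loc (fun y => sum_f_R0 (a y) N + Series (fun k => (1 / 2) ^ (S N + k)))).
    + exists (mkposreal _ P). intros y Hy.
      change (Rabs (y - t) < t / 2) in Hy. apply Rabs_def2 in Hy. rewrite (F_split y N). f_equal.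
      apply Series_ext. intros k. symmetry. apply a_saturated.
      apply Rle_trans with (/ INR N); [|lra].
      eapply Rle_trans. apply Htau. apply Rinv_le_contravar. apply lt_0_INR; auto. apply le_INR. lia.
    + apply (ex_derive_plus (fun y => sum_f_R0 (a y) N) (fun _ => _)). apply sum_derive. apply ex_derive_const.
Qed.

Let F_continuous (t : R) : continuous F t.
Proof.
  destruct (Req_dec t 0) as [->|Ht].
  2: apply (ex_derive_continuous (V:=R_NormedModule)); apply F_derive; auto.
  apply continuity_pt_filterlim. intros eps He.
  destruct (pow_lt_1_zero (1 / 2) ltac:(rewrite Rabs_pos_eq; lra) (eps / 2) ltac:(lra)) as [N HN].
  specialize (HN N (Nat.le_refl N)). rewrite Rabs_pos_eq in HN by (left; apply pow_half_pos).
  assert (C : continuity_pt (fun t => sum_f_R0 (a t) N) 0).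
  { apply continuity_pt_filterlim. apply (ex_derive_continuous (V:=R_NormedModule)). apply sum_derive. }
  destruct (C (eps / 2)) as (d & Hd & K); [lra|].
  exists d. split; auto. intros y [Hy1 Hy2]. specialize (K y (conj Hy1 Hy2)).
  simpl in *. unfold Rdist in *.
  assert (S0 : sum_f_R0 (a 0) N = 0).
  { generalize (F_split 0 N) (tail_range 0 N) (sum_nonneg 0 N). rewrite F_zero by lra. lra. }
  rewrite (F_zero 0) by lra. rewrite S0 in K.
  rewrite (F_split y N). generalize (tail_range y N) (sum_nonneg y N). intros.
  rewrite Rminus_0_r in *. rewrite Rabs_pos_eq in * by lra. lra.
Qed.

Lemma exists_slow_primitive : exists F, slow_primitive tau F.
Proof. exists F. constructor; auto. Qed.

End SlowPrimitive.

(** * Lower bound for Re Omega on monotone primitives *)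

Lemma cos_upper y : 0 <= y <= 1 -> y ^ 2 / 8 <= 1 - cos y.
Proof.
  intros H. destruct (pre_cos_bound y 0) as [_ U]; try lra.
  replace (cos_approx y (2 * (0 + 1))) with (1 - y ^ 2 / 2 + y ^ 4 / 24) in U.
  2:{ unfold cos_approx, cos_term. simpl. field. }
  assert (y ^ 4 <= y ^ 2).
  { replace (y ^ 4) with (y ^ 2 * y ^ 2) by ring.
    rewrite <- (Rmult_1_r (y ^ 2)) at 3. apply Rmult_le_compat_l. apply pow2_ge_0. simpl. nra. }
  generalize (pow2_ge_0 y). lra.
Qed.

Lemma Re_v_nonneg s t : 0 <= Re (v s t).
Proof.
  destruct (Req_dec t 0) as [->|Ht].
  - rewrite v_0. simpl. generalize (pow2_ge_0 s). simpl. lra.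
  - rewrite v_nonzero by auto. simpl. apply Rdiv_le_0_compat.
    generalize (COS_bound (s * t)). lra. generalize (pow2_gt_0 t Ht). simpl. auto.
Qed.

Lemma Re_v_lower s t : 0 < s -> 0 < t -> s * t <= 1 -> s ^ 2 / 8 <= Re (v s t).
Proof.
  intros Hs Ht H. rewrite v_nonzero by lra.
  change (s ^ 2 / 8 <= (1 - cos (s * t)) / t ^ 2).
  assert (K := cos_upper (s * t) ltac:(nra)).
  apply (Rle_div_r (s ^ 2 / 8) (1 - cos (s * t)) (t ^ 2)). apply pow_lt; auto. replace (s ^ 2 / 8 * t ^ 2) with ((s * t) ^ 2 / 8) by field. auto.
Qed.

(* Abel summation on the Riemann-Stieltjes sums: no derivative of F is needed. *)
Lemma RS_sum_monotone_le (F : R -> R) s tau a b n x :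
  (forall t, t <= 0 -> F t = 0) -> (forall x y, x <= y -> F x <= F y) ->
  0 < s -> 0 < tau -> s * (2 * tau) <= 1 -> a < 0 -> tau < b ->
  tagged_partition a b n x x -> (forall i, (i < n)%nat -> x (S i) - x i < tau) ->
  Re (RS_sum (fun t => RtoC (F t)) (v s) n x x) <= F b * Re (v s b) - s ^ 2 / 8 * F tau.
Proof.
  intros F0 Fm Hs Ht Hst Ha Hb Hp Hm.
  destruct Hp as (H0 & Hn & Hx).
  (* Truncating at F(tau) discards increments beyond tau, where only Re v_s >= 0 is used. A cell
     starting before tau ends before 2 tau by the mesh condition, so s x <= 1 at its right end. *)
  set (H := fun t => Rmin (F t) (F tau)).
  assert (Ft : 0 <= F tau) by (rewrite <- (F0 0); [apply Fm|]; lra).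
  assert (K : forall m, (m <= n)%nat ->
    Re (csum m (fun i => RtoC (F (x i)) * (v s (x (S i)) - v s (x i)))%C) <=
    (F (x m) * Re (v s (x m)) - s ^ 2 / 8 * H (x m)) - (F (x O) * Re (v s (x O)) - s ^ 2 / 8 * H (x O))).
  { induction m; intros Hmn. simpl; lra.
    specialize (IHm ltac:(lia)). specialize (Hx m ltac:(lia)). specialize (Hm m ltac:(lia)).
    assert (Re (csum (S m) (fun i => RtoC (F (x i)) * (v s (x (S i)) - v s (x i)))%C) =
      Re (csum m (fun i => RtoC (F (x i)) * (v s (x (S i)) - v s (x i)))%C) +
      F (x m) * (Re (v s (x (S m))) - Re (v s (x m)))) as ->.
    { simpl. unfold Re. ring. }
    assert (P := Re_v_nonneg s (x (S m))). assert (M := Fm (x m) (x (S m)) ltac:(lra)).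
    (* Summation by parts: with the tag at the left end, the increment of F is paired with the value
       of v_s at the right end. *)
    enough (s ^ 2 / 8 * (H (x (S m)) - H (x m)) <= (F (x (S m)) - F (x m)) * Re (v s (x (S m)))) by lra.
    unfold H. destruct (Rle_dec tau (x m)) as [L|L].
    - rewrite !Rmin_right by (apply Fm; lra). nra.
    - destruct (Rle_dec (x (S m)) 0) as [L'|L'].
      + rewrite !(F0 (x m)), !(F0 (x (S m))) by lra. lra.
      + assert (Q := Re_v_lower s (x (S m)) Hs ltac:(lra) ltac:(nra)).
        assert (Rmin (F (x (S m))) (F tau) - Rmin (F (x m)) (F tau) <= F (x (S m)) - F (x m)).
        { unfold Rmin. repeat destruct (Rle_dec _ _); lra. }
        assert (0 <= s ^ 2 / 8) by (generalize (pow2_ge_0 s); lra). nra. }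
  specialize (K n (Nat.le_refl n)). unfold RS_sum. rewrite H0, Hn in K.
  unfold H in K. rewrite (F0 a) in K by lra. rewrite (Rmin_right (F b)) in K by (apply Fm; lra).
  rewrite (Rmin_left 0) in K by auto. lra.
Qed.

(** Omega is minus the Stieltjes integral, so the upper bound on the sums becomes a lower bound. The
    three thirds of eps pay for the truncation, the Stieltjes sum and the boundary term F(b) Re
    v_s(b). *)
Lemma Re_Omega_lower (F : R -> R) s tau : in_Bc (fun t => RtoC (F t)) ->
  (forall t, t <= 0 -> F t = 0) -> (forall x y, x <= y -> F x <= F y) ->
  0 < s -> 0 < tau -> s * (2 * tau) <= 1 ->
  s ^ 2 / 8 * F tau <= Re (Omega (fun t => RtoC (F t)) s).
Proof.
  intros HF F0 Fm Hs Ht Hst. set (Fc := fun t => RtoC (F t)) in *.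
  set (N := alex_norm Fc). assert (HN := alex_norm_nonneg _ HF). fold N in HN.
  apply le_epsilon. intros eps He.
  destruct (Omega_Clim Fc s HF (eps / 3)) as (M & HM & A); [lra|].
  destruct (v_small s (eps / (3 * (N + 1)))) as (M' & HM' & A').
  { apply Rdiv_lt_0_compat; lra. }
  set (b := M + M' + tau + 1).
  specialize (A (- b) b ltac:(unfold b; lra) ltac:(unfold b; lra)).
  specialize (A' b). rewrite Rabs_pos_eq in A' by (unfold b; lra). specialize (A' ltac:(unfold b; lra)).
  set (z := CI _ _ _) in *.
  assert (RSz := RS_C1 Fc (v s) (dv s) (- b) b ltac:(unfold b; lra) (in_Bc_Ccont Fc HF) (Cder_v s) (Ccont_dv s)).
  fold z in RSz.
  destruct (RSz (eps / 3)) as (d & Hd & K); [lra|].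
  destruct (uniform_partition (- b) b (Rmin d tau)) as (n & x & Hp & Hm & _).
  { unfold b; lra. } { apply Rmin_pos; auto. }
  specialize (K n x x Hp ltac:(intros; eapply Rlt_le_trans; [apply Hm; auto|apply Rmin_l])).
  assert (L := RS_sum_monotone_le F s tau (- b) b n x F0 Fm Hs Ht Hst ltac:(unfold b; lra)
    ltac:(unfold b; lra) Hp ltac:(intros; eapply Rlt_le_trans; [apply Hm; auto|apply Rmin_r])).
  fold Fc in L. set (S := RS_sum _ _ _ _ _) in *.
  assert (R1 := re_le_Cmod (S - z)). assert (R2 := re_le_Cmod (z - - Omega Fc s)).
  assert (E1 : Re (S - z) = Re S - Re z) by (unfold Re; simpl; ring).
  assert (E2 : Re (z - - Omega Fc s) = Re z + Re (Omega Fc s)).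
  { set (o := Omega Fc s). unfold Re; simpl; ring. }
  rewrite E1 in R1. rewrite E2 in R2.
  apply Rabs_le_between in R1. apply Rabs_le_between in R2.
  assert (FN : F b <= N).
  { assert (Q := alex_norm_ge Fc b HF). unfold Fc at 1 in Q. rewrite Cmod_R in Q.
    generalize (Rle_abs (F b)). fold N in Q. lra. }
  assert (Fb : 0 <= F b) by (rewrite <- (F0 0); [apply Fm|]; unfold b; lra).
  assert (Vb := re_le_Cmod (v s b)). assert (Vb0 := Re_v_nonneg s b).
  rewrite Rabs_pos_eq in Vb by auto.
  assert (F b * Re (v s b) <= eps / 3).
  { apply Rle_trans with ((N + 1) * (eps / (3 * (N + 1)))).
    apply Rmult_le_compat; lra. right. field. lra. }
  lra.
Qed.

(** The interval is split at t; the two errors e (t - x) and e (y - t) add up to e (y - x) precisely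
    because t lies between x and y. *)
Lemma straddle (F : R -> R) t l e : is_derive F t l -> 0 < e -> exists d, 0 < d /\
  forall x y, t - d < x -> x <= t -> t <= y -> y < t + d ->
    Rabs (F y - F x - l * (y - x)) <= e * (y - x).
Proof.
  intros H He. apply is_derive_Reals in H. destruct (H e He) as [d Hd].
  exists d. split. apply cond_pos.
  assert (K : forall h, Rabs h < d -> Rabs (F (t + h) - F t - l * h) <= e * Rabs h).
  { intros h Hh. destruct (Req_dec h 0) as [->|H0].
    - rewrite Rplus_0_r, Rabs_R0. replace (F t - F t - l * 0) with 0 by ring. rewrite Rabs_R0; lra.
    - specialize (Hd h H0 Hh). assert (P : 0 < Rabs h) by (apply Rabs_pos_lt; auto).
      replace (F (t + h) - F t - l * h) with (((F (t + h) - F t) / h - l) * h) by (field; auto).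
      rewrite Rabs_mult. apply Rmult_le_compat_r; lra. }
  intros x y H1 H2 H3 H4.
  assert (A := K (x - t) ltac:(apply Rabs_def1; lra)). assert (B := K (y - t) ltac:(apply Rabs_def1; lra)).
  replace (t + (x - t)) with x in A by ring. replace (t + (y - t)) with y in B by ring.
  rewrite (Rabs_left1 (x - t)) in A by lra. rewrite (Rabs_pos_eq (y - t)) in B by lra.
  apply Rabs_le_between in A. apply Rabs_le_between in B. apply Rabs_le. lra.
Qed.

(* The exceptional point 0 costs at most F(d0): the increments over intervals tagged by 0
   are absorbed by those of the monotone function min(F, F(d0)). *)
Lemma HK_of_derivative_off_0 (F : R -> R) :
  (forall t, t <= 0 -> F t = 0) -> (forall x y, x <= y -> F x <= F y) ->
  (forall t : R, continuous F t) -> (forall t, t <> 0 -> ex_derive F t) ->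
  HK_function_with_primitive
    (fun t => if Req_EM_T t 0 then RtoC 0 else RtoC (Derive F t)) (fun t => RtoC (F t)).
Proof.
  intros F0 Fm Fc Fd a b Hab eps He.
  (* Half of eps covers the straddle errors, at most e (b - a) in total, and the other half covers
     F(d0). The added 1 admits a = b. *)
  set (e := eps / (2 * (b - a + 1))).
  assert (Pe : 0 < e) by (apply Rdiv_lt_0_compat; lra).
  assert (exists d0, 0 < d0 /\ F d0 < eps / 2) as (d0 & Hd0 & HF0).
  { assert (C := proj2 (continuity_pt_filterlim F 0) (Fc 0)).
    destruct (C (eps / 2)) as (d & Hd & K); [lra|].
    exists (d / 2). split; [lra|]. specialize (K (d / 2)). simpl in K. unfold Rdist in K.
    rewrite (F0 0), !Rminus_0_r in K by lra.
    assert (F (d / 2) <= Rabs (F (d / 2))) by apply Rle_abs.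
    assert (Rabs (F (d / 2)) < eps / 2); [|lra]. apply K. split.
    split; [exact I|]. lra. rewrite Rabs_pos_eq; lra. }
  set (P := fun t d => 0 < d /\ forall x y, t - d < x -> x <= t -> t <= y -> y < t + d ->
    Rabs (F y - F x - Derive F t * (y - x)) <= e * (y - x)).
  set (delta := fun t => if Req_EM_T t 0 then d0 else epsilon (inhabits 0) (P t)).
  assert (Hdelta : forall t, t <> 0 -> P t (delta t)).
  { intros t Ht. unfold delta. destruct (Req_EM_T t 0); [contradiction|]. apply epsilon_spec.
    apply straddle; auto. apply Derive_correct, Fd; auto. }
  exists delta. split.
  { intros t. destruct (Req_dec t 0) as [->|Ht].
    - unfold delta. destruct (Req_EM_T 0 0); [auto|lra].
    - apply (Hdelta t Ht). }
  intros n x xi (H0 & Hn & Hxi) Hfine.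
  set (H := fun t => e * t + Rmin (F t) (F d0)).
  assert (K : forall m, (m <= n)%nat ->
    Cmod (csum m (fun i => (if Req_EM_T (xi i) 0 then RtoC 0 else RtoC (Derive F (xi i))) * RtoC (x (S i) - x i))%C
      - (RtoC (F (x m)) - RtoC (F (x O)))) <= H (x m) - H (x O)).
  { induction m; intros Hmn.
    - simpl. replace (0 - (F (x 0%nat) - F (x 0%nat)))%C with (RtoC 0) by ring. rewrite Cmod_0. lra.
    - specialize (IHm ltac:(lia)). specialize (Hxi m ltac:(lia)). specialize (Hfine m ltac:(lia)).
      change (csum (S m) ?f) with (csum m f + f m)%C.
      set (A := csum m _) in *. cbv beta.
      assert (M := Fm (x m) (x (S m)) ltac:(lra)).
      assert (M' : Rmin (F (x m)) (F d0) <= Rmin (F (x (S m))) (F d0)).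
      { unfold Rmin. repeat destruct (Rle_dec _ _); lra. }
      assert (Q : Cmod ((if Req_EM_T (xi m) 0 then RtoC 0 else RtoC (Derive F (xi m))) * RtoC (x (S m) - x m)
         - (RtoC (F (x (S m))) - RtoC (F (x m)))) <= H (x (S m)) - H (x m)).
      { unfold H. destruct (Req_EM_T (xi m) 0) as [E|E].
        - unfold delta in Hfine. rewrite E in *. destruct (Req_EM_T 0 0); [|lra].
          rewrite <- RtoC_minus, <- RtoC_mult, <- RtoC_minus, Cmod_R.
          rewrite !Rmin_left by (apply Fm; lra).
          rewrite Rabs_left1 by lra. nra.
        - destruct (Hdelta _ E) as [_ D].
          specialize (D (x m) (x (S m)) ltac:(lra) ltac:(lra) ltac:(lra) ltac:(lra)).
          rewrite <- RtoC_minus, <- RtoC_mult, <- RtoC_minus, Cmod_R, Rabs_minus_sym. lra. }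
      set (B := (_ * RtoC (x (S m) - x m))%C) in *.
      replace (A + B - (F (x (S m)) - F (x 0%nat)))%C with
       ((A - (F (x m) - F (x 0%nat))) + (B - (F (x (S m)) - F (x m))))%C by ring.
      eapply Rle_trans. apply Cmod_triangle. lra. }
  specialize (K n (Nat.le_refl n)). rewrite H0, Hn in K.
  eapply Rle_lt_trans. apply K. unfold H.
  assert (F d0 >= 0) by (rewrite <- (F0 0) by lra; apply Rle_ge, Fm; lra).
  assert (Rmin (F b) (F d0) <= F d0) by apply Rmin_r.
  assert (0 <= Rmin (F a) (F d0)).
  { apply Rmin_glb; [|lra]. destruct (Rle_dec a 0). rewrite F0; lra.
    rewrite <- (F0 0) by lra. apply Fm; lra. }
  assert (e * (b - a) < eps / 2).
  { apply Rlt_le_trans with (e * (b - a + 1)). apply Rmult_lt_compat_l; lra.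
    right. unfold e. field. lra. }
  lra.
Qed.

Lemma slow_in_Bc tau F : slow_primitive tau F -> in_Bc (fun t => RtoC (F t)).
Proof.
  intros HF. split; [|split].
  - apply continuous_Ccont. apply Ccont_RtoC. apply (slow_continuous _ _ HF).
  - apply (proj2 (filterlim_C (Rbar_locally m_infty) (fun t => RtoC (F t)) (RtoC 0))).
    intros eps He. exists 0. intros x Hx. rewrite (slow_zero _ _ HF) by lra.
    replace (0 - 0)%C with (RtoC 0) by ring. rewrite Cmod_0. auto.
  - exists (RtoC (F 1)). apply (proj2 (filterlim_C (Rbar_locally p_infty) (fun t => RtoC (F t)) (RtoC (F 1)))).
    intros eps He. exists 1. intros x Hx. rewrite (slow_const _ _ HF) by lra.
    replace (F 1 - F 1)%C with (RtoC 0) by ring. rewrite Cmod_0. auto.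
Qed.

(** Points s_n tending to infinity are chosen with psi(s_n) <= 2^{-n} s_n^2, and tau_n = 1/(2 s_n).
    Then Re Omega(s_n) >= s_n^2 F(tau_n)/8 >= 2^{-n} s_n^2/8 >= psi(s_n)/8, so the quotient stays at
    least 1/8 along s_n. *)
Lemma growth_sharp (psi : R -> R) : (forall s, 0 <= s -> 0 < psi s) ->
  is_lim (fun s => psi s / s ^ 2) p_infty 0 ->
  exists F g, in_Bc F /\ HK_function_with_primitive g F /\
    ~ is_lim (fun s => Cmod (Omega F s) / psi s) p_infty 0.
Proof.
  intros Hpos Hlim. apply is_lim_spec in Hlim.
  assert (HS : forall n, exists s, INR (S n) <= s /\ psi s / s ^ 2 <= (1 / 2) ^ n).
  { intros n. assert (Pn : 0 < (1 / 2) ^ n) by (apply pow_lt; lra).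
    destruct (Hlim (mkposreal _ Pn)) as [M HM]. cbn [pos] in HM.
    exists (Rmax (M + 1) (INR (S n))). split. apply Rmax_r.
    specialize (HM (Rmax (M + 1) (INR (S n)))).
    assert (M < Rmax (M + 1) (INR (S n))) by (eapply Rlt_le_trans; [|apply Rmax_l]; lra).
    specialize (HM H). apply Rabs_def2 in HM. lra. }
  set (sq := fun n => epsilon (inhabits 0) (fun s => INR (S n) <= s /\ psi s / s ^ 2 <= (1 / 2) ^ n)).
  assert (Hs : forall n, INR (S n) <= sq n /\ psi (sq n) / sq n ^ 2 <= (1 / 2) ^ n).
  { intros n. unfold sq. apply epsilon_spec. apply HS. }
  assert (Sn : forall n, 0 < INR (S n)) by (intros; apply lt_0_INR; lia).
  destruct (exists_slow_primitive (fun n => / (2 * sq n))) as [F HF].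
  { intros n. specialize (Sn n). destruct (Hs n) as [H1 _]. split.
    - apply Rinv_0_lt_compat. lra.
    - apply Rinv_le_contravar; lra. }
  assert (HB := slow_in_Bc _ _ HF).
  exists (fun t => RtoC (F t)), (fun t => if Req_EM_T t 0 then RtoC 0 else RtoC (Derive F t)).
  split; [exact HB|split].
  - apply HK_of_derivative_off_0; apply HF.
  - intros L. apply is_lim_spec in L. assert (P8 : 0 < 1 / 8) by lra.
    destruct (L (mkposreal _ P8)) as [M HM]. cbn [pos] in HM.
    destruct (nfloor_ex (Rabs M) (Rabs_pos M)) as (n & _ & Hn).
    destruct (Hs n) as [H1 H2]. specialize (Sn n).
    assert (Hm : M < sq n).
    { generalize (Rle_abs M). rewrite S_INR in H1. lra. }
    specialize (HM (sq n) Hm). rewrite Rminus_0_r in HM.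
    assert (Pp := Hpos (sq n) ltac:(lra)).
    rewrite Rabs_pos_eq in HM. 2: apply Rdiv_le_0_compat; auto; apply Cmod_ge_0.
    apply (Rlt_div_l _ (1 / 8) (psi (sq n))) in HM; auto.
    assert (B := Re_Omega_lower F (sq n) (/ (2 * sq n)) HB (slow_zero _ _ HF) (slow_mono _ _ HF)
      ltac:(lra) ltac:(apply Rinv_0_lt_compat; lra) ltac:(right; field; lra)).
    assert (C := slow_large _ _ HF n). cbv beta in C.
    assert (D := re_le_Cmod (Omega (fun t => RtoC (F t)) (sq n))).
    apply Rabs_le_between in D.
    assert (P2 : 0 < sq n ^ 2) by (apply pow_lt; lra).
    apply Rle_div_l in H2; auto.
    assert (sq n ^ 2 / 8 * (1 / 2) ^ n <= sq n ^ 2 / 8 * F (/ (2 * sq n))).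
    { apply Rmult_le_compat_l; auto. lra. }
    set (p := (1 / 2) ^ n) in *. set (q := sq n ^ 2) in *. clearbody p q. lra.
Qed.

Lemma Omega_0 F : in_Bc F -> Omega F 0 = 0%C.
Proof.
  intros HF. apply Cmod_eq_0. generalize (Omega_bound F 0 HF) (Cmod_ge_0 (Omega F 0)).
  replace (varv1 * alex_norm F * 0 ^ 2) with 0 by ring. lra.
Qed.

(* A primitive for which Omega grows faster than linearly, from the sharpness of o(s^2). *)
Lemma not_Lipschitz : exists F, in_Bc F /\
  ~ (exists L, forall x y, Cmod (Omega F x - Omega F y) <= L * Rabs (x - y)).
Proof.
  set (psi := fun s => (1 + s) * sqrt (1 + s)).
  assert (Pp : forall s, 0 <= s -> 0 < psi s).
  { intros s Hs. apply Rmult_lt_0_compat. lra. apply sqrt_lt_R0; lra. }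
  destruct (growth_sharp psi Pp) as (F & g & HF & _ & HN).
  - apply is_lim_spec. intros eps. assert (Pe := cond_pos eps).
    assert (Q : 0 <= (4 / eps) ^ 2) by apply pow2_ge_0.
    exists (1 + (4 / eps) ^ 2). intros s Hs.
    assert (Ps := Pp s ltac:(lra)).
    rewrite Rminus_0_r, Rabs_pos_eq. 2: apply Rdiv_le_0_compat; [lra|apply pow_lt; lra].
    apply Rlt_div_l. apply pow_lt; lra. unfold psi.
    (* In terms of r = sqrt(1 + s), psi is r^3 and s^2 >= r^4/4, so the quotient is at most 4/r; the
       threshold on s is exactly what makes r > 4/eps. *)
    assert (r2 := sqrt_sqrt (1 + s) ltac:(lra)). set (r := sqrt (1 + s)) in *.
    assert (Pr : 0 <= r) by apply sqrt_pos.
    assert (4 / eps < r).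
    { apply Rnot_le_lt. intros N. assert (P4 : 0 < 4 / eps) by (apply Rdiv_lt_0_compat; lra). nra. }
    assert (4 < eps * r).
    { apply (Rmult_lt_compat_l eps) in H; auto. replace (eps * (4 / eps)) with 4 in H by (field; lra). auto. }
    assert (r22 : r ^ 2 = 1 + s) by (rewrite <- r2; ring).
    assert (r ^ 2 / 2 <= s) by lra.
    assert ((r ^ 2 / 2) ^ 2 <= s ^ 2). { apply pow_incr. split; auto. generalize (pow2_ge_0 r); lra. }
    assert (P4 : 0 < 4 / eps) by (apply Rdiv_lt_0_compat; lra).
    assert (0 < r ^ 3) by (apply pow_lt; lra).
    rewrite <- r2. replace (r * r * r) with (r ^ 3) by ring.
    apply Rlt_le_trans with (eps * (r ^ 2 / 2) ^ 2).
    + replace (eps * (r ^ 2 / 2) ^ 2) with ((eps * r / 4) * r ^ 3) by field. nra.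
    + apply Rmult_le_compat_l; lra.
  - exists F. split; auto. intros [L HL]. apply HN. apply is_lim_spec. intros eps.
    assert (Pe := cond_pos eps). assert (PL := Rabs_pos L).
    assert (Q : 0 <= (Rabs L / eps) ^ 2) by apply pow2_ge_0.
    exists ((Rabs L / eps) ^ 2). intros s Hs.
    assert (Ps := Pp s ltac:(lra)).
    rewrite Rminus_0_r, Rabs_pos_eq. 2: apply Rdiv_le_0_compat; [apply Cmod_ge_0|lra].
    apply Rlt_div_l. auto.
    specialize (HL s 0). rewrite Omega_0 in HL by auto.
    rewrite Rminus_0_r, (Rabs_pos_eq s) in HL by lra.
    replace (Omega F s - 0)%C with (Omega F s) in HL by ring.
    eapply Rle_lt_trans. apply HL.
    assert (r2 := sqrt_sqrt (1 + s) ltac:(lra)). unfold psi. set (r := sqrt (1 + s)) in *.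
    assert (Pr : 0 < r) by (apply sqrt_lt_R0; lra).
    assert (Rabs L / eps < r).
    { apply Rnot_le_lt. intros N. assert (P4 : 0 <= Rabs L / eps) by (apply Rdiv_le_0_compat; lra). nra. }
    assert (Rabs L < eps * r).
    { apply (Rmult_lt_compat_l eps) in H; auto. replace (eps * (Rabs L / eps)) with (Rabs L) in H by (field; lra). auto. }
    assert (L <= Rabs L) by apply Rle_abs.
    apply Rle_lt_trans with (eps * r * s). apply Rmult_le_compat_r; lra.
    assert (0 < eps * r) by (apply Rmult_lt_0_compat; auto). lra.
Qed.

Theorem mainTheorem1 :
  (* ---- (a) ---- c = int |v_1'| = var(v_1) *)
  (is_finite (tvar (v 1)) /\
   is_RInt_gen (fun t => Cmod (cderiv (v 1) t))
     (Rbar_locally m_infty) (Rbar_locally p_infty) (real (tvar (v 1)))) /\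
  (forall F, in_Bc F -> forall s : R,
     Cmod (Omega F s) <= real (tvar (v 1)) * alex_norm F * s ^ 2) /\
  (forall F, in_Bc F -> is_derive (Omega F) 0 (RtoC 0)) /\
  (forall c' : R, c' < real (tvar (v 1)) ->
     exists F s, in_Bc F /\ c' * alex_norm F * s ^ 2 < Cmod (Omega F s)) /\
  (* ---- (b) ---- *)
  (forall F, in_Bc F ->
     is_lim (fun s => Cmod (Cminus (Omega F s)
                                   (Cmult (lim_pinf F) (RtoC (s ^ 2 / 2)))) / s ^ 2)
            0 0) /\
  (forall F, in_Bc F ->
     is_lim (fun s => Cmod (Omega F s) / s ^ 2) p_infty 0 /\
     is_lim (fun s => Cmod (Omega F s) / s ^ 2) m_infty 0) /\
  (forall psi : R -> R, (forall s, 0 <= s -> 0 < psi s) ->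
     is_lim (fun s => psi s / s ^ 2) p_infty 0 ->
     exists F g, in_Bc F /\ HK_function_with_primitive g F /\
       ~ is_lim (fun s => Cmod (Omega F s) / psi s) p_infty 0) /\
  (* ---- (c) ---- *)
  (exists k : R, forall F, in_Bc F -> forall s h : R,
     0 < Rabs h < / exp 1 ->
     Cmod (Cminus (Omega F (s + h)) (Omega F s))
       <= k * alex_norm F *
          (Rabs s * Rabs h * Rabs (ln (Rabs h)) + (s ^ 2 + 1) * Rabs h)) /\
  (forall F, in_Bc F ->
     (forall s, continuous (Omega F) s) /\
     (forall a b alpha : R, 0 < alpha < 1 -> exists K : R,
        forall x y, a <= x <= b -> a <= y <= b ->
          Cmod (Cminus (Omega F x) (Omega F y)) <= K * rpow (Rabs (x - y)) alpha)) /\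
  (* ---- (d) ---- *)
  (exists F, in_Bc F /\
     ~ (exists L : R, forall x y,
          Cmod (Cminus (Omega F x) (Omega F y)) <= L * Rabs (x - y))) /\
  (* ---- (e) ---- *)
  (forall rho sigma : R, 1 < rho -> 1 / rho + 1 / sigma = 1 ->
     Lp_integrable rho (cderiv (u 1)) /\ Lp_integrable sigma (u 1) /\
     Lp_integrable rho (u 1) /\ Lp_integrable sigma (cderiv (u 1)) /\
     forall F, in_Bc F -> forall s h : R,
       Cmod (Cminus (Omega F (s + h)) (Omega F s))
         <= alex_norm F *
            (real (tvar (v 1)) * h ^ 2
             + Lnorm rho (cderiv (u 1)) * Lnorm sigma (u 1)
                 * rpow (Rabs h) (2 - 1 / rho) * rpow (Rabs s) (1 / rho)
             + Lnorm rho (u 1) * Lnorm sigma (cderiv (u 1))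
                 * rpow (Rabs h) (1 - 1 / rho) * rpow (Rabs s) (1 + 1 / rho))).
Proof.
  destruct varv1_spec as (Ev & HL & HB). rewrite Ev. cbn [real].
  assert (Ed : cderiv (v 1) = dv1).
  { apply functional_extensionality. intros t. apply cderiv_unique, Cder_v1. }
  rewrite Ed, cderiv_u1.
  split; [|split; [|split; [|split; [|split; [|split; [|split; [|split; [|split; [|split]]]]]]]]].
  - split; [reflexivity|]. apply Rlimint_gen; auto. apply continuous_Cmod, Ccont_dv1.
  - intros F HF s. apply Omega_bound; auto.
  - intros F HF. apply Omega_derive_0; auto.
  - apply best_constant.
  - intros F HF. apply Omega_lim_0; auto.
  - intros F HF. split; apply is_lim_spec; intros eps;
    destruct (Omega_little_o F eps HF (cond_pos eps)) as (M & HM & H).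
    + exists M. intros s Hs. apply H. rewrite Rabs_pos_eq; lra.
    + exists (- M). intros s Hs. apply H. rewrite Rabs_left; lra.
  - apply growth_sharp.
  - apply Omega_log_modulus.
  - intros F HF. split.
    + intros s. apply Omega_continuous; auto.
    + intros a b alpha Ha. destruct (Omega_holder F HF a b alpha Ha) as (K & _ & H). exists K; auto.
  - apply not_Lipschitz.
  - intros rho sigma Hr Hrs. destruct (conj_exponent _ _ Hr Hrs) as [Hs _].
    split; [apply Lp_du1; auto|]. split; [apply Lp_u1; auto|].
    split; [apply Lp_u1; auto|]. split; [apply Lp_du1; auto|].
    intros F HF s h. apply Omega_holder_bound; auto.
Qed.
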